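(* The category of contact manifolds (objects: pairs $(M,H)$ with $H$ a contact structure on $M$) and contactomorphisms is equivalent to the category of symplectic Atiyah bundles (objects: pairs $(L\to M,\omega)$ with $\omega$ a symplectic Atiyah form on the real line bundle $L$) and symplectic Atiyah morphisms.
   Context: All manifolds, bundles and maps are smooth; line bundles are real. Contact manifolds. A contact structure on a manifold $M$ is a hyperplane distribution (corank $1$ subbundle) $H\subseteq TM$ such that the curvature form $\kappa_H:\wedge^2 H\to TM/H$, induced by $(X,Y)\mapsto [X,Y] \bmod H$ for $X,Y\in\Gamma(H)$, is non-degenerate. No global contact $1$-form is assumed, i.e. the line bundle $TM/H$ need not be trivial. A contact manifold is a pair $(M,H)$ with $H$ a contact structure on $M$. A contactomorphism $(M_1,H_1)\to(M_2,H_2)$ is a diffeomorphism $\Phi:M_1\to M_2$ with $d\Phi(H_1)=H_2$. Gauge algebroid. A derivation of a vector bundle $E\to M$ is an $\mathbb R$-linear operator $D:\Gamma(E)\to\Gamma(E)$ for which there is a (necessarily unique) vector field $\sigma(D)\in\mathfrak X(M)$, the symbol of $D$, with $D(fe)=\sigma(D)(f)\,e+f\,D(e)$ for all $f\in C^\infty(M)$, $e\in\Gamma(E)$. Derivations of $E$ are the sections of a Lie algebroid $\mathsf D E\Rightarrow M$ (the gauge, or Atiyah, algebroid), with bracket the commutator and anchor the symbol map $\sigma:\mathsf D E\to TM$. Atiyah forms. Let $L\to M$ be a line bundle. An Atiyah $k$-form on $L$ is an element of $\Omega^k_{\mathsf D}:=\Gamma(\wedge^k(\mathsf D L)^*\otimes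 L)$, i.e. an alternating $L$-valued $k$-form on $\mathsf D L$. The differential $d_{\mathsf D}:\Omega^k_{\mathsf D}\to\Omega^{k+1}_{\mathsf D}$ is $$d_{\mathsf D}\omega(D_1,\dots,D_{k+1})=\sum_{i}(-1)^{i+1}D_i\big(\omega(\dots,\hat D_i,\dots)\big)+\sum_{i<j}(-1)^{i+j}\omega([D_i,D_j],\dots,\hat D_i,\dots,\hat D_j,\dots),$$ where a hat denotes omission. A symplectic Atiyah form on $L$ is an Atiyah $2$-form $\omega$ such that $d_{\mathsf D}\omega=0$ and $\omega$ is non-degenerate, i.e. $\Gamma(\mathsf D L)\to\Gamma(\mathrm{Hom}(\mathsf D L,L))$, $D\mapsto\omega(D,-)$, is an isomorphism. A symplectic Atiyah bundle is a line bundle equipped with a symplectic Atiyah form. Morphisms. A symplectic Atiyah morphism $(L_1\to M_1,\omega_1)\to(L_2\to M_2,\omega_2)$ is a vector bundle isomorphism $F:L_1\to L_2$ (covering a diffeomorphism $M_1\to M_2$) identifying $\omega_1$ with $\omega_2$. That is, denoting also by $F:\Gamma(L_1)\to\Gamma(L_2)$ the induced isomorphism on sections, $\omega_2(F D F^{-1},F D' F^{-1})=F(\omega_1(D,D'))$ for all $D,D'\in\Gamma(\mathsf D L_1)$. *)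

(* Defs.v *)
From HB Require Import structures.
From mathcomp Require Import all_boot all_order all_algebra.
From mathcomp Require Import mathcomp_extra boolp classical_sets functions cardinality.
From mathcomp Require Import ring.
From mathcomp Require Import reals topology normedtype landau derive.

Set Implicit Arguments.
Unset Strict Implicit.
Unset Printing Implicit Defensive.
Import Order.TTheory GRing.Theory Num.Theory.
Import numFieldNormedType.Exports.

Local Open Scope classical_set_scope.
Local Open Scope ring_scope.

Section Calculus.
Context {R : realType}.

(* f is C^k on A, which is open in all uses: f is C^(k+1) iff it is (Frechet)
   differentiable and all its directional derivatives are C^k. *)
Fixpoint Ck {n} (k : nat) (A : set 'rV[R]_n) (f : 'rV[R]_n -> R) : Prop :=
  if k is k'.+1
  then (forall x, A x -> differentiable f x) /\
       (forall v : 'rV[R]_n, Ck k' A ('D_v f))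
  else forall x, A x -> {for x, continuous f}.

Definition smooth_on {n} (A : set 'rV[R]_n) (f : 'rV[R]_n -> R) : Prop :=
  forall k, Ck k A f.

Definition smooth_map_on {m n} (A : set 'rV[R]_m) (g : 'rV[R]_m -> 'rV[R]_n)
  : Prop := forall j : 'I_n, smooth_on A (fun x => g x ord0 j).

Lemma Ck_sub n k (A B : set 'rV[R]_n) f : B `<=` A -> Ck k A f -> Ck k B f.
Proof.
move=> sBA; elim: k f => [|k IH] f /=; first by move=> + x /sBA; apply.
by move=> [df Df]; split=> [x /sBA /df //|v]; apply/IH/Df.
Qed.

Lemma Ck_local n k (A : set 'rV[R]_n) f :
  (forall x, A x -> exists2 B : set 'rV[R]_n, B x & Ck k B f) -> Ck k A f.
Proof.
elim: k f => [|k IH] f /= H.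
  by move=> x /H[B Bx]; apply.
split=> [x /H[B Bx [+ _]]|v]; first exact.
by apply: IH => x /H[B Bx [_ /(_ v)]]; exists B.
Qed.

Lemma near_derive_eq n (A : set 'rV[R]_n) (f g : 'rV[R]_n -> R) v :
  open A -> (forall x, A x -> f x = g x) ->
  forall x, A x -> 'D_v f x = 'D_v g x.
Proof.
move=> oA fg x Ax; apply: near_eq_derive.
by apply: filterS (open_nbhs_nbhs (conj oA Ax)) => y /fg.
Qed.

Lemma near_eq_differentiable (V W : normedModType R) (f g : V -> W) x :
  (\near x, f x = g x) -> differentiable f x -> differentiable g x.
Proof.
move=> fg df.
have fgx : f x = g x by exact: nbhs_singleton fg.
suff [? dg] : continuous ('d f x) /\
    g \o shift x = cst (g x) + ('d f x) +o_ (0 : V) id.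
  by apply/diff_locallyP; rewrite (diff_unique _ dg).
move/diff_locallyP: df => [cf df]; split => //.
apply/eqaddoP => e e0.
move/eqaddoP: df => /(_ e e0).
have : \forall h \near 0, f (h + x) = g (h + x).
  by move: fg; rewrite (near_shift 0) /=; apply: filterS => h /=; rewrite subr0.
apply: filter_app2; near=> h => fgh.
by rewrite !fctE /= fgh fgx.
Unshelve. all: by end_near. Qed.

Lemma Ck_ext n k (A : set 'rV[R]_n) f g : open A ->
  (forall x, A x -> f x = g x) -> Ck k A f -> Ck k A g.
Proof.
move=> oA; elim: k f g => [|k IH] f g fg /=.
  move=> cf x Ax; have cfx := cf x Ax.
  rewrite /prop_for /continuous_at -(fg _ Ax).
  apply: cvg_trans cfx; apply: (@near_eq_cvg _ _ (nbhs x)).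
  by apply: filterS (open_nbhs_nbhs (conj oA Ax)) => y /fg.
move=> [df Df]; split=> [x Ax|v].
  apply: near_eq_differentiable (df x Ax).
  by apply: filterS (open_nbhs_nbhs (conj oA Ax)) => y /fg.
by apply: IH (Df v); exact: near_derive_eq.
Qed.

Lemma CkW n k (A : set 'rV[R]_n) f : Ck k.+1 A f -> Ck k A f.
Proof.
elim: k f => [|k IH] f; first by move=> [df _] x /df /differentiable_continuous.
by move=> [df Df]; split=> // v; apply/IH/Df.
Qed.

Lemma Ck_cst n k (A : set 'rV[R]_n) (c : R) : Ck k A (cst c).
Proof.
elim: k c => [|k IH] c; first by move=> x _; exact: cst_continuous.
split=> // v; have -> // : 'D_v (cst c) = cst 0 :> ('rV[R]_n -> R).
by apply/funext => x; rewrite derive_cst.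
Qed.

Lemma CkD n k (A : set 'rV[R]_n) f g : open A ->
  Ck k A f -> Ck k A g -> Ck k A (f \+ g).
Proof.
move=> oA; elim: k f g => [|k IH] f g.
  by move=> cf cg x Ax; exact: (cvgD (cf x Ax) (cg x Ax)).
move=> [df Df] [dg Dg]; split=> [x Ax|v].
  by apply: differentiableD; [exact: df|exact: dg].
apply: Ck_ext (IH _ _ (Df v) (Dg v)) => // x Ax /=.
by rewrite deriveD //; apply: diff_derivable; [exact: df|exact: dg].
Qed.

Lemma CkM n k (A : set 'rV[R]_n) f g : open A ->
  Ck k A f -> Ck k A g -> Ck k A (f \* g).
Proof.
move=> oA; elim: k f g => [|k IH] f g.
  by move=> cf cg x Ax; exact: (cvgM (cf x Ax) (cg x Ax)).
move=> cf cg; have [df Df] := cf; have [dg Dg] := cg; split=> [x Ax|v].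
  by apply: differentiableM; [exact: df|exact: dg].
have H := CkD oA (IH _ _ (CkW cf) (Dg v)) (IH _ _ (CkW cg) (Df v)).
apply: Ck_ext H => // x Ax /=.
by rewrite deriveM //; apply: diff_derivable; [exact: df|exact: dg].
Qed.

Lemma CkV n k (A : set 'rV[R]_n) f : open A ->
  (forall x, A x -> f x != 0) -> Ck k A f -> Ck k A (fun x => (f x)^-1).
Proof.
move=> oA f0; elim: k => [|k IH].
  by move=> cf x Ax; exact: (cvgV (f0 x Ax) (cf x Ax)).
move=> cf; have [df Df] := cf; split=> [x Ax|v].
  by apply: differentiableV; [exact: df|exact: f0].
have iv := IH (CkW cf).
have H := CkM oA (Ck_cst k A (-1)) (CkM oA (CkM oA iv iv) (Df v)).
apply: Ck_ext H => // x Ax /=.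
rewrite deriveV ?f0//; last exact/diff_derivable/df.
by rewrite mulN1r scaleNr invrM ?unitfE ?f0.
Qed.

Lemma Ck_sum n k (A : set 'rV[R]_n) m (f : 'I_m -> 'rV[R]_n -> R) : open A ->
  (forall i, Ck k A (f i)) -> Ck k A (fun x => \sum_i f i x).
Proof.
move=> oA cf; elim: m f cf => [|m IH] f cf.
  by under eq_fun do rewrite big_ord0; exact: Ck_cst.
under eq_fun do rewrite big_ord_recl.
by apply: (CkD oA (cf _)); apply: IH.
Qed.

Lemma continuous_row m n (g : 'rV[R]_m -> 'rV[R]_n) x :
  (forall j, {for x, continuous (fun y => g y ord0 j)}) -> {for x, continuous g}.
Proof.
move=> cg U [P PU sPU].
have : \forall y \near nbhs x, forall j, P 0 j (g y 0 j).
  by apply: filter_forall => j; apply: (cg j); exact: PU.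
by apply: filterS => y H; apply: sPU => i j; rewrite ord1.
Qed.

Lemma differentiable_row m n (g : 'rV[R]_m -> 'rV[R]_n) x :
  (forall j, differentiable (fun x => g x ord0 j) x) -> differentiable g x.
Proof.
move=> dg; have -> : g = \sum_j (fun x => g x ord0 j *: delta_mx 0 j).
  by apply/funext => y; rewrite fct_sumE [LHS]row_sum_delta.
by apply: differentiable_sum => j; exact: differentiableZl.
Qed.

Lemma Ck_comp m n k (A : set 'rV[R]_m) (B : set 'rV[R]_n)
    (g : 'rV[R]_m -> 'rV[R]_n) f : open A -> (forall x, A x -> B (g x)) ->
  (forall j, Ck k A (fun x => g x ord0 j)) -> Ck k B f -> Ck k A (f \o g).
Proof.
move=> oA gAB; elim: k f => [|k IH] f cg cf.
  move=> x Ax; apply: continuous_comp; last exact/cf/gAB.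
  by apply: continuous_row => j; exact: cg.
have [df Df] := cf.
have dg x : A x -> differentiable g x.
  by move=> Ax; apply: differentiable_row => j; have [+ _] := cg j; exact.
split=> [x Ax|v].
  exact: (differentiable_comp (dg x Ax) (df _ (gAB _ Ax))).
have H : Ck k A (fun x => \sum_j
    'D_v (fun x => g x ord0 j) x * ('D_(delta_mx 0 j) f \o g) x).
  apply: Ck_sum => // j; apply: CkM => //; first by have [_] := cg j; exact.
  by apply: (IH _ _ (Df _)) => i; exact: (CkW (cg i)).
apply: Ck_ext H => // x Ax.
rewrite [RHS]deriveE; last exact: (differentiable_comp (dg x Ax) (df _ (gAB _ Ax))).
rewrite (diff_comp (dg x Ax) (df _ (gAB _ Ax))) /=.
rewrite -(deriveE _ (dg x Ax)).
rewrite derive_mx; last exact: (diff_derivable (dg x Ax)).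
rewrite [X in 'd f _ X]row_sum_delta linear_sum; apply: eq_bigr => j _.
by rewrite linearZ /= -deriveE ?mxE//; exact: (df _ (gAB _ Ax)).
Qed.

End Calculus.

Section Manifolds.
Context {R : realType}.

(* A homeomorphism from an open set of M onto an open subset of R^n; [cmap]
   and [cinv] are total functions, only relevant on [cdom] and its image. *)
Record chart (M : topologicalType) (n : nat) := Chart {
  cdom : set M ;
  cmap :> M -> 'rV[R]_n ;
  cinv : 'rV[R]_n -> M ;
  cdom_open : open cdom ;
  cimg_open : open (cmap @` cdom) ;
  cmapK : forall x, cdom x -> cinv (cmap x) = x ;
  cmap_cont : forall x, cdom x -> {for x, continuous cmap} ;
  cinv_cont : forall y, (cmap @` cdom) y -> {for y, continuous cinv}
}.

Definition smooth_transition M n (c d : chart M n) : Prop :=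
  smooth_map_on (c @` (cdom c `&` cdom d)) (fun y => d (cinv c y)).

Record manifold := Manifold {
  mspace :> topologicalType ;
  mdim : nat ;
  atlas : set (chart mspace mdim) ;
  manifold_hausdorff : hausdorff_space mspace ;
  manifold_second_countable : @second_countable mspace ;
  atlas_cover : forall x, exists2 c, atlas c & cdom c x ;
  (* left to right: compatibility; right to left: maximality *)
  atlas_max : forall c, atlas c <->
    (forall d, atlas d -> smooth_transition c d /\ smooth_transition d c)
}.

(* U is meant to be open; f is only tested on U. *)
Definition msmooth (M : manifold) (U : set M) (f : M -> R) : Prop :=
  forall c, atlas c -> smooth_on (c @` (cdom c `&` U)) (f \o cinv c).

Definition smooth_map (M N : manifold) (phi : M -> N) : Prop :=
  continuous phi /\
  forall (c : chart M (mdim M)) (d : chart N (mdim N)), atlas c -> atlas d ->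
    smooth_map_on (c @` (cdom c `&` phi @^-1` cdom d))
      (fun y => d (phi (cinv c y))).

Lemma cimg_openI (M : topologicalType) n (c : chart M n) (U : set M) :
  open U -> open (c @` (cdom c `&` U)).
Proof.
move=> oU; rewrite openE => _ [x [cx Ux] <-].
have cy : (c @` cdom c) (c x) by exists x.
have nU : nbhs (cinv c (c x)) U by rewrite cmapK//; exact: open_nbhs_nbhs.
have := cinv_cont cy nU; rewrite /interior /=.
have := open_nbhs_nbhs (conj (@cimg_open _ _ c) cy).
apply: filterS2 => _ [z cz <-]; rewrite /= cmapK// => Uz.
by exists z.
Qed.

Section Msmooth.
Variable M : manifold.
Implicit Types (U V : set M) (f g : M -> R).

Lemma msmooth_sub U V f : V `<=` U -> msmooth U f -> msmooth V f.
Proof.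
move=> VU sf c ac k; apply: Ck_sub (sf c ac k).
by move=> _ [x [cx Vx] <-]; exists x => //; split=> //; exact: VU.
Qed.

Lemma msmooth_local U f :
  (forall x, U x -> exists2 V, V x & msmooth V f) -> msmooth U f.
Proof.
move=> H c ac k; apply: Ck_local => _ [x [cx Ux] <-].
have [V Vx sV] := H x Ux.
by exists (c @` (cdom c `&` V)); [exists x|exact: sV].
Qed.

Lemma msmooth_ext U f g : open U ->
  (forall x, U x -> f x = g x) -> msmooth U f -> msmooth U g.
Proof.
move=> oU fg sf c ac k; apply: Ck_ext (sf c ac k); first exact: cimg_openI.
by move=> _ [x [cx Ux] <-] /=; rewrite cmapK// fg.
Qed.

Lemma msmooth_cst U (a : R) : msmooth U (fun=> a).
Proof. by move=> c _ k; exact: Ck_cst. Qed.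

Lemma msmoothD U f g : open U -> msmooth U f -> msmooth U g ->
  msmooth U (fun x => f x + g x).
Proof.
by move=> oU sf sg c ac k; apply: (CkD _ (sf c ac k) (sg c ac k)); exact: cimg_openI.
Qed.

Lemma msmoothM U f g : open U -> msmooth U f -> msmooth U g ->
  msmooth U (fun x => f x * g x).
Proof.
by move=> oU sf sg c ac k; apply: (CkM _ (sf c ac k) (sg c ac k)); exact: cimg_openI.
Qed.

Lemma msmoothV U f : open U -> (forall x, U x -> f x != 0) ->
  msmooth U f -> msmooth U (fun x => (f x)^-1).
Proof.
move=> oU f0 sf c ac k; apply: (CkV _ _ (sf c ac k)); first exact: cimg_openI.
by move=> _ [x [cx Ux] <-] /=; rewrite cmapK//; exact: f0.
Qed.

Lemma msmooth_glue U (P : M -> R -> Prop) : open U ->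
  (forall x a b, U x -> P x a -> P x b -> a = b) ->
  (forall x, U x -> exists V, [/\ open V, V x &
     exists2 g, msmooth V g & forall y, V y -> P y (g y)]) ->
  exists2 g, msmooth U g & forall x, U x -> P x (g x).
Proof.
move=> oU uP H; pose g x := xget 0 [set a | P x a].
have gP x : U x -> P x (g x).
  move=> Ux; have [V [_ Vx [h _ hP]]] := H x Ux.
  exact: (xgetPex 0 (ex_intro _ (h x) (hP x Vx))).
exists g => //; apply: msmooth_local => x Ux.
have [V [oV Vx [h sh hP]]] := H x Ux.
exists (V `&` U) => //; apply: (msmooth_ext (f := h)).
- exact: openI.
- by move=> y [Vy Uy]; apply: uP (hP y Vy) (gP y Uy).
- by apply: msmooth_sub sh => y [].
Qed.

End Msmooth.

Lemma msmooth_comp (M N : manifold) (phi : M -> N) (U : set N) (f : N -> R) :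
  smooth_map phi -> open U -> msmooth U f -> msmooth (phi @^-1` U) (f \o phi).
Proof.
move=> [cphi sphi] oU sf c ac k; apply: Ck_local => _ [x [cx Ux] <-].
have [d ad dx] := atlas_cover (phi x).
have oW : open (phi @^-1` (cdom d `&` U)).
  by apply: open_comp => //; apply: openI => //; exact: cdom_open.
exists (c @` (cdom c `&` phi @^-1` (cdom d `&` U))); first by exists x.
have H := Ck_comp (B := d @` (cdom d `&` U))
  (g := fun y => d (phi (cinv c y))) (cimg_openI (c := c) oW) _ _ (sf d ad k).
apply: Ck_ext (H _ _); first exact: cimg_openI.
- by move=> _ [z [cz [dz Uz]] <-] /=; rewrite !cmapK.
- by move=> _ [z [cz [dz Uz]] <-] /=; rewrite !cmapK//; exists (phi z).
- move=> j; apply: Ck_sub (sphi c d ac ad j k).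
  by move=> _ [z [cz [dz Uz]] <-]; exists z.
Qed.

Lemma smooth_map_comp (M N P : manifold) (psi : N -> P) (phi : M -> N) :
  smooth_map psi -> smooth_map phi -> smooth_map (psi \o phi).
Proof.
move=> [cpsi spsi] sphi; have [cphi _] := sphi; split.
  by move=> x; apply: continuous_comp; [exact: cphi|exact: cpsi].
move=> c d ac ad j.
apply: (msmooth_comp (U := psi @^-1` cdom d) (f := fun z => d (psi z) ord0 j)) => //.
  by apply: open_comp => //; exact: cdom_open.
by move=> c' ac'; exact: (spsi c' d).
Qed.

Lemma smooth_map_id (M : manifold) : smooth_map (@idfun M).
Proof.
split; first by move=> x; exact: cvg_id.
by move=> c d ac ad; have [] := (atlas_max c).1 ac d ad.
Qed.

Definition is_diffeo (M N : manifold) (phi : M -> N) (psi : N -> M) : Prop :=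
  [/\ cancel phi psi, cancel psi phi, smooth_map phi & smooth_map psi].

Record diffeo (M N : manifold) := Diffeo {
  dmap :> M -> N ;
  dinv : N -> M ;
  diffeoP : is_diffeo dmap dinv
}.

Lemma is_diffeo_id (M : manifold) : is_diffeo (@idfun M) idfun.
Proof. by split=> //; exact: smooth_map_id. Qed.

Definition diffeo_id (M : manifold) : diffeo M M := Diffeo (is_diffeo_id M).

Lemma is_diffeo_comp (M N P : manifold) (g : diffeo N P) (f : diffeo M N) :
  is_diffeo (g \o f) (dinv f \o dinv g).
Proof.
case: g f => [g g' [gK g'K sg sg']] [f f' [fK f'K sf sf']] /=; split.
- exact: can_comp.
- exact: can_comp.
- exact: smooth_map_comp.
- exact: smooth_map_comp.
Qed.

Definition diffeo_comp (M N P : manifold) (g : diffeo N P) (f : diffeo M N) :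
  diffeo M P := Diffeo (is_diffeo_comp g f).

Lemma dmapK (M N : manifold) (f : diffeo M N) : cancel f (dinv f).
Proof. by case: f => f g []. Qed.
Lemma dinvK (M N : manifold) (f : diffeo M N) : cancel (dinv f) f.
Proof. by case: f => f g []. Qed.
Lemma dmap_smooth (M N : manifold) (f : diffeo M N) : smooth_map f.
Proof. by case: f => f g []. Qed.
Lemma dinv_smooth (M N : manifold) (f : diffeo M N) : smooth_map (dinv f).
Proof. by case: f => f g []. Qed.

Definition cinf_pred (M : manifold) : {pred M -> R} :=
  [pred f | `[< msmooth setT f >]].
Arguments cinf_pred M : clear implicits.

Record cinf (M : manifold) := CInf {
  cinf_fun :> M -> R ;
  cinf_subproof : cinf_fun \in cinf_pred M
}.

End Manifolds.
Arguments manifold R : clear implicits.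

Section CInfAlgebra.
Context {R : realType} {M : manifold R}.

HB.instance Definition _ := [isSub for @cinf_fun R M].
HB.instance Definition _ := [Choice of cinf M by <:].

Lemma cinf_smooth (f : cinf M) : msmooth setT f.
Proof. by case: f => f sf; apply/asboolP. Qed.

Lemma cinf_eq (f g : cinf M) : (forall x, f x = g x) -> f = g.
Proof. by move=> fg; apply/val_inj/funext. Qed.

Fact cinf_subring : subring_closed (@cinf_pred R M).
Proof.
split=> [|f g /asboolP sf /asboolP sg|f g /asboolP sf /asboolP sg]; apply/asboolP.
- exact: msmooth_cst.
- have sN : msmooth setT (fun x => -1 * g x).
    by apply: msmoothM sg => //; [exact: openT|exact: msmooth_cst].
  apply: msmooth_ext (msmoothD openT sf sN); first exact: openT.
  by move=> x _; rewrite mulN1r.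
- exact: (msmoothM openT sf sg).
Qed.
HB.instance Definition _ := GRing.SubChoice_isSubComPzRing.Build
  (M -> R) (@cinf_pred R M) (cinf M) cinf_subring.

Fact cinf_submod : subsemimod_closed (@cinf_pred R M).
Proof.
split; first split; first by apply/asboolP; exact: msmooth_cst.
  move=> f g /asboolP sf /asboolP sg; apply/asboolP.
  exact: (msmoothD openT sf sg).
move=> a f /asboolP sf; apply/asboolP.
by apply: (msmoothM openT _ sf); exact: msmooth_cst.
Qed.
HB.instance Definition _ := GRing.SubZmodule_isSubLmodule.Build
  R (M -> R) (@cinf_pred R M) (cinf M) cinf_submod.

Lemma cinfDE (f g : cinf M) x : (f + g) x = f x + g x. Proof. by []. Qed.
Lemma cinfNE (f : cinf M) x : (- f) x = - f x. Proof. by []. Qed.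
Lemma cinfME (f g : cinf M) x : (f * g) x = f x * g x. Proof. by []. Qed.
Lemma cinfZE (a : R) (f : cinf M) x : (a *: f) x = a * f x. Proof. by []. Qed.
Lemma cinf1E x : (1 : cinf M) x = 1. Proof. by []. Qed.

Definition cinf_cst (a : R) : cinf M := a *: (1 : cinf M).

Definition mk_cinf (f : M -> R) (sf : msmooth setT f) : cinf M :=
  CInf (introT (asboolP _) sf).

End CInfAlgebra.

Definition cinf_pull {R : realType} {M N : manifold R} (phi : diffeo M N)
    (f : cinf N) : cinf M :=
  mk_cinf (msmooth_comp (dmap_smooth phi) openT (cinf_smooth f)).

Section Tangent.
Context {R : realType} {M : manifold R}.

(* T_x M is the space of point derivations of C^oo(M) at x. *)
Record tangent (x : M) := Tangent {
  tfun :> cinf M -> R ;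
  tangentP : (forall (a : R) (f g : cinf M),
                 tfun (a *: f + g) = a * tfun f + tfun g) /\
             (forall f g : cinf M, tfun (f * g) = f x * tfun g + g x * tfun f)
}.

HB.instance Definition _ x := gen_eqMixin (tangent x).
HB.instance Definition _ x := gen_choiceMixin (tangent x).

Lemma tangent_eq x (v w : tangent x) : (forall f, v f = w f) -> v = w.
Proof.
case: v w => [v vP] [w wP] /= /funext vw; subst w.
by rewrite (Prop_irrelevance vP wP).
Qed.

Section TangentSpace.
Variable x : M.
Implicit Types u v w : tangent x.

Lemma tlinear v (a : R) f g : v (a *: f + g) = a * v f + v g.
Proof. by case: v => v []. Qed.
Lemma tD v f g : v (f + g) = v f + v g.
Proof. by rewrite -{1}(scale1r f) tlinear mul1r. Qed.
Lemma tleibniz v f g : v (f * g) = f x * v g + g x * v f.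
Proof. by case: v => v []. Qed.

Program Definition tzero : tangent x := @Tangent x (fun=> 0) _.
Next Obligation. by split=> *; rewrite !mulr0 addr0. Qed.
Program Definition topp v : tangent x := @Tangent x (fun f => - v f) _.
Next Obligation.
by move=> v; split=> *; rewrite ?tlinear ?tleibniz; ring.
Qed.
Program Definition tadd v w : tangent x := @Tangent x (fun f => v f + w f) _.
Next Obligation.
by move=> v w; split=> *; rewrite ?tlinear ?tleibniz; ring.
Qed.
Program Definition tscale (a : R) v : tangent x :=
  @Tangent x (fun f => a * v f) _.
Next Obligation.
by move=> a v; split=> *; rewrite ?tlinear ?tleibniz; ring.
Qed.

Fact taddA : associative tadd.
Proof. by move=> u v w; apply: tangent_eq => f /=; rewrite addrA. Qed.
Fact taddC : commutative tadd.
Proof. by move=> u v; apply: tangent_eq => f /=; rewrite addrC. Qed.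
Fact tadd0 : left_id tzero tadd.
Proof. by move=> u; apply: tangent_eq => f /=; rewrite add0r. Qed.
Fact taddN : left_inverse tzero topp tadd.
Proof. by move=> u; apply: tangent_eq => f /=; rewrite addNr. Qed.
HB.instance Definition _ :=
  GRing.isZmodule.Build (tangent x) taddA taddC tadd0 taddN.

Fact tscaleA a b v : tscale a (tscale b v) = tscale (a * b) v.
Proof. by apply: tangent_eq => f /=; rewrite mulrA. Qed.
Fact tscale1 : left_id 1 tscale.
Proof. by move=> v; apply: tangent_eq => f /=; rewrite mul1r. Qed.
Fact tscaleDr : right_distributive tscale +%R.
Proof. by move=> a v w; apply: tangent_eq => f /=; rewrite mulrDr. Qed.
Fact tscaleDl v : {morph tscale^~ v : a b / a + b}.
Proof. by move=> a b; apply: tangent_eq => f /=; rewrite mulrDl. Qed.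
HB.instance Definition _ := GRing.Zmodule_isLmodule.Build R (tangent x)
  tscaleA tscale1 tscaleDr tscaleDl.

End TangentSpace.

(* v is a section of TM, smooth on the open set U iff v(f) is smooth on U for
   all f in C^oo(M); global test functions suffice, since germs extend. *)
Definition smooth_vf_on (U : set M) (v : forall x, tangent x) : Prop :=
  forall f : cinf M, msmooth U (fun x => v x f).

Record vfield := VField {
  vf :> forall x, tangent x ;
  vf_smooth : smooth_vf_on setT vf
}.

Lemma vfield_eq (X Y : vfield) : (forall x f, X x f = Y x f) -> X = Y.
Proof.
case: X Y => [X sX] [Y sY] /= XY.
have E : X = Y by apply/functional_extensionality_dep => x; exact: tangent_eq.
by subst Y; rewrite (Prop_irrelevance sX sY).
Qed.

Definition vf_app (X : vfield) (f : cinf M) : cinf M := mk_cinf (vf_smooth X f).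

Lemma vf_appE X f x : vf_app X f x = X x f. Proof. by []. Qed.
Lemma vf_app_linear X (a : R) f g :
  vf_app X (a *: f + g) = a *: vf_app X f + vf_app X g.
Proof. by apply: cinf_eq => x; rewrite /= tlinear. Qed.
Lemma vf_app_leibniz X f g : vf_app X (f * g) = f * vf_app X g + g * vf_app X f.
Proof. by apply: cinf_eq => x; rewrite /= tleibniz. Qed.

Lemma cinf_val_smooth (f : M -> R) (g : cinf M) : f = g -> msmooth setT f.
Proof. by move=> ->; exact: cinf_smooth. Qed.

Program Definition vf_zero : vfield := @VField (fun=> 0) _.
Next Obligation. by move=> f; exact: msmooth_cst. Qed.

Program Definition vf_add (X Y : vfield) : vfield :=
  @VField (fun x => X x + Y x) _.
Next Obligation.
by move=> X Y f; apply: (@cinf_val_smooth _ (vf_app X f + vf_app Y f)).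
Qed.

Program Definition vf_scale (h : cinf M) (X : vfield) : vfield :=
  @VField (fun x => h x *: X x) _.
Next Obligation.
by move=> h X f; apply: (@cinf_val_smooth _ (h * vf_app X f)).
Qed.

Program Definition lie_at (X Y : vfield) (x : M) : tangent x :=
  @Tangent x (fun f => X x (vf_app Y f) - Y x (vf_app X f)) _.
Next Obligation.
move=> X Y x; split=> *; rewrite ?vf_app_linear ?vf_app_leibniz ?tlinear.
  by ring.
by rewrite !tD !tleibniz !vf_appE; ring.
Qed.

Program Definition vf_bracket (X Y : vfield) : vfield := @VField (lie_at X Y) _.
Next Obligation.
move=> X Y f.
exact: (@cinf_val_smooth _ (vf_app X (vf_app Y f) - vf_app Y (vf_app X f))).
Qed.

Definition has_local_frames (k : nat) (H : forall x : M, set (tangent x)) : Prop :=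
  forall x, exists U : set M, [/\ open U, U x &
    exists X : 'I_k -> forall y, tangent y,
      (forall i, smooth_vf_on U (X i)) /\
      (forall y, U y -> (forall i, H y (X i y)) /\
         forall w, H y w -> exists! a : 'rV[R]_k, w = \sum_i a ord0 i *: X i y)].

Definition is_subspace (V : lmodType R) (S : set V) : Prop :=
  S 0 /\ forall (a : R) u v, S u -> S v -> S (a *: u + v).

Definition corank1 (V : lmodType R) (S : set V) : Prop :=
  exists2 u, ~ S u & forall w, exists a : R, S (w - a *: u).

Definition hyperplane_distribution (H : forall x : M, set (tangent x)) : Prop :=
  [/\ forall x, is_subspace (H x), forall x, corank1 (H x) &
      has_local_frames (mdim M).-1 H].

Definition tangent_to (H : forall x : M, set (tangent x)) (X : vfield) : Prop :=
  forall x, H x (X x).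

(* kappa_H (v, w) in T_x M / H_x, the latter being realized as a set of cosets:
   the class of [X, Y]_x for sections X, Y of H extending v, w. *)
Definition curvature (H : forall x : M, set (tangent x)) (x : M)
    (v w : tangent x) : set (tangent x) :=
  [set u | exists X Y : vfield, [/\ tangent_to H X, tangent_to H Y,
     X x = v, Y x = w & H x (u - vf_bracket X Y x)]].

(* the zero of T_x M / H_x is the coset H x *)
Definition curvature_nondegenerate (H : forall x : M, set (tangent x)) : Prop :=
  forall x v, H x v -> (forall w, H x w -> curvature H v w = H x) -> v = 0.

Definition contact_structure (H : forall x : M, set (tangent x)) : Prop :=
  hyperplane_distribution H /\ curvature_nondegenerate H.

End Tangent.
Arguments tangent {R} M x.
Arguments vfield {R} M.

Section PushForward.
Context {R : realType} {M N : manifold R} (phi : diffeo M N).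

Lemma cinf_pull_linear (a : R) (f g : cinf N) :
  cinf_pull phi (a *: f + g) = a *: cinf_pull phi f + cinf_pull phi g.
Proof. exact: cinf_eq. Qed.
Lemma cinf_pullM (f g : cinf N) :
  cinf_pull phi (f * g) = cinf_pull phi f * cinf_pull phi g.
Proof. exact: cinf_eq. Qed.

Program Definition dphi (x : M) (v : tangent M x) : tangent N (phi x) :=
  @Tangent R N (phi x) (fun f => v (cinf_pull phi f)) _.
Next Obligation.
by move=> x v; split=> *; rewrite ?cinf_pull_linear ?cinf_pullM ?tlinear ?tleibniz.
Qed.

Program Definition vf_push_at (X : vfield M) (y : N) : tangent N y :=
  @Tangent R N y (fun f => X (dinv phi y) (cinf_pull phi f)) _.
Next Obligation.
move=> X y; split=> *; rewrite ?cinf_pull_linear ?cinf_pullM ?tlinear ?tleibniz//.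
by rewrite /= !dinvK.
Qed.

Program Definition vf_push (X : vfield M) : vfield N := @VField R N (vf_push_at X) _.
Next Obligation.
move=> X f.
exact: (msmooth_comp (dinv_smooth phi) openT (vf_smooth X (cinf_pull phi f))).
Qed.

Lemma vf_push_dphi (X : vfield M) (x : M) : vf_push X (phi x) = dphi (X x).
Proof.
apply: tangent_eq => f /=.
by rewrite dmapK.
Qed.

End PushForward.

(* A smooth real line bundle: one-dimensional real vector spaces L x, with a
   bundle atlas.  A local trivialization U x R ~ L|_U is encoded by (U, e)
   where e x is the image of (x, 1), so that e is a nowhere zero section over U
   (its values outside U are irrelevant). *)
Record line_bundle {R : realType} (M : manifold R) := LineBundle {
  fiber :> M -> lmodType R ;
  trivs : set (set M * (forall x, fiber x)) ;
  triv_open : forall t, trivs t -> open t.1 ;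
  triv_basis : forall t, trivs t -> forall x, t.1 x ->
    forall v : fiber x, exists! a : R, v = a *: t.2 x ;
  triv_cover : forall x, exists2 t, trivs t & t.1 x ;
  triv_compat : forall s t, trivs s -> trivs t ->
    exists2 g : M -> R, msmooth (s.1 `&` t.1) g &
      forall x, s.1 x -> t.1 x -> t.2 x = g x *: s.2 x
}.

Section Sections.
Context {R : realType} {M : manifold R} (L : line_bundle M).

Definition smooth_section (s : forall x, L x) : Prop :=
  forall t, trivs t -> exists2 g : M -> R, msmooth t.1 g &
    forall x, t.1 x -> s x = g x *: t.2 x.

Lemma triv_inj t x (a b : R) :
  trivs t -> t.1 x -> a *: t.2 x = b *: t.2 x :> L x -> a = b.
Proof.
move=> Tt tx ab; have [c [_ uc]] := triv_basis Tt tx (a *: t.2 x).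
by rewrite -(uc a erefl) -(uc b ab).
Qed.

Lemma smooth_section_local (s : forall x, L x) :
  (forall x, exists t (V : set M), [/\ trivs t, t.1 x, open V, V x &
     exists2 g : M -> R, msmooth V g & forall y, V y -> s y = g y *: t.2 y]) ->
  smooth_section s.
Proof.
move=> H t Tt; apply: (msmooth_glue (P := fun x a => s x = a *: t.2 x)).
- exact: triv_open.
- by move=> x a b tx -> /(triv_inj Tt tx).
move=> x tx; have [u [V [Tu ux oV Vx [g sg gP]]]] := H x.
have [h sh hP] := triv_compat Tt Tu.
have oW : open (V `&` (t.1 `&` u.1)).
  by apply: openI => //; apply: openI; exact: triv_open.
exists (V `&` (t.1 `&` u.1)); split=> //.
exists (fun y => g y * h y).
  apply: msmoothM => //; first by apply: msmooth_sub sg => y [].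
  by apply: msmooth_sub sh => y [].
by move=> y [Vy [ty uy]]; rewrite gP// hP// scalerA.
Qed.

Record Gamma := Section_ {
  sec :> forall x, L x ;
  sec_smooth : smooth_section sec
}.

HB.instance Definition _ := gen_eqMixin Gamma.
HB.instance Definition _ := gen_choiceMixin Gamma.

Lemma sec_eq (s t : Gamma) : (forall x, s x = t x) -> s = t.
Proof.
case: s t => [s sP] [t tP] /= st.
have E : s = t by exact: functional_extensionality_dep.
subst t.
by rewrite (Prop_irrelevance sP tP).
Qed.

Program Definition sec_zero : Gamma := @Section_ (fun=> 0) _.
Next Obligation.
move=> t Tt; exists (fun=> 0); first exact: msmooth_cst.
by move=> x tx; rewrite scale0r.
Qed.
Program Definition sec_add (s t : Gamma) : Gamma :=
  @Section_ (fun x => s x + t x) _.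
Next Obligation.
move=> s u t Tt; have [g sg gP] := sec_smooth s Tt.
have [h sh hP] := sec_smooth u Tt.
exists (fun x => g x + h x); first exact: (msmoothD (triv_open Tt)).
by move=> x tx; rewrite gP// hP// scalerDl.
Qed.
Program Definition sec_scale (f : cinf M) (s : Gamma) : Gamma :=
  @Section_ (fun x => f x *: s x) _.
Next Obligation.
move=> f s t Tt; have [g sg gP] := sec_smooth s Tt.
exists (fun x => f x * g x).
  apply: (msmoothM (triv_open Tt)) => //.
  by apply: msmooth_sub (cinf_smooth f).
by move=> x tx; rewrite gP// scalerA.
Qed.
Definition sec_opp (s : Gamma) : Gamma := sec_scale (- 1) s.

Fact sec_addA : associative sec_add.
Proof. by move=> s t u; apply: sec_eq => x /=; rewrite addrA. Qed.
Fact sec_addC : commutative sec_add.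
Proof. by move=> s t; apply: sec_eq => x /=; rewrite addrC. Qed.
Fact sec_add0 : left_id sec_zero sec_add.
Proof. by move=> s; apply: sec_eq => x /=; rewrite add0r. Qed.
Fact sec_addN : left_inverse sec_zero sec_opp sec_add.
Proof.
move=> s; apply: sec_eq => x.
by rewrite -[LHS]/((-1 : R) *: s x + s x) scaleN1r addNr.
Qed.
HB.instance Definition _ :=
  GRing.isZmodule.Build Gamma sec_addA sec_addC sec_add0 sec_addN.

Fact sec_scaleA f g s : sec_scale f (sec_scale g s) = sec_scale (f * g) s.
Proof. by apply: sec_eq => x /=; rewrite scalerA. Qed.
Fact sec_scale1 : left_id 1 sec_scale.
Proof. by move=> s; apply: sec_eq => x; exact: scale1r. Qed.
Fact sec_scaleDr : right_distributive sec_scale +%R.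
Proof. by move=> f s t; apply: sec_eq => x /=; rewrite scalerDr. Qed.
Fact sec_scaleDl s : {morph sec_scale^~ s : f g / f + g}.
Proof. by move=> f g; apply: sec_eq => x; exact: scalerDl. Qed.
HB.instance Definition _ := GRing.Zmodule_isLmodule.Build (cinf M) Gamma
  sec_scaleA sec_scale1 sec_scaleDr sec_scaleDl.

Lemma secDE (s t : Gamma) x : (s + t) x = s x + t x. Proof. by []. Qed.
Lemma secZE (f : cinf M) (s : Gamma) x : (f *: s) x = f x *: s x.
Proof. by []. Qed.

Definition is_symbol (D : Gamma -> Gamma) (X : vfield M) : Prop :=
  forall (f : cinf M) (s : Gamma), D (f *: s) = vf_app X f *: s + f *: D s.

Definition real_linear (D : Gamma -> Gamma) : Prop :=
  forall (a : R) (s t : Gamma), D (cinf_cst a *: s + t) = cinf_cst a *: D s + D t.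

(* The sections of the gauge algebroid DL. *)
Record derivation := Derivation {
  der :> Gamma -> Gamma ;
  derP : real_linear der /\ exists X, is_symbol der X
}.

HB.instance Definition _ := gen_eqMixin derivation.
HB.instance Definition _ := gen_choiceMixin derivation.

Lemma der_eq (D E : derivation) : (forall s, D s = E s) -> D = E.
Proof.
case: D E => [D DP] [E EP] /= /funext DE; subst E.
by rewrite (Prop_irrelevance DP EP).
Qed.

Lemma der_linear (D : derivation) (a : R) s t :
  D (cinf_cst a *: s + t) = cinf_cst a *: D s + D t.
Proof. by case: D => D []. Qed.

Lemma derD (D : derivation) s t : D (s + t) = D s + D t.
Proof. by have := der_linear D 1 s t; rewrite /cinf_cst !scale1r. Qed.

Program Definition der_zero : derivation := @Derivation (fun=> 0) _.
Next Obligation.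
split=> [a s t|]; first by rewrite scaler0 addr0.
exists vf_zero => f s; rewrite scaler0 addr0.
by apply: sec_eq => x; rewrite secZE scale0r.
Qed.
Program Definition der_add (D E : derivation) : derivation :=
  @Derivation (fun s => D s + E s) _.
Next Obligation.
move=> D E; split=> [a s t|]; first by rewrite !der_linear scalerDr addrACA.
have [_ [X DX]] := derP D; have [_ [Y EY]] := derP E.
exists (vf_add X Y) => f s; rewrite DX EY addrACA -scalerDl -scalerDr.
by congr (_ *: _ + _); exact: cinf_eq.
Qed.
Program Definition der_scale (f : cinf M) (D : derivation) : derivation :=
  @Derivation (fun s => f *: D s) _.
Next Obligation.
move=> h D; split=> [a s t|].
  by rewrite der_linear scalerDr !scalerA mulrC.
have [_ [X DX]] := derP D.
exists (vf_scale h X) => f s; rewrite DX scalerDr !scalerA [h * f]mulrC.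
by congr (_ *: _ + _); exact: cinf_eq.
Qed.
Definition der_opp (D : derivation) : derivation := der_scale (- 1) D.

Fact der_addA : associative der_add.
Proof. by move=> C D E; apply: der_eq => s /=; rewrite addrA. Qed.
Fact der_addC : commutative der_add.
Proof. by move=> C D; apply: der_eq => s /=; rewrite addrC. Qed.
Fact der_add0 : left_id der_zero der_add.
Proof. by move=> C; apply: der_eq => s /=; rewrite add0r. Qed.
Fact der_addN : left_inverse der_zero der_opp der_add.
Proof. by move=> C; apply: der_eq => s /=; rewrite scaleN1r addNr. Qed.
HB.instance Definition _ :=
  GRing.isZmodule.Build derivation der_addA der_addC der_add0 der_addN.

Fact der_scaleA f g D : der_scale f (der_scale g D) = der_scale (f * g) D.
Proof. by apply: der_eq => s /=; rewrite scalerA. Qed.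
Fact der_scale1 : left_id 1 der_scale.
Proof. by move=> D; apply: der_eq => s /=; rewrite scale1r. Qed.
Fact der_scaleDr : right_distributive der_scale +%R.
Proof. by move=> f D E; apply: der_eq => s /=; rewrite scalerDr. Qed.
Fact der_scaleDl D : {morph der_scale^~ D : f g / f + g}.
Proof. by move=> f g; apply: der_eq => s /=; rewrite scalerDl. Qed.
HB.instance Definition _ := GRing.Zmodule_isLmodule.Build (cinf M) derivation
  der_scaleA der_scale1 der_scaleDr der_scaleDl.

Program Definition der_bracket (D E : derivation) : derivation :=
  @Derivation (fun s => D (E s) - E (D s)) _.
Next Obligation.
move=> D E; split=> [a s t|].
  by rewrite !der_linear opprD addrACA scalerBr.
have [_ [X DX]] := derP D; have [_ [Y EY]] := derP E.
exists (vf_bracket X Y) => f s; rewrite DX EY !derD !DX !EY.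
have -> : vf_app (vf_bracket X Y) f =
    vf_app X (vf_app Y f) - vf_app Y (vf_app X f) by exact: cinf_eq.
rewrite scalerBl scalerBr [X in _ + X - _]addrC addrACA.
rewrite [X in _ - (_ + X)]addrC [X in _ - X]addrACA [X in _ - X]addrC.
by rewrite [X in _ - (X + _)]addrC addrKA opprD addrACA.
Qed.

(* Atiyah 2-forms: Gamma(wedge^2 (DL)^* (x) L) is the module of alternating
   C^oo(M)-bilinear maps Gamma(DL) x Gamma(DL) -> Gamma(L). *)
Record atiyah2 := Atiyah2 {
  aform :> derivation -> derivation -> Gamma ;
  aform_linearl : forall E, linear (aform^~ E) ;
  aform_linearr : forall D, linear (aform D) ;
  aform_alt : forall D, aform D D = 0
}.

(* The differential d_D in degree 2. *)
Definition d_atiyah2 (w : atiyah2) (D1 D2 D3 : derivation) : Gamma :=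
  D1 (w D2 D3) - D2 (w D1 D3) + D3 (w D1 D2)
  - w (der_bracket D1 D2) D3 + w (der_bracket D1 D3) D2
  - w (der_bracket D2 D3) D1.

Definition atiyah_closed (w : atiyah2) : Prop :=
  forall D1 D2 D3, d_atiyah2 w D1 D2 D3 = 0.

(* D |-> w (D, -) is bijective onto
   Gamma(Hom(DL, L)) = Hom_{C^oo(M)}(Gamma(DL), Gamma(L)) *)
Definition atiyah_nondegenerate (w : atiyah2) : Prop :=
  forall alpha : {linear derivation -> Gamma},
    exists! D : derivation, forall E, w D E = alpha E.

Definition symplectic_atiyah (w : atiyah2) : Prop :=
  atiyah_closed w /\ atiyah_nondegenerate w.

End Sections.

Section BundleIso.
Context {R : realType}.

(* The fibrewise inverse of a smooth fibrewise invertible bundle map is smooth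
   (lemma lb_inv_smooth below), so only the smoothness of F is required. *)
Definition is_lb_iso (M N : manifold R) (L1 : line_bundle M) (L2 : line_bundle N)
    (phi : diffeo M N) (F : forall x, L1 x -> L2 (phi x))
    (F' : forall x, L2 (phi x) -> L1 x) : Prop :=
  [/\ forall x, linear (F x), forall x, cancel (F x) (F' x),
      forall x, cancel (F' x) (F x) &
      forall s t, trivs s -> trivs t ->
        exists2 g : M -> R, msmooth (s.1 `&` phi @^-1` t.1) g &
          forall x, s.1 x -> t.1 (phi x) -> F x (s.2 x) = g x *: t.2 (phi x)].

Record lb_iso (M N : manifold R) (L1 : line_bundle M) (L2 : line_bundle N) :=
  LbIso {
    lb_base :> diffeo M N ;
    lb_fun : forall x, L1 x -> L2 (lb_base x) ;
    lb_inv : forall x, L2 (lb_base x) -> L1 x ;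
    lb_isoP : is_lb_iso lb_fun lb_inv
  }.

Arguments lb_fun {M N L1 L2} l x _.
Arguments lb_inv {M N L1 L2} l x _.

Section Push.
Context {M N : manifold R} {L1 : line_bundle M} {L2 : line_bundle N}.
Variable F : lb_iso L1 L2.

Lemma lb_linear x (a : R) u v :
  lb_fun F x (a *: u + v) = a *: lb_fun F x u + lb_fun F x v.
Proof. by have [lF _ _ _] := lb_isoP F; exact: lF. Qed.
Lemma lb_scale x (a : R) u : lb_fun F x (a *: u) = a *: lb_fun F x u.
Proof.
have F0 : lb_fun F x 0 = 0.
  apply: (addIr (lb_fun F x 0)); rewrite add0r.
  by have := lb_linear 1 (0 : L1 x) 0; rewrite !scale1r addr0 => <-.
by rewrite -[a *: u]addr0 lb_linear F0 addr0.
Qed.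
Lemma lb_add x u v : lb_fun F x (u + v) = lb_fun F x u + lb_fun F x v.
Proof. by have := lb_linear 1 u v; rewrite !scale1r. Qed.
Lemma lb_funK x : cancel (lb_fun F x) (lb_inv F x).
Proof. by have [_ FK _ _] := lb_isoP F. Qed.
Lemma lb_invK x : cancel (lb_inv F x) (lb_fun F x).
Proof. by have [_ _ FK _] := lb_isoP F. Qed.
Lemma lb_smooth s t : trivs s -> trivs t ->
  exists2 g : M -> R, msmooth (s.1 `&` F @^-1` t.1) g &
    forall x, s.1 x -> t.1 (F x) -> lb_fun F x (s.2 x) = g x *: t.2 (F x).
Proof. by have [_ _ _ sF] := lb_isoP F; exact: sF. Qed.

Lemma lb_open_pre (U : set N) : open U -> open (F @^-1` U).
Proof.
by move=> oU; apply: open_comp => // x _; have [+ _] := dmap_smooth F; exact.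
Qed.

Lemma lb_inv_smooth s t : trivs s -> trivs t ->
  exists2 g : M -> R, msmooth (s.1 `&` F @^-1` t.1) g &
    forall x, s.1 x -> t.1 (F x) -> lb_inv F x (t.2 (F x)) = g x *: s.2 x.
Proof.
move=> Ts Tt; have [g sg gP] := lb_smooth Ts Tt.
have g0 x : s.1 x -> t.1 (F x) -> g x != 0.
  move=> sx tx; apply/eqP => gx0.
  have s0 : s.2 x = 0.
    apply: (can_inj (@lb_funK x)); rewrite gP// gx0 scale0r.
    by rewrite -[0 in RHS](scale0r (0 : L1 x)) lb_scale scale0r.
  have := triv_inj (a := 1) (b := 0) Ts sx.
  by rewrite s0 !scaler0 => /(_ erefl)/eqP; rewrite oner_eq0.
exists (fun x => (g x)^-1).
  apply: msmoothV => //; last by move=> x [sx tx]; exact: g0.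
  by apply: openI; [exact: triv_open|exact/lb_open_pre/triv_open].
move=> x sx tx; apply: (can_inj (@lb_funK x)).
by rewrite lb_invK lb_scale gP// scalerA mulVf ?scale1r ?g0.
Qed.

(* F^-1 : Gamma(L2) -> Gamma(L1) *)
Definition sec_pull_fun (s : Gamma L2) (x : M) : L1 x := lb_inv F x (s (F x)).

Lemma sec_pull_smooth s : smooth_section (sec_pull_fun s).
Proof.
apply: smooth_section_local => x.
have [t Tt tx] := triv_cover L1 x; have [u Tu ux] := triv_cover L2 (F x).
have [g sg gP] := lb_inv_smooth Tt Tu; have [h sh hP] := sec_smooth s Tu.
have oW : open (t.1 `&` F @^-1` u.1).
  by apply: openI; [exact: triv_open|exact/lb_open_pre/triv_open].
exists t, (t.1 `&` F @^-1` u.1); split=> //.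
exists (fun y => h (F y) * g y).
  apply: msmoothM => //.
  apply: (msmooth_sub (U := F @^-1` u.1)) => [y []//|].
  exact: (msmooth_comp (dmap_smooth F) (triv_open Tu) sh).
move=> y [ty uy]; rewrite /sec_pull_fun hP//.
by apply: (can_inj (@lb_funK y)); rewrite lb_invK -scalerA lb_scale -gP// lb_invK.
Qed.

Definition sec_pull (s : Gamma L2) : Gamma L1 := Section_ (sec_pull_smooth s).

(* F : Gamma(L1) -> Gamma(L2), s |-> F o s o phi^-1 *)
Definition sec_push_fun (s : Gamma L1) (y : N) : L2 y :=
  ecast z (L2 z) (dinvK F y) (lb_fun F (dinv F y) (s (dinv F y))).

Lemma sec_push_funE (s : Gamma L1) (x : M) :
  sec_push_fun s (F x) = lb_fun F x (s x).
Proof.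
rewrite /sec_push_fun; move: (dinvK F (F x)); rewrite dmapK => e.
by rewrite eq_axiomK.
Qed.

Lemma sec_push_smooth s : smooth_section (sec_push_fun s).
Proof.
apply: smooth_section_local => y; rewrite -(dinvK F y); set x := dinv F y.
have [t Tt tx] := triv_cover L1 x; have [u Tu ux] := triv_cover L2 (F x).
have [g sg gP] := lb_smooth Tt Tu; have [h sh hP] := sec_smooth s Tt.
have oW : open (dinv F @^-1` t.1 `&` u.1).
  apply: openI; last exact: triv_open.
  apply: open_comp; last exact: triv_open.
  by move=> z _; have [+ _] := dinv_smooth F; exact.
have oW' : open (t.1 `&` F @^-1` u.1).
  by apply: openI; [exact: triv_open|exact/lb_open_pre/triv_open].
exists u, (dinv F @^-1` t.1 `&` u.1); split=> //; first by rewrite /= dmapK.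
exists (fun z => h (dinv F z) * g (dinv F z)).
  have sgh : msmooth (t.1 `&` F @^-1` u.1) (fun x => h x * g x).
    by apply: msmoothM => //; apply: msmooth_sub sh => z [].
  apply: msmooth_sub (msmooth_comp (dinv_smooth F) oW' sgh).
  by move=> z [tz uz]; split=> //=; rewrite dinvK.
move=> z [/= tz uz]; rewrite -(dinvK F z); set w := dinv F z.
rewrite sec_push_funE dmapK hP// lb_scale gP ?scalerA//.
by rewrite /preimage /= dinvK.
Qed.

Definition sec_push (s : Gamma L1) : Gamma L2 := Section_ (sec_push_smooth s).

Lemma sec_pushE (s : Gamma L1) x : sec_push s (F x) = lb_fun F x (s x).
Proof. exact: sec_push_funE. Qed.
Lemma sec_pushP (s : Gamma L1) (t : Gamma L2) :
  (forall x, t (F x) = lb_fun F x (s x)) -> sec_push s = t.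
Proof.
by move=> st; apply: sec_eq => y; rewrite -(dinvK F y) sec_pushE st.
Qed.
Lemma sec_pushK : cancel sec_push sec_pull.
Proof. by move=> s; apply: sec_eq => x /=; rewrite /sec_pull_fun sec_pushE lb_funK. Qed.
Lemma sec_pullK : cancel sec_pull sec_push.
Proof. by move=> s; apply: sec_pushP => x /=; rewrite /sec_pull_fun lb_invK. Qed.
Lemma sec_pushD s t : sec_push (s + t) = sec_push s + sec_push t.
Proof. by apply: sec_pushP => x; rewrite !secDE !sec_pushE lb_add. Qed.
Lemma sec_pushZ (f : cinf N) s :
  sec_push (cinf_pull F f *: s) = f *: sec_push s.
Proof. by apply: sec_pushP => x; rewrite !secZE sec_pushE lb_scale. Qed.
Lemma sec_pullD s t : sec_pull (s + t) = sec_pull s + sec_pull t.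
Proof. by apply: (can_inj sec_pushK); rewrite sec_pushD !sec_pullK. Qed.
Lemma sec_pullZ (f : cinf N) s :
  sec_pull (f *: s) = cinf_pull F f *: sec_pull s.
Proof. by apply: (can_inj sec_pushK); rewrite sec_pushZ !sec_pullK. Qed.

(* D |-> F D F^-1 *)
Program Definition der_push (D : derivation L1) : derivation L2 :=
  @Derivation R N L2 (fun s => sec_push (D (sec_pull s))) _.
Next Obligation.
move=> D; split=> [a s t|].
  have pA : cinf_pull F (cinf_cst a) = cinf_cst a by exact: cinf_eq.
  by rewrite sec_pullD sec_pullZ pA der_linear sec_pushD -{1}pA sec_pushZ.
have [_ [X DX]] := derP D; exists (vf_push F X) => f s.
rewrite sec_pullZ DX sec_pushD sec_pushZ; congr (_ + _).
have -> : vf_app X (cinf_pull F f) = cinf_pull F (vf_app (vf_push F X) f).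
  by apply: cinf_eq => x /=; rewrite dmapK.
by rewrite sec_pushZ sec_pullK.
Qed.

End Push.
End BundleIso.
Arguments lb_fun {R M N L1 L2} l x _.
Arguments lb_inv {R M N L1 L2} l x _.

Section IsoComposition.
Context {R : realType}.

Lemma lb_id_subproof (M : manifold R) (L : line_bundle M) :
  is_lb_iso (phi := diffeo_id M) (fun x (u : L x) => u) (fun x (u : L x) => u).
Proof.
split=> // s t Ts Tt.
have [h sh hP] := triv_compat Tt Ts.
exists h; first by apply: msmooth_sub sh => x [].
by move=> x sx tx; exact: hP.
Qed.

Definition lb_id (M : manifold R) (L : line_bundle M) : lb_iso L L :=
  LbIso (@lb_id_subproof M L).

Lemma lb_comp_subproof (M N P : manifold R) (L1 : line_bundle M)
    (L2 : line_bundle N) (L3 : line_bundle P)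
    (G : lb_iso L2 L3) (F : lb_iso L1 L2) :
  is_lb_iso (L1 := L1) (L2 := L3) (phi := diffeo_comp G F)
    (fun x u => lb_fun G (F x) (lb_fun F x u))
    (fun x u => lb_inv F x (lb_inv G (F x) u)).
Proof.
split.
- by move=> x a u v; rewrite !lb_linear.
- by move=> x u; rewrite !lb_funK.
- by move=> x u; rewrite !lb_invK.
move=> s t Ts Tt /=.
have oU : open (s.1 `&` (F : M -> N) @^-1` ((G : N -> P) @^-1` t.1)).
  by apply: openI; [exact: triv_open|exact/lb_open_pre/lb_open_pre/triv_open].
have := msmooth_glue (P := fun x a =>
  lb_fun G (F x) (lb_fun F x (s.2 x)) = a *: t.2 (G (F x))) oU.
case=> [x a b [sx tx] ->|x [sx tx]|g sg gP].
- exact: (triv_inj Tt tx).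
- have [u Tu ux] := triv_cover L2 (F x).
  have [g sg gP] := lb_smooth F Ts Tu; have [h sh hP] := lb_smooth G Tu Tt.
  have oW : open (s.1 `&` (F : M -> N) @^-1` (u.1 `&` (G : N -> P) @^-1` t.1)).
    apply: openI; first exact: triv_open.
    apply: lb_open_pre; apply: openI; first exact: triv_open.
    exact/lb_open_pre/triv_open.
  exists (s.1 `&` (F : M -> N) @^-1` (u.1 `&` (G : N -> P) @^-1` t.1)); split=> //.
  exists (fun y => g y * h (F y)).
    apply: msmoothM => //; first by apply: msmooth_sub sg => y [sy []].
    apply: (msmooth_sub (U := (F : M -> N) @^-1` (u.1 `&` (G : N -> P) @^-1` t.1))).
      by move=> y [].
    apply: (msmooth_comp (dmap_smooth F) _ sh).
    by apply: openI; [exact: triv_open|exact/lb_open_pre/triv_open].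
  by move=> y [sy [uy ty]]; rewrite gP// lb_scale hP// scalerA.
- by exists g => // x sx tx; exact: gP.
Qed.

Definition lb_comp (M N P : manifold R) (L1 : line_bundle M)
    (L2 : line_bundle N) (L3 : line_bundle P)
    (G : lb_iso L2 L3) (F : lb_iso L1 L2) : lb_iso L1 L3 :=
  LbIso (lb_comp_subproof G F).

Lemma diffeo_proof_irrelevance (M N : manifold R) (f : M -> N) g
  (p q : is_diffeo f g) : Diffeo p = Diffeo q.
Proof. by rewrite (Prop_irrelevance p q). Qed.

Lemma lb_iso_proof_irrelevance (M N : manifold R) (L1 : line_bundle M)
    (L2 : line_bundle N) (f : M -> N) (g : N -> M) (p q : is_diffeo f g)
    (F : forall x, L1 x -> L2 (f x)) (F' : forall x, L2 (f x) -> L1 x)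
    (pF : is_lb_iso (phi := Diffeo p) F F')
    (qF : is_lb_iso (phi := Diffeo q) F F') :
  LbIso pF = LbIso qF.
Proof.
move: pF qF; rewrite (Prop_irrelevance p q) => pF qF.
by rewrite (Prop_irrelevance pF qF).
Qed.

Lemma der_push_id (M : manifold R) (L : line_bundle M) (D : derivation L) :
  der_push (lb_id L) D = D.
Proof.
apply: der_eq => s /=; apply: sec_pushP => x /=.
by congr (D _ x); apply: sec_eq.
Qed.

Lemma sec_push_comp (M N P : manifold R) (L1 : line_bundle M)
    (L2 : line_bundle N) (L3 : line_bundle P)
    (G : lb_iso L2 L3) (F : lb_iso L1 L2) (s : Gamma L1) :
  sec_push (lb_comp G F) s = sec_push G (sec_push F s).
Proof.
apply: sec_pushP => x.
by rewrite [LHS](sec_pushE G (sec_push F s) (F x)) (sec_pushE F).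
Qed.

Lemma der_push_comp (M N P : manifold R) (L1 : line_bundle M)
    (L2 : line_bundle N) (L3 : line_bundle P)
    (G : lb_iso L2 L3) (F : lb_iso L1 L2) (D : derivation L1) :
  der_push (lb_comp G F) D = der_push G (der_push F D).
Proof.
apply: der_eq => s /=; rewrite sec_push_comp.
by congr (sec_push G (sec_push F (D _))); apply: sec_eq.
Qed.

End IsoComposition.

Record category := Category {
  obj :> Type ;
  hom : obj -> obj -> Type ;
  idm : forall A, hom A A ;
  compm : forall A B C, hom B C -> hom A B -> hom A C ;
  comp1m : forall A B (f : hom A B), compm (idm B) f = f ;
  compm1 : forall A B (f : hom A B), compm f (idm A) = f ;
  compmA : forall A B C D (h : hom C D) (g : hom B C) (f : hom A B),
    compm h (compm g f) = compm (compm h g) f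
}.
Arguments idm {c} A.
Arguments compm {c A B C}.

Record functor (C D : category) := Functor {
  fobj :> C -> D ;
  fmap : forall A B, hom A B -> hom (fobj A) (fobj B) ;
  fmap_id : forall A, fmap (idm A) = idm (fobj A) ;
  fmap_comp : forall A B E (g : hom B E) (f : hom A B),
    fmap (compm g f) = compm (fmap g) (fmap f)
}.
Arguments fmap {C D} _ {A B} _.

Definition is_iso (C : category) (A B : C) (f : hom A B) : Prop :=
  exists g : hom B A, compm g f = idm A /\ compm f g = idm B.

Definition functor_id (C : category) : functor C C :=
  @Functor C C idfun (fun _ _ f => f) (fun=> erefl) (fun _ _ _ _ _ => erefl).

Program Definition functor_comp (C D E : category) (G : functor D E)
    (F : functor C D) : functor C E :=
  @Functor C E (fun A => G (F A)) (fun A B f => fmap G (fmap F f)) _ _.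
Next Obligation. by move=> * /=; rewrite !fmap_id. Qed.
Next Obligation. by move=> * /=; rewrite !fmap_comp. Qed.

Definition naturally_isomorphic (C D : category) (F G : functor C D) : Prop :=
  exists eta : forall A, hom (F A) (G A),
    (forall A, is_iso (eta A)) /\
    (forall A B (f : hom A B), compm (eta B) (fmap F f) = compm (fmap G f) (eta A)).

Definition equivalent_categories (C D : category) : Prop :=
  exists (F : functor C D) (G : functor D C),
    naturally_isomorphic (functor_comp G F) (functor_id C) /\
    naturally_isomorphic (functor_comp F G) (functor_id D).

Section ContactCategory.
Variable R : realType.

Record contact_manifold := ContactManifold {
  cm_base :> manifold R ;
  cm_dist : forall x : cm_base, set (tangent cm_base x) ;
  cm_contact : contact_structure cm_dist
}.

Arguments cm_dist c x : clear implicits.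

Definition maps_dist (A B : contact_manifold) (phi : diffeo A B) : Prop :=
  forall x, dphi phi (x := x) @` cm_dist A x = cm_dist B (phi x).

Record contactomorphism (A B : contact_manifold) := Contactomorphism {
  cto_diffeo :> diffeo A B ;
  ctoP : maps_dist cto_diffeo
}.

Lemma cto_eq (A B : contact_manifold) (f g : contactomorphism A B) :
  cto_diffeo f = cto_diffeo g -> f = g.
Proof.
case: f g => [f fP] [g gP] /= fg; subst g.
by rewrite (Prop_irrelevance fP gP).
Qed.

Lemma diffeo_eta (A B : manifold R) (f : diffeo A B) (p : is_diffeo f (dinv f)) :
  Diffeo p = f.
Proof. by case: f p => f g q p; exact: diffeo_proof_irrelevance. Qed.

Lemma maps_dist_id (A : contact_manifold) : @maps_dist A A (diffeo_id A).
Proof.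
move=> x; have dE (v : tangent A x) : dphi (diffeo_id A) v = v.
  by apply: tangent_eq => f; congr (v _); exact: cinf_eq.
apply/seteqP; split=> [_ [v vH <-]|v vH]; first by rewrite dE.
by exists v.
Qed.

Lemma maps_dist_comp (A B C : contact_manifold) (g : contactomorphism B C)
  (f : contactomorphism A B) : @maps_dist A C (diffeo_comp g f).
Proof.
move=> x; rewrite -[RHS](ctoP g (f x)) -(ctoP f x) image_comp.
apply: eq_imagel => v _; apply: tangent_eq => h; congr (v _); exact: cinf_eq.
Qed.

Program Definition contact_category : category :=
  @Category contact_manifold contactomorphism
    (fun A => Contactomorphism (@maps_dist_id A))
    (fun A B C g f => Contactomorphism (maps_dist_comp g f)) _ _ _.
Next Obligation. by move=> A B f; apply: cto_eq; exact: diffeo_eta. Qed.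
Next Obligation. by move=> A B f; apply: cto_eq; exact: diffeo_eta. Qed.
Next Obligation.
by move=> A B C D h g f; apply: cto_eq; exact: diffeo_proof_irrelevance.
Qed.

End ContactCategory.

Section SymplecticAtiyahCategory.
Variable R : realType.

Record symplectic_atiyah_bundle := SymplecticAtiyahBundle {
  sab_base : manifold R ;
  sab_bundle :> line_bundle sab_base ;
  sab_form : atiyah2 sab_bundle ;
  sab_symplectic : symplectic_atiyah sab_form
}.

Definition preserves_form (A B : symplectic_atiyah_bundle) (F : lb_iso A B) : Prop :=
  forall D D' : derivation A,
    sab_form B (der_push F D) (der_push F D') = sec_push F (sab_form A D D').

Record symplectic_atiyah_morphism (A B : symplectic_atiyah_bundle) :=
  SymplecticAtiyahMorphism {
    sam_iso :> lb_iso A B ;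
    samP : preserves_form sam_iso
  }.

Lemma sam_eq (A B : symplectic_atiyah_bundle)
    (f g : symplectic_atiyah_morphism A B) : sam_iso f = sam_iso g -> f = g.
Proof.
case: f g => [f fP] [g gP] /= fg; subst g.
by rewrite (Prop_irrelevance fP gP).
Qed.

Lemma preserves_form_id (A : symplectic_atiyah_bundle) :
  @preserves_form A A (lb_id A).
Proof. by move=> D D'; rewrite !der_push_id; apply/esym/sec_pushP. Qed.

Lemma preserves_form_comp (A B C : symplectic_atiyah_bundle)
    (G : symplectic_atiyah_morphism B C) (F : symplectic_atiyah_morphism A B) :
  @preserves_form A C (lb_comp G F).
Proof.
by move=> D D'; rewrite !der_push_comp (samP G) (samP F) sec_push_comp.
Qed.

Lemma lb_iso_eta (M N : manifold R) (L1 : line_bundle M) (L2 : line_bundle N)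
    (F : lb_iso L1 L2) (p : is_diffeo F (dinv F))
    (pF : is_lb_iso (phi := Diffeo p) (lb_fun F) (lb_inv F)) : LbIso pF = F.
Proof.
case: F p pF => [[f g q] F F' qF] p pF; exact: lb_iso_proof_irrelevance.
Qed.

Program Definition symplectic_atiyah_category : category :=
  @Category symplectic_atiyah_bundle symplectic_atiyah_morphism
    (fun A => SymplecticAtiyahMorphism (@preserves_form_id A))
    (fun A B C g f => SymplecticAtiyahMorphism (preserves_form_comp g f)) _ _ _.
Next Obligation. by move=> A B f; apply: sam_eq; exact: lb_iso_eta. Qed.
Next Obligation. by move=> A B f; apply: sam_eq; exact: lb_iso_eta. Qed.
Next Obligation.
by move=> A B C D h g f; apply: sam_eq; exact: lb_iso_proof_irrelevance.
Qed.

End SymplecticAtiyahCategory.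

(* Main.v *)
From HB Require Import structures.
From mathcomp Require Import all_boot all_order all_algebra.
From mathcomp Require Import boolp classical_sets functions ring lra.
From mathcomp Require Import reals topology normedtype landau derive realfun.
From mathcomp Require Import sequences exp constructive_ereal measure.
From mathcomp Require Import lebesgue_measure lebesgue_integral ftc.
Require Import Defs.

Set Implicit Arguments.
Unset Strict Implicit.
Unset Printing Implicit Defensive.
Import Order.TTheory GRing.Theory Num.Theory.
Import numFieldNormedType.Exports.
Local Open Scope classical_set_scope.
Local Open Scope ring_scope.

(** A symplectic Atiyah form w is the same thing as a contact distribution
    because it is determined by its contraction th = w (1, -) with the identity
    derivation 1.  As w (1, 1) = 0, th factors through the symbol s and is an
    L-valued 1-form on M; as 1 commutes with every derivation, closedness of w
    on the triple (1, D, E) reads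
      w (D, E) = D (th (s E)) - E (th (s D)) - th (s [D, E]),
    that is, w is the differential of th o s ([closed_dcontr]).  So both
    categories are about L-valued 1-forms th without zeros, and the core of the
    proof is [contact_symplecticP]: the kernel of th is a contact structure iff
    the differential of th o s is symplectic.  If D and E have symbols X and Y
    tangent to ker th, then w (D, E) = - th [X, Y] is the curvature of ker th,
    while w (1, E) = th (s E) detects the two remaining directions, spanned by 1
    and by a derivation with symbol transverse to ker th.

    The equivalence is the functor (L, w) |-> (M, ker th), which is fully
    faithful and essentially surjective ([fully_faithful_equivalence]).
    A bundle isomorphism F over phi maps 1 to 1, hence preserves the forms iff
    F (th v) = th (dphi v) ([preserves_intertwines], [intertwines_dlf]).  As th
    is onto, this relation determines F from phi, and it defines F as soon as
    dphi maps kernel onto kernel ([induced_iso]).  Finally every hyperplane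
    distribution is the kernel of the projection of TM onto the normal line
    bundle ([normal_form]).

    What remains is the passage between pointwise statements and statements on
    modules of global sections, in terms of which derivations, forms and their
    non-degeneracy are defined.  Bump functions make all operators local.
    Tangent vectors are point derivations of the algebra of smooth functions, so
    that the Hadamard lemma is needed to see that coordinate fields span
    ([coordinate_frame_exists]).  A line bundle and a coordinate frame give a
    local frame of the gauge algebroid, whence C^oo-linear maps on derivations
    are tensorial ([linear_tensorial]) and pointwise non-degeneracy implies
    non-degeneracy on sections ([pointwise_nondegenerateP]), where the inverse
    is found by Cramer's rule in the ring of smooth functions. *)

(** * A smooth function flat at the origin, and bump functions on R^n *)

Section FlatFunction.
Context {R : realType}.

(** The factor t^-m makes the family closed under differentiation, so that one
    induction proves all of its members smooth. *)
Definition flat (m : nat) (t : R) : R :=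
  if 0 < t then t^-1 ^+ m * expR (- t^-1) else 0.

Lemma flat_gt0 m t : 0 < t -> 0 < flat m t.
Proof.
by move=> t0; rewrite /flat t0 mulr_gt0 ?expR_gt0// exprn_gt0// invr_gt0.
Qed.

Lemma flat_ge0 m t : 0 <= flat m t.
Proof.
by have [/flat_gt0/ltW//|] := ltP 0 t; rewrite /flat leNgt => /negbTE ->.
Qed.

Lemma flat_le0 m t : t <= 0 -> flat m t = 0.
Proof. by rewrite /flat leNgt; case: ifP. Qed.

Lemma flat0 m : flat m 0 = 0.
Proof. by rewrite flat_le0. Qed.

Lemma exprn_expRN_le (m : nat) (s : R) : 0 < s ->
  s ^+ m * expR (- s) <= m.+1%:R ^+ m.+1 / s.
Proof.
move=> s0; have m0 : 0 < m.+1%:R :> R by [].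
have e : (s / m.+1%:R) ^+ m.+1 <= expR s.
  rewrite -[X in expR X](divfK (lt0r_neq0 m0)) expRM_natr.
  rewrite lerXn2r ?nnegrE ?expR_ge0 ?divr_ge0 ?ltW//.
  by rewrite (lt_le_trans _ (expR_ge1Dx _))// ltrDr.
rewrite expRN ler_pdivlMr// mulrAC ler_pdivrMr ?expR_gt0// -exprSr.
by move: e; rewrite expr_div_n ler_pdivrMr ?exprn_gt0// mulrC.
Qed.

(** Being O(t^2) at 0 is what makes [flat] differentiable there, with derivative
    0; the exponential absorbs the extra powers of t^-1. *)
Lemma flat_quadratic m : exists2 C : R, 0 < C &
  forall t, `|flat m t| <= C * t ^+ 2.
Proof.
exists (m.+2%:R ^+ m.+2); first by rewrite exprn_gt0.
move=> t; have [t0|t0] := leP t 0.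
  by rewrite flat_le0// normr0; apply: mulr_ge0; [exact: exprn_ge0|exact: sqr_ge0].
rewrite ger0_norm ?flat_ge0// /flat t0.
have s0 : 0 < t^-1 by rewrite invr_gt0.
have := exprn_expRN_le m.+1 s0.
rewrite invrK -(ler_pM2r t0) -[leRHS]mulrA -(expr2 t).
apply: le_trans.
by rewrite [leRHS]mulrAC exprSr mulfVK ?lt0r_neq0.
Qed.

Lemma is_derive_flat m (t : R) :
  is_derive t 1 (flat m) (flat m.+2 t - m%:R * flat m.+1 t).
Proof.
have [t0|t0|->] := ltgtP t 0.
- rewrite !flat_le0 ?(ltW t0)// mulr0 subr0.
  apply: (@near_eq_is_derive _ _ _ (cst 0)).
  near=> s; rewrite flat_le0//; apply: ltW; near: s.
  exact: lt_nbhsl.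
- pose g (t : R) : R := t^-1 ^+ m * expR (- t^-1).
  apply: (@near_eq_is_derive _ _ _ g).
    near=> s; rewrite /g /flat ifT//; near: s.
    exact: lt_nbhsr.
  have tn0 : t != 0 by rewrite lt0r_neq0.
  have dV : is_derive t (1 : R) (fun t : R => t^-1) (- t ^- 2 *: 1).
    exact: (is_deriveV (f := id) tn0).
  have dX := is_deriveX m dV.
  have dE : is_derive t (1 : R) (fun t : R => expR (- t^-1))
      (expR (- t^-1) * - (- t ^- 2 *: 1)).
    exact: (is_derive1_comp (f := expR) (g := fun t : R => - t^-1)
      (is_derive_expR _) (is_deriveN dV)).
  have dM := is_deriveM dX dE.
  have gE : g = ((fun t : R => t^-1) ^+ m) * (fun t : R => expR (- t^-1)).
    by apply/funext => s; rewrite /g mulrfctE exprfctE.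
  rewrite gE; apply: is_derive_eq.
  rewrite /flat t0 exprfctE /GRing.scale /= mulr1 -exprVn.
  by case: m {g gE dX dE dM} => [|m] /=; rewrite ?exprS; ring.
- rewrite !flat0 mulr0 subr0; apply/is_derive1_caratheodory.
  have [C C0 HC] := flat_quadratic m.
  exists (fun z => flat m z / z); split.
  + move=> z; rewrite flat0 !subr0; have [->|z0] := eqVneq z 0.
      by rewrite flat0 !mul0r.
    by rewrite divfK.
  + rewrite /prop_for /continuous_at flat0 mul0r.
    apply/cvgr0Pnorm_lt => e e0.
    have d0 : 0 < C^-1 * e by rewrite mulr_gt0 ?invr_gt0.
    have := nbhsx_ballx (0 : R) _ d0; apply: filterS => z.
    rewrite -ball_normE /= sub0r normrN => zd.
    have [->|z0] := eqVneq z 0; first by rewrite flat0 mul0r normr0.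
    rewrite normrM normfV ltr_pdivrMr ?normr_gt0//.
    apply: le_lt_trans (HC z) _.
    rewrite -real_normK ?num_real// expr2 mulrA ltr_pM2r ?normr_gt0//.
    by rewrite -ltr_pdivlMl.
  + by rewrite flat0 mul0r.
Unshelve. all: by end_near. Qed.

Lemma Ck_flat n k (A : set 'rV[R]_n) (f : 'rV[R]_n -> R) m : open A ->
  Ck k A f -> Ck k A (fun y => flat m (f y)).
Proof.
move=> oA; elim: k m => [|k IH] m.
  move=> cf x Ax; apply: (continuous_comp (cf x Ax)).
  apply/differentiable_continuous/derivable1_diffP.
  by have [] := is_derive_flat m (f x).
move=> cf; have [df Df] := cf.
have dflat t : differentiable (flat m) t.
  by apply/derivable1_diffP; have [] := is_derive_flat m t.
split=> [x Ax|v]; first exact: (differentiable_comp (df x Ax) (dflat _)).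
have cf' := CkW cf.
have H : Ck k A (fun x => (flat m.+2 (f x) + - m%:R * flat m.+1 (f x)) * 'D_v f x).
  apply: (CkM oA _ (Df v)); apply: (CkD oA (IH _ cf')).
  by apply: (CkM oA _ (IH _ cf')); exact: Ck_cst.
apply: Ck_ext H => // x Ax.
rewrite [RHS]deriveE; last exact: (differentiable_comp (df x Ax) (dflat _)).
rewrite (diff_comp (df x Ax) (dflat _)) /= -(deriveE _ (df x Ax)).
rewrite -[X in 'd _ _ X]mulr1 -[_ * 1]/('D_v f x *: (1 : R)) linearZ /=.
rewrite -deriveE// /GRing.scale /= mulrC; congr (_ * _).
by have [_ ->] := is_derive_flat m (f x); rewrite mulNr.
Qed.

End FlatFunction.

Section EuclideanBump.
Context {R : realType}.

Lemma smooth_on_coord n (A : set 'rV[R]_n) j : smooth_on A (fun y => y ord0 j).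
Proof.
move=> [|k]; first by move=> x _; exact: coord_continuous.
split=> [x _|v]; first exact: differentiable_coord.
have -> // : 'D_v (fun y : 'rV[R]_n => y ord0 j) = cst (v ord0 j).
  apply/funext => x; have /matrixP/(_ ord0 j) := derive_mx (@derivable_id _ _ x v).
  by rewrite derive_id mxE.
exact: Ck_cst.
Qed.

Lemma smooth_onB n (A : set 'rV[R]_n) f g : open A ->
  smooth_on A f -> smooth_on A g -> smooth_on A (fun x => f x - g x).
Proof.
move=> oA sf sg k.
apply: Ck_ext (CkD oA (sf k) (CkM oA (Ck_cst k A (-1)) (sg k))) => //.
by move=> x _ /=; rewrite mulN1r.
Qed.

(** With q the squared Euclidean distance to y0, the quotient
    flat (r^2 - q) / (flat (r^2 - q) + flat (q - r^2/4)) is 1 for q <= r^2/4 and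
    0 for q >= r^2; the Euclidean ball sits inside the ball of the max norm. *)
Lemma euclidean_bump n (y0 : 'rV[R]_n) (r : R) : 0 < r ->
  exists b : 'rV[R]_n -> R, [/\ smooth_on setT b,
    \forall y \near y0, b y = 1 & forall y, ~ ball y0 r y -> b y = 0].
Proof.
move=> r0.
pose q (y : 'rV[R]_n) := \sum_j (y ord0 j - y0 ord0 j) * (y ord0 j - y0 ord0 j).
have sq : smooth_on setT q.
  move=> k; apply: Ck_sum => [|j]; first exact: openT.
  have H : Ck k setT (fun y : 'rV[R]_n => y ord0 j - y0 ord0 j).
    apply: smooth_onB => [||k']; first exact: openT.
      exact: smooth_on_coord.
    exact: Ck_cst.
  by apply: CkM => //; exact: openT.
have sflat f : smooth_on setT f -> smooth_on setT (fun y => flat 0 (f y)).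
  by move=> sf k; apply: Ck_flat => //; exact: openT.
pose u y := flat 0 (r ^+ 2 - q y); pose w y := flat 0 (q y - r ^+ 2 / 4).
have su : smooth_on setT u.
  by apply: sflat; exact: (smooth_onB openT (fun k => Ck_cst k setT _) sq).
have sw : smooth_on setT w.
  by apply: sflat; exact: (smooth_onB openT sq (fun k => Ck_cst k setT _)).
have r20 : 0 < r ^+ 2 by rewrite exprn_gt0.
have uw0 y : u y + w y != 0.
  rewrite lt0r_neq0//; have [qr|qr] := ltP (q y) (r ^+ 2).
    by rewrite ltr_wpDr ?flat_ge0// flat_gt0// subr_gt0.
  rewrite ltr_wpDl ?flat_ge0// flat_gt0// subr_gt0 (lt_le_trans _ qr)//.
  lra.
exists (fun y => u y * (u y + w y)^-1); split.
- move=> k; apply: CkM; [exact: openT|exact: su|].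
  apply: CkV; [exact: openT|by move=> *|].
  by apply: CkD; [exact: openT|exact: su|exact: sw].
- have cq : q y @[y --> y0] --> (0 : R).
    have -> : (0 : R) = q y0 by rewrite /q big1// => j _; rewrite subrr mul0r.
    exact: (sq 0%N y0 I).
  near=> y; have wy : w y = 0.
    rewrite /w flat_le0// subr_le0; apply: ltW; near: y.
    have r4 : 0 < r ^+ 2 / 4 by rewrite divr_gt0.
    exact: (cq _ (lt_nbhsl r4)).
  by have := uw0 y; rewrite wy addr0 => uy; rewrite mulfV.
- move=> y ny; rewrite /u flat_le0 ?mul0r// subr_le0 leNgt; apply/negP => qr.
  apply: ny; split=> // i j; rewrite ord1 /ball /=.
  rewrite -ltr_sqr ?nnegrE ?normr_ge0 ?(ltW r0)//.
  rewrite real_normK ?num_real//; apply: le_lt_trans qr.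
  rewrite /q (bigD1 j)//= -expr2 -sqrrN opprB lerDl sumr_ge0// => k _.
  by rewrite -expr2 sqr_ge0.
Unshelve. all: by end_near. Qed.

End EuclideanBump.

(** * The Hadamard lemma *)

Section Hadamard.
Context {R : realType} {n : nat}.
Implicit Types (f h : 'rV[R]_n -> R) (y v : 'rV[R]_n).

Lemma derive_coord f y v : differentiable f y ->
  'D_v f y = \sum_j v ord0 j * 'D_(delta_mx 0 j) f y.
Proof.
move=> df; rewrite deriveE// [X in 'd f _ X]row_sum_delta linear_sum.
by apply: eq_bigr => j _; rewrite linearZ /= -deriveE.
Qed.

Lemma differentiable_of_estimate f y (c : 'I_n -> R) :
  (forall e, 0 < e -> \forall v \near (0 : 'rV[R]_n),
     `|f (v + y) - f y - \sum_j v ord0 j * c j| <= e * `|v|) ->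
  differentiable f y /\ forall v, 'D_v f y = \sum_j v ord0 j * c j.
Proof.
move=> H; pose g v := \sum_j v ord0 j * c j.
have lin : linear g.
  move=> a u v; rewrite /g scaler_sumr -big_split; apply: eq_bigr => j _ /=.
  by rewrite !mxE mulrDl -mulrA.
pose dm := GRing.isLinear.Build R 'rV[R]_n R *:%R g lin.
pose df : {linear 'rV[R]_n -> R} := HB.pack g dm.
have cdf : continuous df.
  move=> x; apply: (@Ck_sum R n 0 setT _ (fun j y => y ord0 j * c j)) => //.
    exact: openT.
  move=> j; apply: (@CkM R n 0 setT (fun y => y ord0 j) (fun=> c j)).
  - exact: openT.
  - exact: (smooth_on_coord setT j 0).
  - exact: Ck_cst.
have dg : f \o shift y = cst (f y) + df +o_ (0 : 'rV[R]_n) id.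
  apply/eqaddoP => e e0; near=> v; rewrite !fctE opprD addrA /=; near: v.
  exact: H.
have dfE := diff_unique cdf dg.
have dfy : differentiable f y by apply/diff_locallyP; rewrite dfE.
by split=> // v; rewrite deriveE// dfE.
Unshelve. all: by end_near. Qed.

Variable r : R.
Let A : set 'rV[R]_n := ball (0 : 'rV[R]_n) r.

Lemma ball0_star y t : A y -> 0 <= t <= 1 -> A (t *: y).
Proof.
move=> Ay /andP[t0 t1]; move: Ay; rewrite /A -!ball_normE /= !sub0r !normrN.
by rewrite normrZ ger0_norm//; apply: le_lt_trans; exact: ler_piMl.
Qed.

Let mu := @lebesgue_measure R.

(** The weight t^m appears when a mean along rays is differentiated: by the chain
    rule the derivative of t^m h(ty) along v is t^(m+1) (D_v h)(ty). *)
Definition ray_mean (m : nat) h y : R :=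
  \int[mu]_(t in `[0, 1]) (t ^+ m * h (t *: y)).

Lemma ray_continuous (m : nat) h y (t : R) : Ck 0 A h -> A y -> 0 <= t <= 1 ->
  {for t, continuous (fun t : R => t ^+ m * h (t *: y))}.
Proof.
move=> ch Ay t01; apply: cvgM; first exact: exprn_continuous.
apply: (@continuous_comp _ _ _ (fun t : R => t *: y) h); last exact/ch/ball0_star.
exact: scalel_continuous.
Qed.

Lemma ray_integrable m h y : Ck 0 A h -> A y ->
  mu.-integrable `[0, 1] (EFin \o (fun t : R => t ^+ m * h (t *: y))).
Proof.
move=> ch Ay; apply: continuous_compact_integrable; first exact: segment_compact.
apply: continuous_in_subspaceT => t; rewrite inE /= in_itv /= => t01.
exact: ray_continuous.
Qed.

Lemma Rintegral01_le (g : R -> R) (e : R) :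
  mu.-integrable `[0, 1] (EFin \o g) ->
  (forall t, 0 <= t <= 1 -> `|g t| <= e) ->
  `|\int[mu]_(t in `[0, 1]) g t| <= e.
Proof.
move=> ig ge; apply: (le_trans (le_normr_Rintegral _ ig)) => //.
have -> : e = \int[mu]_(t in `[0%R, 1%R]) e.
  rewrite Rintegral_cst// (_ : fine _ = 1) ?mulr1//.
  by rewrite /mu/= lebesgue_measure_itv/= lte_fin ltr01 oppr0 adde0.
apply: le_Rintegral => //.
- exact: (integrable_norm ig).
- apply: continuous_compact_integrable; first exact: segment_compact.
  by apply: continuous_subspaceT => x; exact: cst_continuous.
Qed.

Lemma int01B (f g : R -> R) : mu.-integrable `[0, 1] (EFin \o f) ->
  mu.-integrable `[0, 1] (EFin \o g) ->
  mu.-integrable `[0, 1] (EFin \o (fun t => f t - g t)).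
Proof.
move=> If Ig; rewrite (_ : EFin \o _ = (EFin \o f) \- (EFin \o g))%E.
  exact: integrableB.
by apply/funext => t /=; rewrite EFinB.
Qed.

Lemma int01_sum k (a : 'I_k -> R) (f : 'I_k -> R -> R) :
  (forall j, mu.-integrable `[0, 1] (EFin \o f j)) ->
  mu.-integrable `[0, 1] (EFin \o (fun t => \sum_j a j * f j t)) /\
  \int[mu]_(t in `[0, 1]) (\sum_j a j * f j t) =
  \sum_j a j * \int[mu]_(t in `[0, 1]) f j t.
Proof.
move=> If; elim: k a f If => [|k IH] a f If.
  rewrite big_ord0; split.
    rewrite (_ : EFin \o _ = cst 0%E); first exact: integrable0.
    by apply/funext => t /=; rewrite big_ord0.
  under eq_Rintegral do rewrite big_ord0.
  by rewrite Rintegral_cst// mul0r.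
have IZ (c : R) (g : R -> R) : mu.-integrable `[0, 1] (EFin \o g) ->
    mu.-integrable `[0, 1] (EFin \o (fun t => c * g t)).
  move=> Ig; rewrite (_ : EFin \o _ = (fun t => c%:E * (EFin \o g) t)%E).
    exact: integrableZl.
  by apply/funext => t.
have [I1 I2] := IH (fun j => a (lift ord0 j)) (fun j => f (lift ord0 j))
  (fun j => If _).
have E t : \sum_j a j * f j t =
    a ord0 * f ord0 t + \sum_(j < k) a (lift ord0 j) * f (lift ord0 j) t.
  by rewrite big_ord_recl.
split.
  rewrite (_ : EFin \o _ = (EFin \o (fun t => a ord0 * f ord0 t)%R) \+
     (EFin \o (fun t => \sum_(j < k) a (lift ord0 j) * f (lift ord0 j) t)%R))%E.
    by apply: integrableD => //; exact: IZ.
  by apply/funext => t /=; rewrite E EFinD.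
under eq_Rintegral do rewrite E.
rewrite RintegralD//; last exact: IZ.
by rewrite RintegralZl// I2 big_ord_recl.
Qed.

(** Compactness of [0, 1] makes continuity uniform along the ray. *)
Lemma ray_uniform h y (e : R) : Ck 0 A h -> A y -> 0 < e ->
  \forall z \near y, A z /\
    forall t, 0 <= t <= 1 -> `|h (t *: z) - h (t *: y)| <= e.
Proof.
move=> ch Ay e0; near=> z; split.
  by near: z; apply: open_nbhs_nbhs; split => //; exact: ball_open.
suff : `[0, 1]%classic `<=` [set t | `|h (t *: z) - h (t *: y)| <= e].
  by move=> + t t01; apply; rewrite /= in_itv.
near: z; have /compact_near_coveringP := @segment_compact R 0 1.
apply=> t; rewrite /= in_itv /= => t01.
have ht := ch _ (ball0_star Ay t01).
have c1 : h (p.1 *: p.2) @[p --> (t, y)] --> h (t *: y).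
  exact: (cvg_comp _ _ (@scale_continuous _ _ (t, y)) ht).
have c2 : h (p.1 *: y) @[p --> (t, y)] --> h (t *: y).
  have ct : {for t, continuous (fun t : R => h (t *: y))}.
    apply: (cvg_comp (fun t : R => t *: y) h _ ht); exact: scalel_continuous.
  exact: (cvg_comp (fun p : R * _ => p.1) (fun t : R => h (t *: y))
    (@cvg_fst _ _ (nbhs t) (nbhs y) _) ct).
have e2 : 0 < e / 2 by rewrite divr_gt0.
move/cvgrPdist_lt: c1 => /(_ _ e2) N1; move/cvgrPdist_lt: c2 => /(_ _ e2) N2.
apply: filterS2 N1 N2 => -[s z] /= H1 H2; rewrite [e]splitr ltW//.
apply: le_lt_trans (ler_distD (h (t *: y)) _ _) _.
by rewrite distrC ltrD.
Unshelve. all: by end_near. Qed.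

Lemma ray_mean_continuous m h : Ck 0 A h -> Ck 0 A (ray_mean m h).
Proof.
move=> ch y Ay; apply: (@cvgrPdist_le _ R^o _ (nbhs y) _ _ _).2 => e e0; near=> z.
have [Az Hz] : A z /\ forall t, 0 <= t <= 1 -> `|h (t *: z) - h (t *: y)| <= e.
  by near: z; exact: ray_uniform.
have iy := ray_integrable m ch Ay; have iz := ray_integrable m ch Az.
rewrite /ray_mean -RintegralB//.
apply: Rintegral01_le => [|t /[dup] t01 /andP[t0 t1]]; first exact: int01B.
rewrite -mulrBr normrM distrC; apply: le_trans (Hz t t01).
by rewrite ler_piMl// normrX ger0_norm// exprn_ile1.
Unshelve. all: by end_near. Qed.

Lemma ball_segment (y v : 'rV[R]_n) (d s : R) : `|v| < d -> 0 <= s <= 1 ->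
  ball y d (s *: v + y).
Proof.
move=> vd /andP[s0 s1]; rewrite -ball_normE /= opprD addrCA subrr addr0 normrN.
by rewrite normrZ ger0_norm// (le_lt_trans _ vd)// ler_piMl.
Qed.

Lemma is_derive_line h y v (s : R) : differentiable h (s *: v + y) ->
  is_derive s (1 : R) (fun s => h (s *: v + y)) ('D_v h (s *: v + y)).
Proof.
move=> dh; pose a (s : R) := s *: v + y.
have da : is_diff s a ( *:%R^~ v).
  by have := is_diffD (is_diff_scalel s v) (is_diff_cst y s); rewrite addr0.
have dhs : is_diff (a s) h ('d h (a s)) by apply: DiffDef.
have dha : is_diff s (h \o a) ('d h (a s) \o *:%R^~ v) by exact: is_diff_comp.
apply: DeriveDef; first by apply/derivable1_diffP; case: dha.
rewrite deriveE; last by case: dha.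
by rewrite (diff_val (is_diff_def := dha)) /= scale1r -deriveE.
Qed.

Lemma mean_value_segment h y v :
  (forall s, 0 <= s <= 1 -> differentiable h (s *: v + y)) ->
  exists2 s, 0 <= s <= 1 & h (v + y) - h y = 'D_v h (s *: v + y).
Proof.
move=> dh; pose g (s : R) := h (s *: v + y).
have dg s s01 := is_derive_line (dh s s01).
have [s s01 E] : exists2 c, c \in `[0, 1]%R &
    g 1 - g 0 = 'D_v h (c *: v + y) * (1 - 0).
  apply: MVT_segment => // [s|].
    by rewrite in_itv /= => /andP[s0 s1]; apply: dg; rewrite !ltW.
  apply: derivable_within_continuous => s; rewrite in_itv /= => s01.
  by have [] := dg s s01.
exists s; first by move: s01; rewrite in_itv.
by move: E; rewrite /g scale1r scale0r add0r subr0 mulr1.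
Qed.

Lemma ray_uniform_ball (I : finType) (h : I -> 'rV[R]_n -> R) y (e : R) :
  (forall i, Ck 0 A (h i)) -> A y -> 0 < e ->
  exists2 d, 0 < d & forall z, ball y d z -> A z /\ forall i t, 0 <= t <= 1 ->
      `|h i (t *: z) - h i (t *: y)| <= e.
Proof.
move=> ch Ay e0.
have : \forall z \near y, A z /\ forall i t, 0 <= t <= 1 ->
    `|h i (t *: z) - h i (t *: y)| <= e.
  near=> z; split.
    by near: z; apply: open_nbhs_nbhs; split => //; exact: ball_open.
  near: z; apply: filter_forall => i.
  by apply: filterS (ray_uniform (ch i) Ay e0) => z [].
by move=> /nbhs_ballP[d /= d0 Hd]; exists d.
Unshelve. all: by end_near. Qed.

(** Differentiation under the integral sign: the mean value theorem on the segment
    from ty to t(v+y) replaces the increment of h by its derivative at a point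
    which is uniformly close to ty. *)
Lemma ray_mean_estimate m h y (e : R) : Ck 1 A h -> A y -> 0 < e ->
  \forall v \near (0 : 'rV[R]_n),
    `|ray_mean m h (v + y) - ray_mean m h y -
      \sum_j v ord0 j * ray_mean m.+1 ('D_(delta_mx 0 j) h) y| <= e * `|v|.
Proof.
move=> ch Ay e0; have [dh Dh] := ch; have ch0 := CkW ch.
pose e' := e / n.+1%:R.
have e'0 : 0 < e' by rewrite divr_gt0.
have [d d0 Hd] := ray_uniform_ball (fun j : 'I_n => Dh (delta_mx 0 j)) Ay e'0.
near=> v.
have vd : `|v| < d.
  have : ball (0 : 'rV[R]_n) d v by near: v; exact: nbhsx_ballx.
  by rewrite -ball_normE /= sub0r normrN.
have Avy : A (v + y).
  have s01 : 0 <= (1 : R) <= 1 by rewrite ler01 lexx.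
  by have [+ _] := Hd _ (@ball_segment y v d 1 vd s01); rewrite scale1r.
have iy := ray_integrable m ch0 Ay; have ivy := ray_integrable m ch0 Avy.
have iD j := ray_integrable m.+1 (Dh (delta_mx 0 j)) Ay.
have [iS SE] := int01_sum (fun j => v ord0 j) iD.
rewrite -SE /ray_mean -RintegralB// -RintegralB//; last exact: int01B.
apply: Rintegral01_le => [|t t01].
  by apply: int01B => //; exact: int01B.
(* [ball_segment] keeps the segment from ty to t(v+y) inside the ball A. *)
have {}dh s : 0 <= s <= 1 -> differentiable h (s *: (t *: v) + t *: y).
  move=> s01; rewrite scalerA mulrC -scalerA -scalerDr.
  apply: dh; apply: ball0_star => //.
  by have [] := Hd _ (ball_segment y vd s01).
have [s s01 E] := mean_value_segment dh.
have Hz := (Hd _ (ball_segment y vd s01)).2.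
have {}E : h (t *: (v + y)) - h (t *: y) =
    t * \sum_j v ord0 j * 'D_(delta_mx 0 j) h (t *: (s *: v + y)).
  rewrite scalerDr E derive_coord; last exact: dh.
  rewrite mulr_sumr; apply: eq_bigr => j _.
  by rewrite mxE mulrA scalerDr !scalerA [s * t]mulrC.
have [t0 t1] := andP t01.
rewrite -mulrBr E mulrA -exprSr mulr_sumr -sumrB.
apply: (le_trans (ler_norm_sum _ _ _)).
have -> : e * `|v| = n.+1%:R * (`|v| * e') by rewrite /e' [n.+1%:R * _]mulrC -mulrA divfK ?pnatr_eq0// mulrC.
apply: (@le_trans _ _ (\sum_(j < n) `|v| * e')).
  apply: ler_sum => j _.
  have -> (u1 u2 u3 u4 : R) :
      u1 * (u2 * u3) - u2 * (u1 * u4) = u1 * (u2 * (u3 - u4)) by ring.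
  rewrite normrM normrX (ger0_norm t0).
  apply: (@le_trans _ _ (`|v ord0 j * ('D_(delta_mx 0 j) h (t *: (s *: v + y)) -
      'D_(delta_mx 0 j) h (t *: y))|)).
    by rewrite ler_piMl// exprn_ile1.
  rewrite normrM ler_pM//; last exact: Hz.
  rewrite /Num.norm /= mx_normrE.
  exact: (le_bigmax _ (fun i => `|v i.1 i.2|) (ord0, j)).
rewrite sumr_const card_ord -[leLHS]mulr_natl ler_wpM2r//.
  by rewrite mulr_ge0// ltW.
by rewrite ler_nat.
Unshelve. all: by end_near. Qed.

Lemma Ck_ray_mean k m h : Ck k A h -> Ck k A (ray_mean m h).
Proof.
have oA : open A by exact: ball_open.
elim: k m h => [|k IH] m h ch; first exact: ray_mean_continuous.
have ch1 : Ck 1 A h.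
  have [dh Dh] := ch; split=> // v.
  by elim: {ch IH} k Dh => [|k IHk] Dh; [exact: Dh|apply: IHk => w; exact/CkW].
have H y : A y -> _ := fun Ay => differentiable_of_estimate
  (fun e e0 => ray_mean_estimate m ch1 Ay e0).
split=> [y /H[]//|v].
have [_ Dh] := ch.
have c : Ck k A (fun y => \sum_j v ord0 j * ray_mean m.+1 ('D_(delta_mx 0 j) h) y).
  apply: Ck_sum => // j; apply: (@CkM R n k A (fun=> v ord0 j)) => //.
    exact: Ck_cst.
  exact/IH/Dh.
by apply: Ck_ext c => // y /H[_ ->].
Qed.

(** Integrate d/dt f(ty) = sum_j y_j (D_j f)(ty) over [0, 1]; the coefficients are
    the means of the partial derivatives along rays. *)
Lemma hadamard f : smooth_on A f -> exists g : 'I_n -> 'rV[R]_n -> R,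
  (forall j, smooth_on A (g j)) /\
  forall y, A y -> f y = f 0 + \sum_j y ord0 j * g j y.
Proof.
move=> sf; pose g j := ray_mean 0 ('D_(delta_mx 0 j) f).
exists g; split=> [j k|y Ay].
  by apply: Ck_ray_mean; have [_] := sf k.+1; exact.
have cD j : Ck 0 A ('D_(delta_mx 0 j) f) by have [_] := sf 1%N; exact.
have df z : A z -> differentiable f z by have [+ _] := sf 1%N; exact.
have iD j := ray_integrable 0 (cD j) Ay.
have [iS SE] := int01_sum (fun j => y ord0 j) iD.
rewrite /g /ray_mean -SE.
pose F (t : R) := f (t *: y).
have dF (t : R) : 0 <= t <= 1 -> is_derive t (1 : R) F ('D_y f (t *: y)).
  move=> t01; have := @is_derive_line f 0 y t; rewrite addr0.
  have -> : (fun t : R => f (t *: y + 0)) = F by apply/funext => u; rewrite addr0.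
  by apply; apply: df; exact: ball0_star.
pose F' (t : R) := \sum_j y ord0 j * (t ^+ 0 * 'D_(delta_mx 0 j) f (t *: y)).
have F'E (t : R) : 0 <= t <= 1 -> F' t = 'D_y f (t *: y).
  move=> t01; rewrite derive_coord; last exact/df/ball0_star.
  by apply: eq_bigr => j _; rewrite expr0 mul1r.
have cF' (t : R) : 0 <= t <= 1 -> {for t, continuous F'}.
  move=> t01; apply: cvg_big => [|j _]; first exact: add_continuous.
  apply: cvgM; first exact: cvg_cst.
  exact: (@ray_continuous 0 _ y t (cD j) Ay t01).
have cF (t : R) : 0 <= t <= 1 -> {for t, continuous F}.
  move=> /dF[dFt _]; exact/differentiable_continuous/derivable1_diffP.
have := @continuous_FTC2 R F' F 0 1 ltr01 _ _ _.
rewrite /Rintegral => -> /=.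
- by rewrite /F scale1r scale0r [RHS]addrC subrK.
- by apply: continuous_in_subspaceT => t; rewrite inE /= in_itv /= => /cF'.
- split=> [t||].
  + by rewrite in_itv /= => /andP[t0 t1]; have [] := dF t; rewrite ?ltW.
  + by apply: cvg_at_right_filter; apply: cF; rewrite lexx ler01.
  + by apply: cvg_at_left_filter; apply: cF; rewrite lexx ler01.
- move=> t; rewrite in_itv /= => /andP[t0 t1].
  have t01 : 0 <= t <= 1 by rewrite !ltW.
  by rewrite derive1E F'E//; have [] := dF t t01.
Qed.

End Hadamard.

(** * Bump functions and point derivations on a manifold *)

Section ManifoldBump.
Context {R : realType} {M : manifold R}.

Lemma chart_open (c : chart M (mdim M)) (B : set 'rV[R]_(mdim M)) :
  open B -> open (cdom c `&` c @^-1` B).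
Proof.
move=> oB; rewrite openE => x [cx Bx]; apply: filterI.
  by apply: open_nbhs_nbhs; split=> //; exact: cdom_open.
by apply: (cmap_cont cx); exact: open_nbhs_nbhs.
Qed.

Lemma msmooth_chart (c : chart M (mdim M)) (B : set 'rV[R]_(mdim M)) F :
  atlas c -> open B -> smooth_on B F -> msmooth (cdom c `&` c @^-1` B) (F \o c).
Proof.
move=> ac oB sF c' ac' k.
have [tr _] := (atlas_max c').1 ac' c ac.
have oW := chart_open c oB.
apply: (Ck_comp (B := B) (g := fun y => c (cinv c' y))) (sF k).
- exact: cimg_openI.
- by move=> _ [x [c'x [cx Bx]] <-]; rewrite cmapK.
- move=> j; apply: Ck_sub (tr j k).
  by move=> _ [x [c'x [cx Bx]] <-]; exists x.
Qed.

(** rho has its support in U.  The product of such a rho with any total function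
    that is smooth on U is smooth on M, whatever the function is off U. *)
Definition supported_in (U : set M) (rho : cinf M) : Prop :=
  exists2 K : set M, closed K /\ K `<=` U & forall y, ~ K y -> rho y = 0.

Lemma supported_msmooth U rho g : open U -> supported_in U rho -> msmooth U g ->
  msmooth setT (fun y => rho y * g y).
Proof.
move=> oU [K [cK KU] rho0] sg; apply: msmooth_local => x _.
have [Kx|nKx] := pselect (K x).
  exists U; first exact: KU.
  by apply: msmoothM sg => //; apply: msmooth_sub (cinf_smooth rho).
exists (~` K) => //; apply: (msmooth_ext (f := fun=> 0)); first exact: closed_openC.
  by move=> y nKy; rewrite rho0// mul0r.
exact: msmooth_cst.
Qed.

Lemma supported_out U rho y : supported_in U rho -> ~ U y -> rho y = 0.
Proof. by move=> [K [_ KU] rho0] nUy; apply: rho0 => /KU. Qed.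

(** The bump function of a small ball in a chart, extended by 0.  The extension is
    smooth because the closed ball is compact, hence its preimage K is closed in
    M: this is where the Hausdorff axiom is used. *)
Lemma bump_function U x : open U -> U x ->
  exists2 rho : cinf M, supported_in U rho & \forall y \near x, rho y = 1.
Proof.
move=> oU Ux; have [c ac cx] := atlas_cover x.
have oI := cimg_openI (c := c) oU.
have /nbhs_ballP[r /= r0 rP] : nbhs (c x) (c @` (cdom c `&` U)).
  by apply: open_nbhs_nbhs; split => //; exists x.
have r20 : 0 < r / 2 by rewrite divr_gt0.
have [b [sb b1 b0]] := euclidean_bump (c x) r20.
pose B := closed_ball (c x) (r / 2).
have BI : B `<=` c @` (cdom c `&` U).
  by apply: subset_trans rP; apply: closed_ball_subset; lra.
pose K := cinv c @` B.
have KU : K `<=` U by move=> _ [z /BI[y [cy Uy] <-] <-]; rewrite cmapK.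
have cK : closed K.
  apply: compact_closed; first exact: manifold_hausdorff.
  apply: continuous_compact; last first.
    apply: bounded_closed_compact; last exact: closed_ball_closed.
    exists (`|c x| + r); split; first exact: num_real.
    move=> k kb z Bz; apply: ltW; apply: le_lt_trans kb.
    have : ball (c x) r z by apply: closed_ball_subset Bz; lra.
    rewrite -ball_normE /= => /ltW; rewrite distrC => zr.
    by rewrite -[z](subrK (c x)) addrC (le_trans (ler_normD _ _))// lerD2l.
  apply: continuous_in_subspaceT => z; rewrite inE => /BI[y [cy _] <-].
  by apply: cinv_cont; exists y.
pose f y := if `[< cdom c y >] then b (c y) else 0.
have f0 y : ~ K y -> f y = 0.
  rewrite /f; case: asboolP => // cy nKy; apply: b0 => By; apply: nKy.
  by exists (c y); [exact: subset_closed_ball|rewrite cmapK].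
have sf : msmooth setT f.
  apply: msmooth_local => y _; have [cy|ncy] := pselect (cdom c y).
    exists (cdom c) => //; apply: (msmooth_ext (f := b \o c)).
    - exact: cdom_open.
    - by move=> z cz /=; rewrite /f asboolT.
    - apply: msmooth_sub (msmooth_chart ac openT sb) => z cz; split => //.
  exists (~` K).
    by move=> [z /BI[w [cw _] <-] E]; apply: ncy; rewrite -E cmapK.
  apply: (msmooth_ext (f := fun=> 0)); first exact: closed_openC.
    by move=> z nKz; rewrite f0.
  exact: msmooth_cst.
exists (mk_cinf sf); first by exists K.
near=> y => /=; rewrite /f asboolT; last first.
  by near: y; apply: open_nbhs_nbhs; split=> //; exact: cdom_open.
near: y; exact: (cmap_cont cx b1).
Unshelve. all: by end_near. Qed.

Lemma cinf_extend U x g : open U -> U x -> msmooth U g ->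
  exists h : cinf M, \forall y \near x, h y = g y.
Proof.
move=> oU Ux sg; have [rho cr r1] := bump_function oU Ux.
exists (mk_cinf (supported_msmooth oU cr sg)).
by apply: filterS r1 => y /= ->; rewrite mul1r.
Qed.

Lemma tangent1 x (v : tangent M x) : v 1 = 0.
Proof.
have := tleibniz v 1 1; rewrite mulr1 cinf1E !mul1r => /eqP.
by rewrite -subr_eq0 opprD addrA subrr sub0r oppr_eq0 => /eqP.
Qed.

Lemma tangent0 x (v : tangent M x) : v 0 = 0.
Proof. by apply: (addrI (v 0)); rewrite -tD !addr0. Qed.

Lemma tangent_cst x (v : tangent M x) a : v (cinf_cst a) = 0.
Proof. by rewrite /cinf_cst -[_ *: _]addr0 tlinear tangent1 tangent0 mulr0 addr0. Qed.

Lemma tangentN x (v : tangent M x) f : v (- f) = - v f.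
Proof. by apply/eqP; rewrite -addr_eq0 -tD addNr tangent0. Qed.

Lemma near_bump x (P : set M) : nbhs x P ->
  exists2 rho : cinf M, rho x = 1 & forall y, rho y != 0 -> P y.
Proof.
rewrite nbhsE => -[U [oU Ux] UP].
have [rho cr r1] := bump_function oU Ux; exists rho; first exact: nbhs_singleton r1.
by move=> y; apply: contraNP => nPy; rewrite (supported_out cr)// => /UP.
Qed.

(** If rho vanishes off the set where f = g and rho x = 1, then rho (f - g) = 0,
    and the Leibniz rule at x gives v (f - g) = 0. *)
Lemma tangent_local x (v : tangent M x) (f g : cinf M) :
  (\forall y \near x, f y = g y) -> v f = v g.
Proof.
move=> /near_bump[rho rx rP].
have E : rho * (f - g) = 0.
  apply: cinf_eq => y; rewrite cinfME cinfDE cinfNE.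
  have [->|/rP ->] := eqVneq (rho y) 0; first by rewrite mul0r.
  by rewrite subrr mulr0.
have fgx : f x = g x by apply: rP; rewrite rx oner_eq0.
have := tleibniz v rho (f - g).
rewrite E tangent0 cinfDE cinfNE fgx subrr mul0r addr0 rx mul1r tD tangentN.
by move=> /esym/eqP; rewrite subr_eq0 => /eqP.
Qed.

Section Sums.
Variables (x : M) (v : tangent M x).

Lemma tangent_sum (I : finType) (f : I -> cinf M) : v (\sum_i f i) = \sum_i v (f i).
Proof. by elim/big_rec2 : _ => [|i y1 y2 _ <-]; [exact: tangent0|exact: tD]. Qed.

Lemma cinf_sumE (I : finType) (f : I -> cinf M) y : (\sum_i f i) y = \sum_i f i y.
Proof. by elim/big_rec2 : _ => // i y1 y2 _ <-. Qed.

Lemma tsumE (I : finType) (u : I -> tangent M x) f : (\sum_i u i) f = \sum_i u i f.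
Proof. by elim/big_rec2 : _ => // i y1 y2 _ <-. Qed.

End Sums.

Lemma tscaleE x (v : tangent M x) a f : (a *: v) f = a * v f. Proof. by []. Qed.
Lemma taddE x (v w : tangent M x) f : (v + w) f = v f + w f. Proof. by []. Qed.
Lemma toppE x (v : tangent M x) f : (- v) f = - v f. Proof. by []. Qed.

(** The coordinates are global functions and the fields are global vector fields;
    they behave as coordinates and coordinate fields near x only. *)
Definition coordinate_frame n (x : M) (xi : 'I_n -> cinf M)
    (E : 'I_n -> vfield M) :=
  \forall y \near x, (forall i j, E j y (xi i) = (i == j)%:R) /\
    forall v : tangent M y, v = \sum_j v (xi j) *: E j y.

Section Frame.
Variables (c : chart M (mdim M)) (ac : atlas c).
Let n := mdim M.

Let cimg : set 'rV[R]_n := c @` cdom c.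
Let ocimg : open cimg := @cimg_open _ _ _ c.

Lemma cinf_chart (f : cinf M) : smooth_on cimg (f \o cinv c).
Proof.
move=> k; have := cinf_smooth f ac k.
by rewrite setIT.
Qed.

Variables (rho : cinf M) (srho : supported_in (cdom c) rho).

(** The j-th coordinate field of c, multiplied by rho to extend it to M. *)
Definition dcoord_fun (j : 'I_n) (y : M) (f : cinf M) : R :=
  rho y * 'D_(delta_mx 0 j) (f \o cinv c) (c y).

Program Definition dcoord_at j y : tangent M y := @Tangent R M y (dcoord_fun j y) _.
Next Obligation.
move=> j y; have [cy|ncy] := pselect (cdom c y); last first.
  rewrite /dcoord_fun (supported_out srho ncy).
  by split=> *; rewrite !mul0r ?mulr0 addr0.
have iy : cimg (c y) by exists y.
have df (f : cinf M) : derivable (f \o cinv c) (c y) (delta_mx 0 j).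
  by apply: diff_derivable; have [+ _] := cinf_chart f 1; exact.
rewrite /dcoord_fun; split=> [a f g|f g].
  have -> : (a *: f + g : cinf M) \o cinv c = a *: (f \o cinv c) + (g \o cinv c).
    by apply/funext.
  rewrite deriveD; [|exact: derivableZ|exact: df].
  by rewrite deriveZ// mulrDr mulrCA.
have -> : (f * g : cinf M) \o cinv c = (f \o cinv c) * (g \o cinv c).
  by apply/funext.
rewrite deriveM// /= cmapK// /GRing.scale /=; ring.
Qed.

Lemma dcoord_smooth j : smooth_vf_on setT (dcoord_at j).
Proof.
move=> f; apply: (supported_msmooth (U := cdom c)) srho _; first exact: cdom_open.
have sD : smooth_on cimg ('D_(delta_mx 0 j) (f \o cinv c)).
  by move=> k; have [_] := cinf_chart f k.+1; exact.
by apply: msmooth_sub (msmooth_chart ac ocimg sD) => y cy; split=> //; exists y.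
Qed.

Definition dcoord j : vfield M := VField (dcoord_smooth j).

Lemma coord_msmooth j : msmooth (cdom c) (fun y => c y ord0 j).
Proof.
have := msmooth_chart ac openT (smooth_on_coord setT j).
by rewrite preimage_setT setIT.
Qed.

Definition coord j : cinf M :=
  mk_cinf (supported_msmooth (@cdom_open _ _ _ c) srho (coord_msmooth j)).

(** Near y the Hadamard lemma gives f = f y + sum_j (xi_j - xi_j y) h_j.  A point
    derivation u at y kills the constant and sees only the values h_j y, so
    u f = sum_j u xi_j * h_j y; for u the i-th coordinate field this identifies
    h_i y as the i-th partial derivative of f. *)
Lemma chart_frame x : (\forall y \near x, rho y = 1) ->
  coordinate_frame x coord dcoord.
Proof.
move=> /near_join; apply: filterS => y r1.
have ry : rho y = 1 by exact: nbhs_singleton r1.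
have cy : cdom c y.
  by apply: contrapT => /(supported_out srho)/eqP; rewrite ry oner_eq0.
have iy : cimg (c y) by exists y.
have ccy : cinv c z @[z --> c y] --> y.
  by have := cinv_cont iy; rewrite /prop_for /continuous_at cmapK.
have Dxi i j : dcoord j y (coord i) = (i == j)%:R.
  rewrite /= /dcoord_fun ry mul1r.
  have -> : 'D_(delta_mx 0 j) (coord i \o cinv c) (c y) =
      'D_(delta_mx 0 j) (fun z : 'rV[R]_n => z ord0 i) (c y).
    apply: near_eq_derive.
    have : \forall z \near c y, cimg z by exact: open_nbhs_nbhs.
    have : \forall z \near c y, rho (cinv c z) = 1.
      exact: (ccy _ r1).
    by apply: filterS2 => z r1z [w cw wz]; rewrite /= r1z mul1r -wz cmapK.
  have /matrixP/(_ ord0 i) := derive_mx (@derivable_id _ _ (c y) (delta_mx 0 j)).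
  by rewrite derive_id !mxE eqxx /= => <-.
split=> // v; apply: tangent_eq => f.
have [r /= r0 rP] : exists2 r, 0 < r & ball (c y) r `<=` cimg.
  by apply/nbhs_ballP; exact: open_nbhs_nbhs.
pose F z := f (cinv c (z + c y)).
have sF : smooth_on (ball (0 : 'rV[R]_n) r) F.
  move=> k; apply: (Ck_comp (B := cimg) (g := fun z => z + c y)) (cinf_chart f k).
  - exact: ball_open.
  - move=> z; rewrite -ball_normE /= sub0r normrN => zr; apply: rP.
    by rewrite -ball_normE /= opprD addrCA subrr addr0 normrN.
  - move=> j; have -> : (fun z : 'rV[R]_n => (z + c y) ord0 j) =
        (fun z => z ord0 j) \+ cst (c y ord0 j).
      by apply/funext => z; rewrite mxE.
    by apply: CkD; [exact: ball_open|exact: smooth_on_coord|exact: Ck_cst].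
have [g [sg gP]] := hadamard sF.
have oU : open (cdom c `&` c @^-1` ball (c y) r).
  by apply: chart_open; exact: ball_open.
have Uy : (cdom c `&` c @^-1` ball (c y) r) y by split=> //=; exact: ballxx.
have [h hP] : exists h : 'I_n -> cinf M,
    forall j, \forall z \near y, h j z = g j (c z - c y).
  suff : forall j, exists h : cinf M, \forall z \near y, h z = g j (c z - c y).
    by move=> /choice[h]; exists h.
  move=> j; apply: (cinf_extend oU Uy).
  apply: (msmooth_chart (F := fun z => g j (z - c y))) => //; first exact: ball_open.
  move=> k; apply: (Ck_comp (B := ball (0 : 'rV[R]_n) r)
    (g := fun z => z - c y)) (sg j k).
  - exact: ball_open.
  - by move=> z; rewrite -!ball_normE /= sub0r normrN distrC.
  - move=> i; have -> : (fun z : 'rV[R]_n => (z - c y) ord0 i) =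
        (fun z => z ord0 i) \+ cst (- c y ord0 i).
      by apply/funext => z; rewrite !mxE.
    by apply: CkD; [exact: ball_open|exact: smooth_on_coord|exact: Ck_cst].
have E (u : tangent M y) : u f = \sum_j u (coord j) * h j y.
  have Enear : \forall z \near y, f z =
      (cinf_cst (f y) + \sum_j (coord j - cinf_cst (coord j y)) * h j) z.
    near=> z; have [cz Bz] : (cdom c `&` c @^-1` ball (c y) r) z.
      by near: z; exact: open_nbhs_nbhs.
    have -> : f z = F (c z - c y) by rewrite /F subrK cmapK.
    rewrite gP; last by move: Bz; rewrite -!ball_normE /= sub0r normrN distrC.
    rewrite cinfDE cinf_sumE /F add0r cmapK// cinfZE cinf1E mulr1.
    congr (_ + _); apply: eq_bigr => j _.
    rewrite cinfME cinfDE cinfNE cinfZE cinf1E mulr1 /= ry mul1r.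
    have -> : rho z = 1 by near: z.
    have -> : h j z = g j (c z - c y) by move: j; near: z; exact: filter_forall.
    by rewrite mul1r !mxE.
  rewrite (tangent_local u Enear) tD tangent_cst add0r tangent_sum.
  apply: eq_bigr => j _; rewrite tleibniz cinfDE cinfNE cinfZE cinf1E mulr1.
  rewrite subrr mul0r add0r.
  by rewrite tD tangentN tangent_cst subr0 mulrC.
rewrite E tsumE; apply: eq_bigr => j _; rewrite tscaleE E; congr (_ * _).
rewrite (bigD1 j)// Dxi eqxx mul1r big1 => [|i ij]; first by rewrite [RHS]addr0.
by rewrite Dxi (negbTE ij) mul0r.
Unshelve. all: by end_near. Qed.

End Frame.

Lemma coordinate_frame_exists (x : M) :
  exists (xi : 'I_(mdim M) -> cinf M) (E : 'I_(mdim M) -> vfield M),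
    coordinate_frame x xi E.
Proof.
have [c ac cx] := atlas_cover x.
have [rho srho r1] := bump_function (@cdom_open _ _ _ c) cx.
by exists (coord ac srho), (dcoord ac srho); exact: chart_frame.
Qed.

End ManifoldBump.

(** * Derivations of a line bundle *)

Section Gauge.
Context {R : realType} {M : manifold R} (L : line_bundle M).
Implicit Types (s t e : Gamma L) (f g rho : cinf M).

Lemma supported_section_smooth (t : set M * (forall x, L x)) rho :
  trivs t -> supported_in t.1 rho ->
  smooth_section (fun y => rho y *: t.2 y : L y).
Proof.
move=> Tt srho; apply: smooth_section_local => x.
have [K [cK Kt] rho0] := srho.
have [Kx|nKx] := pselect (K x).
  exists t, t.1; split=> //; [exact: Kt|exact: triv_open|exact: Kt|].
  by exists rho => //; apply: msmooth_sub (cinf_smooth rho).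
have [u Tu ux] := triv_cover L x.
exists u, (u.1 `&` ~` K); split=> //.
  by apply: openI; [exact: triv_open|exact: closed_openC].
exists (fun=> 0); first exact: msmooth_cst.
by move=> y [uy nKy]; rewrite rho0// !scale0r.
Qed.

Lemma smooth_section_near (s : forall x, L x) :
  (forall x : M, exists s' : Gamma L, \forall y \near x, s y = s' y) ->
  smooth_section s.
Proof.
move=> H; apply: smooth_section_local => x; have [s' ss'] := H x.
have [t Tt tx] := triv_cover L x; have [g sg gP] := sec_smooth s' Tt.
move: ss'; rewrite /prop_near1 nbhsE => -[U [oU Ux] UP].
exists t, (U `&` t.1); split=> //; first by apply: openI => //; exact: triv_open.
exists g; first by apply: msmooth_sub sg => y [].
by move=> y [Uy ty]; rewrite UP// gP.
Qed.

Lemma fiber_dim1 x (u w : L x) : u != 0 -> exists a, w = a *: u.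
Proof.
have [t Tt tx] := triv_cover L x; have [a [-> _]] := triv_basis Tt tx u.
have [b [-> _]] := triv_basis Tt tx w.
have [->|a0 _] := eqVneq a 0; first by rewrite scale0r eqxx.
by exists (b / a); rewrite scalerA divfK.
Qed.

(** A local trivialization at x in global terms: e is a global section which does
    not vanish near x, and k s is the coordinate of s with respect to e, cut off
    by rho so as to be globally smooth. *)
Definition gauge (x : M) (e : Gamma L) (rho : cinf M) (k : Gamma L -> cinf M) :=
  [/\ forall f s t, k (f *: s + t) = f * k s + k t,
      forall s, k s *: e = rho *: s &
      \forall y \near x, rho y = 1 /\ e y != 0].

Lemma gauge_exists x : exists e rho k, gauge x e rho k.
Proof.
have [t Tt tx] := triv_cover L x.
have [rho srho r1] := bump_function (triv_open Tt) tx.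
pose e : Gamma L := Section_ (supported_section_smooth Tt srho).
have t0 y : t.1 y -> t.2 y != 0.
  move=> ty; apply/eqP => ty0; have := @triv_inj _ _ _ _ _ 1 0 Tt ty.
  by rewrite ty0 !scaler0 => /(_ erefl)/eqP; rewrite oner_eq0.
have Hk s : exists k : cinf M, forall y,
    k y *: t.2 y = rho y *: s y /\ (~ t.1 y -> k y = 0).
  have [g sg gP] := sec_smooth s Tt.
  exists (mk_cinf (supported_msmooth (triv_open Tt) srho sg)) => y /=.
  have [ty|nty] := pselect (t.1 y); last first.
    by rewrite (supported_out srho nty) mul0r !scale0r.
  by rewrite gP// scalerA.
have [k kP] := choice Hk.
(* Both the section e and the coordinate k s carry one factor rho. *)
exists e, (rho * rho), (fun s => k s); split.
- move=> f s u; apply: cinf_eq => y; rewrite cinfDE cinfME.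
  have [ty|nty] := pselect (t.1 y); last first.
    by rewrite !(kP _ y).2// mulr0 addr0.
  apply: (triv_inj Tt ty); rewrite (kP _ y).1 scalerDl -scalerA !(kP _ y).1.
  by rewrite secDE secZE scalerDr !scalerA [f y * _]mulrC.
- move=> s; apply: sec_eq => y; rewrite !secZE /= scalerA [_ * rho y]mulrC -scalerA.
  by rewrite (kP s y).1 scalerA.
- near=> y; have ry : rho y = 1 by near: y.
  split; first by rewrite cinfME ry mulr1.
  have -> : e y = rho y *: t.2 y by [].
  rewrite ry scale1r; apply: t0.
  by apply: contrapT => /(supported_out srho)/eqP; rewrite ry oner_eq0.
Unshelve. all: by end_near. Qed.

Lemma nonzero_section x : exists e : Gamma L, e x != 0.
Proof.
have [e [rho [k [_ _ ex]]]] := gauge_exists x.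
by exists e; case: (nbhs_singleton ex).
Qed.

Lemma symbol_unique (D : Gamma L -> Gamma L) X Y :
  is_symbol D X -> is_symbol D Y -> X = Y.
Proof.
move=> DX DY; apply: vfield_eq => x f; have [e ex] := nonzero_section x.
have /(congr1 (fun s : Gamma L => s x)) := DX f e.
rewrite DY !secDE => /addIr; rewrite !secZE !vf_appE => /eqP.
by rewrite -subr_eq0 -scalerBl scaler_eq0 (negbTE ex) orbF subr_eq0 => /eqP.
Qed.

Implicit Types (D E : derivation L).

Definition symbol D : vfield M := projT1 (cid (derP D).2).

Lemma symbolP D : is_symbol D (symbol D).
Proof. by rewrite /symbol; case: cid. Qed.

Lemma symbolE D f s x : D (f *: s) x = symbol D x f *: s x + f x *: D s x.
Proof. by rewrite symbolP. Qed.

Lemma symbol_eq D X : is_symbol D X -> symbol D = X.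
Proof. exact: symbol_unique (symbolP D). Qed.

(** The value at x of a derivation, seen as the map s |-> D s x, is its class in
    the fibre of the gauge algebroid at x; it determines the symbol at x. *)
Lemma symbol_det D E x : (forall s, D s x = E s x) -> symbol D x = symbol E x.
Proof.
move=> DE; apply: tangent_eq => f; have [e ex] := nonzero_section x.
have := DE (f *: e); rewrite !symbolE DE => /addIr/eqP.
by rewrite -subr_eq0 -scalerBl scaler_eq0 (negbTE ex) orbF subr_eq0 => /eqP.
Qed.

Lemma der_sumE (I : finType) (F : I -> derivation L) s x :
  (\sum_i F i) s x = \sum_i F i s x.
Proof. by elim/big_rec2 : _ => // i y1 y2 _ <-. Qed.
Lemma sec_sumE (I : finType) (F : I -> Gamma L) x : (\sum_i F i) x = \sum_i F i x.
Proof. by elim/big_rec2 : _ => // i y1 y2 _ <-. Qed.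
Lemma derZE f D s x : (f *: D) s x = f x *: D s x. Proof. by []. Qed.
Lemma derDE D E s x : (D + E) s x = D s x + E s x. Proof. by []. Qed.
Lemma secNE s x : (- s) x = - s x.
Proof. by rewrite -[LHS]/((-1 : R) *: s x) scaleN1r. Qed.
Lemma derNE D s x : (- D) s x = - D s x.
Proof. by rewrite -[LHS]/((-1 : R) *: D s x) scaleN1r. Qed.

Lemma symbolD D E x : symbol (D + E) x = symbol D x + symbol E x.
Proof.
rewrite (@symbol_eq (D + E) (vf_add (symbol D) (symbol E)))// => f s.
apply: sec_eq => y; rewrite derDE !symbolE !secDE !secZE derDE.
by rewrite scalerDr scalerDl addrACA.
Qed.

Lemma symbolZ f D x : symbol (f *: D) x = f x *: symbol D x.
Proof.
rewrite (@symbol_eq (f *: D) (vf_scale f (symbol D)))// => g s.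
apply: sec_eq => y; rewrite derZE !symbolE !secDE !secZE.
by rewrite scalerDr !scalerA [f y * g y]mulrC.
Qed.

Lemma symbol_bracket D E :
  symbol (der_bracket D E) = vf_bracket (symbol D) (symbol E).
Proof.
apply: symbol_eq => f s; apply: sec_eq => y.
have bE (s' : Gamma L) : der_bracket D E s' y = D (E s') y - E (D s') y.
  by rewrite -secNE.
rewrite bE !symbolP !derD !secDE !symbolE !secZE bE.
rewrite [vf_app _ f y]/= scalerBl scalerBr !vf_appE.
rewrite !opprD !addrA.
have cancel (V : zmodType) (a b c d a' d' : V) :
    a + b + c + d - a' - c - b - d' = a - a' + d - d'.
  congr (_ - _); rewrite [_ - a' - c]addrAC [_ + d - c]addrAC addrK.
  by rewrite [_ - a' - b]addrAC [_ + d - b]addrAC addrK addrAC.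
exact: cancel.
Qed.


Program Definition der_one : derivation L := @Derivation R M L idfun _.
Next Obligation.
split=> //; exists vf_zero => f s; apply: sec_eq => x.
by rewrite secDE !secZE scale0r add0r.
Qed.

Lemma symbol1 x : symbol der_one x = 0.
Proof.
rewrite (@symbol_eq der_one vf_zero)// => f s; apply: sec_eq => y.
by rewrite secDE !secZE scale0r add0r.
Qed.

Lemma symbol0 x : symbol 0 x = 0.
Proof. by rewrite -(scale0r der_one) symbolZ scale0r. Qed.

Lemma der0 D : D 0 = 0.
Proof. by apply: (addrI (D 0)); rewrite -derD !addr0. Qed.

Lemma derN D s : D (- s) = - D s.
Proof. by apply/eqP; rewrite -addr_eq0 -derD addNr der0. Qed.

Lemma der_local D s t x : (\forall y \near x, s y = t y) -> D s x = D t x.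
Proof.
move=> /near_bump[rho rx rP].
have E : rho *: (s - t) = 0.
  apply: sec_eq => y; rewrite secZE secDE secNE.
  by have [->|/rP ->] := eqVneq (rho y) 0; rewrite ?scale0r// subrr scaler0.
have stx : s x = t x by apply: rP; rewrite rx oner_eq0.
have := symbolE D rho (s - t) x; rewrite E der0 secDE secNE stx subrr scaler0 add0r.
rewrite rx scale1r derD derN secDE secNE => /esym/eqP.
by rewrite subr_eq0 => /eqP.
Qed.

Section Covariant.
Variables (x : M) (e : Gamma L) (rho : cinf M) (k : Gamma L -> cinf M).
Hypothesis gP : gauge x e rho k.

Lemma gaugeZ f s : k (f *: s) = f * k s.
Proof.
have [kl _ _] := gP.
have k0 : k 0 = 0 by have := kl (-1) 0 0; rewrite scaler0 addr0 mulN1r addNr.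
by rewrite -[f *: s]addr0 kl k0 addr0.
Qed.
Lemma gaugeD s t : k (s + t) = k s + k t.
Proof. by have [kl _ _] := gP; rewrite -{1}[s]scale1r kl mul1r. Qed.

(** The flat connection of the trivialization e, for which e is parallel near x.
    The cut-off contained in k makes it global and turns its symbol into
    rho X. *)
Program Definition cov (X : vfield M) : derivation L :=
  @Derivation R M L (fun s => vf_app X (k s) *: e) _.
Next Obligation.
move=> X; split=> [a s t|].
  rewrite gaugeD gaugeZ scalerA -scalerDl; congr (_ *: _).
  apply: cinf_eq => y; rewrite vf_appE tD tleibniz cinfDE cinfME tangent_cst.
  by rewrite mulr0 addr0.
exists (vf_scale rho X) => f s; rewrite gaugeZ vf_app_leibniz scalerDl.
rewrite addrC scalerA; congr (_ + _).
have [_ ke _] := gP.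
rewrite mulrC -scalerA ke scalerA; congr (_ *: _).
by apply: cinf_eq => y; rewrite cinfME mulrC.
Qed.

Lemma covE X s y : cov X s y = X y (k s) *: e y. Proof. by []. Qed.

Lemma symbol_cov X y : rho y = 1 -> symbol (cov X) y = X y.
Proof.
move=> ry; rewrite (@symbol_eq (cov X) (vf_scale rho X)).
  by rewrite -[LHS]/(rho y *: X y) ry scale1r.
move=> f s; apply: sec_eq => z.
rewrite covE secDE !secZE gaugeZ tleibniz scalerDl -scalerA addrC.
congr (_ + _); have [_ ke _] := gP.
have /(congr1 (fun s : Gamma L => s z)) := ke s; rewrite !secZE => kez.
by rewrite mulrC -scalerA kez scalerA mulrC.
Qed.

Lemma gauge_e : \forall y \near x, forall s, k s y *: e y = s y.
Proof.
have [_ ke H] := gP; apply: filterS H => y [ry _] s.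
by have /(congr1 (fun s : Gamma L => s y)) := ke s; rewrite !secZE ry scale1r.
Qed.

Variables (n : nat) (xi : 'I_n -> cinf M) (E : 'I_n -> vfield M).
Hypothesis fP : coordinate_frame x xi E.

(** Write s = k s e near y and apply the Leibniz rule: the symbol term is expanded
    in the coordinate frame, and D e = k (D e) e accounts for the rest. *)
Lemma der_decomposition : \forall y \near x, forall D s,
  D s y = \sum_j symbol D y (xi j) *: cov (E j) s y + k (D e) y *: s y.
Proof.
have /near_join H := gauge_e.
apply: filterS2 H fP => y gy [_ fy] D s.
have ey := nbhs_singleton gy.
have -> : D s y = D (k s *: e) y.
  by apply: der_local; apply: filterS gy => z gz; rewrite secZE gz.
rewrite symbolE {1}(fy (symbol D y)) tsumE scaler_suml -{1}(ey (D e)).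
rewrite scalerA [k s y * _]mulrC -scalerA ey; congr (_ + _).
by apply: eq_bigr => j _; rewrite covE tscaleE scalerA.
Qed.

Definition local_frame : 'I_n.+1 -> derivation L :=
  fun i => if unlift ord0 i is Some j then cov (E j) else der_one.

Lemma local_frame_span : \forall y \near x, forall D, exists c : 'I_n.+1 -> R,
  forall s, D s y = \sum_i c i *: local_frame i s y.
Proof.
apply: filterS der_decomposition => y Dy D.
exists (fun i => if unlift ord0 i is Some j
                 then symbol D y (xi j) else k (D e) y) => s.
rewrite big_ord_recl /local_frame unlift_none Dy addrC; congr (_ + _).
by apply: eq_bigr => j _; rewrite liftK.
Qed.

(** Test on the sections f e: f = 1 isolates the coefficient of the identity, and
    f = xi_i that of the i-th coordinate field. *)
Lemma local_frame_free : \forall y \near x, forall c : 'I_n.+1 -> R,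
  (forall s, \sum_i c i *: local_frame i s y = 0) -> forall i, c i = 0.
Proof.
have [_ ke /near_join gx] := gP; have /near_join gx' := gauge_e.
apply: filterS3 gx gx' fP => y gy ky [Exi _] c H.
have [ry ey] := nbhs_singleton gy.
have kf f : \forall z \near y, k (f *: e) z = f z.
  apply: filterS2 gy ky => z [rz ez] kz; apply/eqP.
  have /eqP := kz (f *: e).
  rewrite secZE -subr_eq0 -scalerBl scaler_eq0 (negbTE ez) orbF.
  by rewrite subr_eq0.
have Hf f : c ord0 * f y + \sum_(j < n) c (lift ord0 j) * E j y f = 0.
  have := H (f *: e); rewrite big_ord_recl /local_frame unlift_none.
  under eq_bigr => j _ do rewrite liftK covE (tangent_local _ (kf f)) scalerA.
  rewrite -scaler_suml [der_one _ _]secZE scalerA -scalerDl => /eqP.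
  by rewrite scaler_eq0 (negbTE ey) orbF => /eqP.
have c0 : c ord0 = 0.
  have := Hf 1; rewrite cinf1E mulr1 big1 ?addr0// => j _.
  by rewrite tangent1 mulr0.
move=> i; have [j ->|->//] := unliftP ord0 i.
have := Hf (xi j); rewrite c0 mul0r add0r (bigD1 j)//= Exi eqxx mulr1.
rewrite big1 ?addr0// => l lj.
by rewrite Exi eq_sym (negbTE lj) mulr0.
Qed.

End Covariant.

Lemma vfield_extend x (v : tangent M x) : exists X : vfield M, X x = v.
Proof.
have [xi [E fP]] := coordinate_frame_exists x.
have [_ fx] := nbhs_singleton fP.
pose X := \big[@vf_add R M/@vf_zero R M]_j vf_scale (cinf_cst (v (xi j))) (E j).
exists X; have XE : X x = \sum_j vf_scale (cinf_cst (v (xi j))) (E j) x.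
  by rewrite /X; elim/big_rec2 : _ => // j y1 y2 _ <-.
rewrite [RHS]fx XE; apply: eq_bigr => j _.
by rewrite -[LHS]/(cinf_cst (v (xi j)) x *: E j x) cinfZE cinf1E mulr1.
Qed.

Lemma symbol_lift x (v : tangent M x) : exists D, symbol D x = v.
Proof.
have [X <-] := vfield_extend v; have [e [rho [k gP]]] := gauge_exists x.
exists (cov gP X); apply: symbol_cov; have [_ _ gx] := gP.
by have [] := nbhs_singleton gx.
Qed.

Lemma symbol_lift_near (x : M) (X : vfield M) :
  exists D, \forall y \near x, symbol D y = X y.
Proof.
have [e [rho [k gP]]] := gauge_exists x.
exists (cov gP X); have [_ _ gx] := gP; apply: filterS gx => y [ry _].
exact: symbol_cov.
Qed.

(** Exactness of 0 -> R -> (D L)_x -> T_x M -> 0 at the middle term. *)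
Lemma symbol0_scalar D x : symbol D x = 0 -> exists a, forall s, D s x = a *: s x.
Proof.
have [e [rho [k gP]]] := gauge_exists x.
have [xi [E fP]] := coordinate_frame_exists x.
have Dx := nbhs_singleton (der_decomposition gP fP) D => Dx0.
by exists (k (D e) x) => s; rewrite Dx big1 ?add0r// => j _; rewrite Dx0 scale0r.
Qed.

Section Tensoriality.
Variable alpha : {linear derivation L -> Gamma L}.

Lemma linear_local D (x : M) :
  (\forall y \near x, forall s, D s y = 0) -> alpha D x = 0.
Proof.
move=> /near_bump[rho rx rP].
have E : rho *: D = 0.
  apply: der_eq => s; apply: sec_eq => y; rewrite derZE.
  by have [->|/rP ->] := eqVneq (rho y) 0; rewrite ?scale0r// scaler0.
have := linearZ_LR alpha rho D.
rewrite E linear0 => /(congr1 (fun s : Gamma L => s x)).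
by rewrite secZE rx scale1r => <-.
Qed.

(** D differs from a C^oo-combination of a local frame by a derivation that vanishes
    near x, on which [linear_local] applies; the coefficients of the combination
    vanish at x because D does. *)
Lemma linear_tensorial0 D x : (forall s, D s x = 0) -> alpha D x = 0.
Proof.
move=> Dx; have [e [rho [k gP]]] := gauge_exists x.
have [xi [E fP]] := coordinate_frame_exists x.
pose D' := \sum_j vf_app (symbol D) (xi j) *: cov gP (E j) + k (D e) *: der_one.
have DD' : alpha (D - D') x = 0.
  apply: linear_local; apply: filterS (der_decomposition gP fP) => y Dy s.
  rewrite derDE derNE Dy derDE der_sumE; apply/eqP; rewrite subr_eq0; apply/eqP.
  by congr (_ + _).
rewrite linearB secDE secNE in DD'.
move/eqP: DD'; rewrite subr_eq0 => /eqP ->.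
have D0 : symbol D x = 0.
  by rewrite (@symbol_det D 0 x) ?symbol0.
rewrite linearD linear_sum secDE sec_sumE big1 ?add0r => [|j _].
  rewrite linearZ_LR secZE.
  have kx := nbhs_singleton (gauge_e gP) (D e).
  have [_ _ gx] := gP; have [_ ex] := nbhs_singleton gx.
  move: kx; rewrite Dx => /eqP; rewrite scaler_eq0 (negbTE ex) orbF => /eqP ->.
  by rewrite scale0r.
by rewrite linearZ_LR secZE vf_appE D0 scale0r.
Qed.

Lemma linear_tensorial D E x : (forall s, D s x = E s x) -> alpha D x = alpha E x.
Proof.
move=> DE; apply/eqP; rewrite -subr_eq0 -secNE -secDE -linearB; apply/eqP.
by apply: linear_tensorial0 => s; rewrite derDE derNE DE subrr.
Qed.

End Tensoriality.

End Gauge.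

(** * Cramer's rule in the ring of smooth functions *)

Section Evaluation.
Context {R : realType} {M : manifold R}.

Definition cinf_ev (x : M) (f : cinf M) : R := f x.

Lemma cinf_ev_additive x : zmod_morphism (cinf_ev x).
Proof. by []. Qed.
Lemma cinf_ev_multiplicative x : monoid_morphism (cinf_ev x).
Proof. by []. Qed.
HB.instance Definition _ x :=
  GRing.isZmodMorphism.Build (cinf M) R (cinf_ev x) (cinf_ev_additive x).
HB.instance Definition _ x :=
  GRing.isMonoidMorphism.Build (cinf M) R (cinf_ev x) (cinf_ev_multiplicative x).

Lemma open_cinf_neq0 (f : cinf M) : open [set x | f x != 0].
Proof.
rewrite openE => x fx; have [c ac cx] := atlas_cover x.
have iy : (c @` cdom c) (c x) by exists x.
have cf : {for c x, continuous (f \o cinv c)}.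
  have := cinf_smooth f ac 0; rewrite setIT; exact.
have : \forall z \near c x, f (cinv c z) != 0.
  have fcx : (f \o cinv c) (c x) != 0 by rewrite /= cmapK.
  by apply: (cf [set t | t != 0]); apply: open_nbhs_nbhs; split=> //;
     exact: open_neq.
move=> /(cmap_cont cx).
have : \forall z \near x, cdom c z.
  by apply: open_nbhs_nbhs; split=> //; exact: cdom_open.
by apply: filterS2 => z cz; rewrite /= cmapK.
Qed.

Lemma near_inverse (f : cinf M) (x : M) : f x != 0 ->
  exists h : cinf M, \forall y \near x, h y * f y = 1.
Proof.
move=> fx; have oU := open_cinf_neq0 f.
have sV : msmooth [set x | f x != 0] (fun y => (f y)^-1).
  by apply: msmoothV => //; apply: msmooth_sub (cinf_smooth f).
have [h hP] := cinf_extend oU fx sV.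
exists h; have H : \forall y \near x, f y != 0 by exact: open_nbhs_nbhs.
by apply: filterS2 H hP => y fy ->; rewrite mulVf.
Qed.

(** The adjugate is defined over the commutative ring C^oo(M), so that smoothness
    of the inverse comes for free once the determinant is inverted near x. *)
Lemma near_invertible n (A : 'M[cinf M]_n) (x : M) :
  \det (map_mx (cinf_ev x) A) != 0 ->
  exists B : 'M[cinf M]_n, \forall y \near x, map_mx (cinf_ev y) (B *m A) = 1%:M.
Proof.
rewrite det_map_mx => dA; have [h hP] := near_inverse dA.
exists (h *: \adj A); apply: filterS hP => y hy.
rewrite -scalemxAl mul_adj_mx; apply/matrixP => i j.
by rewrite !mxE rmorphM rmorphMn /= mulrnAr -[X in X *+ _]/(h y * \det A y) hy.
Qed.

End Evaluation.

(** * Non-degeneracy of Atiyah forms, pointwise and on sections *)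

Section AtiyahForms.
Context {R : realType} {M : manifold R} {L : line_bundle M}.
Implicit Types (s t : Gamma L) (D E : derivation L) (w : atiyah2 L).

Definition aform_lin w D : {linear derivation L -> Gamma L} :=
  HB.pack (aform w D)
    (GRing.isLinear.Build (cinf M) (derivation L) (Gamma L) *:%R
      (aform w D) (aform_linearr w D)).

Lemma aform_linE w D E : aform_lin w D E = w D E. Proof. by []. Qed.

Definition der_eval_fun s (D : derivation L) : Gamma L := D s.
Lemma der_eval_linear s : linear (der_eval_fun s). Proof. by []. Qed.
Definition der_eval s : {linear derivation L -> Gamma L} :=
  HB.pack (der_eval_fun s)
    (GRing.isLinear.Build (cinf M) (derivation L) (Gamma L) *:%R
      (der_eval_fun s) (der_eval_linear s)).

Lemma aformDl w D D' E : w (D + D') E = w D E + w D' E.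
Proof. by have := aform_linearl w E 1 D D'; rewrite !scale1r. Qed.
Lemma aformZr w D f E : w D (f *: E) = f *: w D E.
Proof. by rewrite -!aform_linE linearZ_LR. Qed.
Lemma aformDr w D E E' : w D (E + E') = w D E + w D E'.
Proof. by rewrite -!aform_linE linearD. Qed.

Lemma aform_sumZl w n (f : 'I_n -> cinf M) (B : 'I_n -> derivation L) E x :
  w (\sum_i f i *: B i) E x = \sum_i f i x *: w (B i) E x.
Proof.
pose l : {linear derivation L -> Gamma L} := HB.pack (aform w ^~ E)
  (GRing.isLinear.Build (cinf M) (derivation L) (Gamma L) *:%R _ (aform_linearl w E)).
rewrite -[w _ _]/(l _) linear_sum sec_sumE; apply: eq_bigr => i _.
by rewrite linearZ_LR.
Qed.

Lemma aform_antisym w D E : w D E = - w E D.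
Proof.
have := aform_alt w (D + E); rewrite aformDl !aformDr !aform_alt add0r addr0.
by move=> /eqP; rewrite addr_eq0 => /eqP.
Qed.

Lemma aform_tensorialr w D E E' x :
  (forall s, E s x = E' s x) -> w D E x = w D E' x.
Proof. exact: (linear_tensorial (aform_lin w D)). Qed.

Lemma aform_tensoriall w D D' E x :
  (forall s, D s x = D' s x) -> w D E x = w D' E x.
Proof.
move=> DD'; rewrite (aform_antisym w D) (aform_antisym w D') !secNE.
by rewrite (aform_tensorialr w E DD').
Qed.

Definition pointwise_nondegenerate w : Prop :=
  forall x D, (forall E, w D E x = 0) -> forall s, D s x = 0.

(** The evaluations D |-> D s are C^oo-linear and separate the points of the fibre,
    so it suffices to represent them by w. *)
Lemma nondegenerate_pointwise w :
  atiyah_nondegenerate w -> pointwise_nondegenerate w.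
Proof.
move=> nw x D Dx s; have [D' [/(_ D) D'P _]] := nw (der_eval s).
by rewrite -[LHS]/(der_eval s D x) -D'P aform_antisym secNE Dx oppr0.
Qed.

(** By tensoriality only the value of D at y matters, which is the value of a
    combination of the B i with constant coefficients. *)
Lemma linear_ext_frame (alpha beta : {linear derivation L -> Gamma L}) n
    (B : 'I_n -> derivation L) (y : M) D (c : 'I_n -> R) :
  (forall s, D s y = \sum_i c i *: B i s y) ->
  (forall i, alpha (B i) y = beta (B i) y) -> alpha D y = beta D y.
Proof.
move=> Dc ab; pose D' := \sum_i cinf_cst (c i) *: B i.
have DD' s : D s y = D' s y.
  rewrite Dc der_sumE; apply: eq_bigr => i _.
  by rewrite derZE cinfZE cinf1E mulr1.
rewrite (linear_tensorial alpha DD') (linear_tensorial beta DD').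
rewrite !linear_sum !sec_sumE.
by apply: eq_bigr => i _; rewrite !linearZ_LR !secZE ab.
Qed.

(** In a local frame B of the gauge algebroid and a generator e of L, finding D
    with w (D, -) = alpha is a linear system with matrix W, which is invertible at
    x by pointwise non-degeneracy and hence near x. *)
Lemma pointwise_nondegenerate_local w (alpha : {linear derivation L -> Gamma L})
    (x : M) :
  pointwise_nondegenerate w ->
  exists D, \forall y \near x, forall E, w D E y = alpha E y.
Proof.
move=> nw; have [e [rho [k gP]]] := gauge_exists L x.
have [xi [Ei fP]] := coordinate_frame_exists x.
have sp := local_frame_span gP fP; have fr := local_frame_free gP fP.
set B := local_frame gP Ei in sp fr.
pose W := \matrix_(i, j) k (w (B i) (B j)).
have ke := gauge_e gP.
have dW : \det (map_mx (cinf_ev x) W) != 0.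
  apply/negP => /det0P[a a0 aW].
  pose D := \sum_i cinf_cst (a ord0 i) *: B i.
  have DE s : D s x = \sum_i a ord0 i *: B i s x.
    rewrite der_sumE; apply: eq_bigr => i _.
    by rewrite derZE cinfZE cinf1E mulr1.
  have wD E : w D E x = 0.
    have [c cP] := nbhs_singleton sp E.
    apply: (linear_ext_frame (beta := \0) (alpha := aform_lin w D) cP) => j.
    have /rowP/(_ j) := aW; rewrite !mxE aform_linE aform_sumZl => aWj.
    transitivity ((0 : R) *: e x); last by rewrite scale0r.
    rewrite -aWj scaler_suml; apply: eq_bigr => i _.
    rewrite !mxE cinfZE cinf1E mulr1 -scalerA.
    by rewrite -[cinf_ev _ _ *: _]/(k _ x *: e x) (nbhs_singleton ke).
  case/negP: a0; apply/eqP/rowP => i; rewrite mxE.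
  by apply: (nbhs_singleton fr (fun i => a ord0 i)) => s; rewrite -DE; exact: nw.
have [V VP] := near_invertible dW.
pose a := \row_j k (alpha (B j)).
exists (\sum_i (a *m V) ord0 i *: B i).
near=> y => E.
have [c cP] : exists c : 'I_(mdim M).+1 -> R,
    forall s, E s y = \sum_i c i *: B i s y.
  by move: E; near: y.
apply: (linear_ext_frame (alpha := aform_lin w _) cP) => j.
have key : forall s, k s y *: e y = s y by near: y.
have VWy : map_mx (cinf_ev y) (V *m W) = 1%:M by near: y.
rewrite aform_linE aform_sumZl -[RHS]key.
have -> : k (alpha (B j)) y = \sum_i (a *m V) ord0 i y * W i j y.
  have /matrixP/(_ ord0 j) :
      map_mx (cinf_ev y) (a *m V *m W) = map_mx (cinf_ev y) a.
    by rewrite -mulmxA map_mxM VWy mulmx1.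
  move=> aE; transitivity (map_mx (cinf_ev y) a ord0 j); first by rewrite !mxE.
  by rewrite -aE map_mxM mxE; apply: eq_bigr => i _; rewrite !mxE.
rewrite scaler_suml; apply: eq_bigr => i _.
by rewrite [W i j]mxE -scalerA key.
Unshelve. all: by end_near. Qed.

Lemma pointwise_unique w D D' x : pointwise_nondegenerate w ->
  (forall E, w D E x = w D' E x) -> forall s, D s x = D' s x.
Proof.
move=> nw DD' s; apply/eqP; rewrite -subr_eq0 -derNE -derDE; apply/eqP.
apply: nw => E; rewrite aformDl secDE DD' -secDE -aformDl subrr.
by rewrite aform_antisym -aform_linE linear0 oppr0.
Qed.

(** The local solutions agree where they are all defined, by [pointwise_unique],
    so they glue to a derivation. *)
Lemma pointwise_nondegenerateP w :
  pointwise_nondegenerate w -> atiyah_nondegenerate w.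
Proof.
move=> nw alpha.
have /choice[D DP] := fun x => pointwise_nondegenerate_local alpha x nw.
(* The glued operator takes at y the value of the solution chosen for y. *)
have DE x : \forall y \near x, forall s, D y s y = D x s y.
  apply: filterS (DP x) => y Dxy s; apply: (pointwise_unique nw) => E.
  by rewrite (nbhs_singleton (DP y)) Dxy.
have sD s : smooth_section (fun x => D x s x).
  by apply: smooth_section_near => x; exists (D x s); apply: filterS (DE x) => y.
pose D0 (s : Gamma L) : Gamma L := Section_ (sD s).
have sX : smooth_vf_on setT (fun x => symbol (D x) x).
  move=> f; apply: msmooth_local => x _.
  have := DE x; rewrite /prop_near1 nbhsE => -[U [oU Ux] UP].
  exists U => //; apply: (msmooth_ext (f := vf_app (symbol (D x)) f)) => //.
    move=> y Uy /=; suff -> : symbol (D y) y = symbol (D x) y by [].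
    by apply: symbol_det => s; exact: UP.
  by apply: msmooth_sub (cinf_smooth _).
have D0P : real_linear D0 /\ exists X, is_symbol D0 X.
  split=> [a s t|].
    by apply: sec_eq => x; rewrite /= der_linear.
  exists (VField sX) => f s; apply: sec_eq => x.
  by rewrite [LHS]/= symbolE.
exists (Derivation D0P); split=> [E|D' D'P].
  apply: sec_eq => x; rewrite -(nbhs_singleton (DP x)).
  exact: aform_tensoriall.
apply: der_eq => s; apply: sec_eq => x.
rewrite -[LHS]/(D x s x); apply: (pointwise_unique nw) => E.
by rewrite (nbhs_singleton (DP x)) D'P.
Qed.

End AtiyahForms.

(** * L-valued 1-forms and contact structures *)

Section LForms.
Context {R : realType} {M : manifold R} {L : line_bundle M}.
Implicit Types (s t : Gamma L) (D E : derivation L) (w : atiyah2 L).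
Implicit Types (X Y Z : vfield M).

(** Reduces linear identities in a fibre to identities of real numbers. *)
Lemma fiber_coord (x : M) : exists phi : L x -> R, [/\ injective phi,
  {morph phi : u v / u + v}, {morph phi : u / - u} &
  forall a u, phi (a *: u) = a * phi u].
Proof.
have [t Tt tx] := triv_cover L x.
have /choice[phi phiP] : forall u : L x, exists a, u = a *: t.2 x.
  by move=> u; have [a [ua _]] := triv_basis Tt tx u; exists a.
exists phi; split=> [u v uv|u v|u|a u].
- by rewrite (phiP u) uv -phiP.
- by apply: (triv_inj Tt tx); rewrite scalerDl -!phiP.
- by apply: (triv_inj Tt tx); rewrite scaleNr -!phiP.
- by apply: (triv_inj Tt tx); rewrite -scalerA -!phiP.
Qed.

Record lform := LForm {
  lf :> forall x : M, tangent M x -> L x ;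
  lf_linear : forall x, linear (lf (x := x)) ;
  lf_smooth : forall X : vfield M, smooth_section (fun x => lf (X x))
}.

Implicit Types th : lform.

Lemma lfD th x (u v : tangent M x) : th x (u + v) = th x u + th x v.
Proof. by have := lf_linear th 1 u v; rewrite !scale1r. Qed.
Lemma lf0 th (x : M) : th x 0 = 0.
Proof. by apply: (addrI (th x 0)); rewrite -lfD !addr0. Qed.
Lemma lfZ th x a (u : tangent M x) : th x (a *: u) = a *: th x u.
Proof. by rewrite -[a *: u]addr0 lf_linear lf0 addr0. Qed.
Lemma lfN th x (u : tangent M x) : th x (- u) = - th x u.
Proof. by rewrite -(scaleN1r u) lfZ scaleN1r. Qed.
Lemma lfB th x (u v : tangent M x) : th x (u - v) = th x u - th x v.
Proof. by rewrite lfD lfN. Qed.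
Lemma lf_sum th x (I : finType) (u : I -> tangent M x) :
  th x (\sum_i u i) = \sum_i th x (u i).
Proof. by elim/big_rec2 : _ => [|i y1 y2 _ <-]; [exact: lf0|exact: lfD]. Qed.

Definition lf_app th X : Gamma L := Section_ (lf_smooth th X).
Definition lf_der th D : Gamma L := lf_app th (symbol D).

Lemma lf_derE th D x : lf_der th D x = th x (symbol D x). Proof. by []. Qed.
Lemma lf_derD th D E : lf_der th (D + E) = lf_der th D + lf_der th E.
Proof. by apply: sec_eq => x; rewrite secDE !lf_derE symbolD lfD. Qed.
Lemma lf_derZ th f D : lf_der th (f *: D) = f *: lf_der th D.
Proof. by apply: sec_eq => x; rewrite secZE !lf_derE symbolZ lfZ. Qed.

Lemma lf_der0 th : lf_der th 0 = 0.
Proof. by apply: sec_eq => x; rewrite lf_derE symbol0 lf0. Qed.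
Lemma lf_derN th D : lf_der th (- D) = - lf_der th D.
Proof. by apply/eqP; rewrite -addr_eq0 -lf_derD addNr lf_der0. Qed.

Lemma derDs D E s : (D + E) s = D s + E s. Proof. by []. Qed.
Lemma derZs f D s : (f *: D) s = f *: D s. Proof. by []. Qed.

Definition dlf_fun th D E : Gamma L :=
  D (lf_der th E) - E (lf_der th D) - lf_der th (der_bracket D E).

Lemma bracketE D E s : der_bracket D E s = D (E s) - E (D s). Proof. by []. Qed.

Lemma bracket_antisym D E : der_bracket E D = (-1) *: der_bracket D E.
Proof.
apply: der_eq => s; apply: sec_eq => x.
by rewrite derZE !bracketE !secDE !secNE scaleN1r opprB.
Qed.

Lemma dlf_antisym th D E : dlf_fun th E D = - dlf_fun th D E.
Proof.
rewrite /dlf_fun (bracket_antisym D E) lf_derZ scaleN1r opprK.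
by rewrite opprD opprB opprK.
Qed.

Lemma dlf_linearl th E : linear ((dlf_fun th)^~ E).
Proof.
move=> f D D'; rewrite /dlf_fun lf_derD lf_derZ derD.
have -> : der_bracket (f *: D + D') E =
    f *: der_bracket D E + ((- vf_app (symbol E) f) *: D + der_bracket D' E).
  apply: der_eq => s; apply: sec_eq => x.
  rewrite !derDE !derZE !bracketE !derDs !derZs derD !(secDE, secNE, secZE) symbolE.
  rewrite cinfNE vf_appE.
  have [phi [phiI phiD phiN phiZ]] := fiber_coord x; apply: phiI.
  by rewrite !(phiD, phiN, phiZ); ring.
rewrite !lf_derD !lf_derZ; apply: sec_eq => x.
rewrite !derDs !derZs !(secDE, secNE, secZE) symbolE cinfNE vf_appE.
have [phi [phiI phiD phiN phiZ]] := fiber_coord x; apply: phiI.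
by rewrite !(phiD, phiN, phiZ); ring.
Qed.

Lemma dlf_linearr th D : linear (dlf_fun th D).
Proof.
move=> f E E'; rewrite (dlf_antisym th (f *: E + E')) (dlf_antisym th E D).
by rewrite (dlf_antisym th E' D) dlf_linearl scalerN opprD.
Qed.

Lemma dlf_alt th D : dlf_fun th D D = 0.
Proof.
rewrite /dlf_fun subrr sub0r (_ : der_bracket D D = 0) ?lf_der0 ?oppr0//.
by apply: der_eq => s; rewrite bracketE subrr.
Qed.

Definition dlf th : atiyah2 L :=
  Atiyah2 (dlf_linearl th) (dlf_linearr th) (dlf_alt th).

Lemma dlfE th D E : dlf th D E =
  D (lf_der th E) - E (lf_der th D) - lf_der th (der_bracket D E).
Proof. by []. Qed.

Lemma dlf_closed th : atiyah_closed (dlf th).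
Proof.
move=> D1 D2 D3; rewrite /d_atiyah2 !dlfE !bracketE !derD !derN.
have J : der_bracket (der_bracket D1 D2) D3 =
    der_bracket (der_bracket D1 D3) D2 - der_bracket (der_bracket D2 D3) D1.
  apply: der_eq => s; apply: sec_eq => x.
  rewrite derDE derNE !bracketE !derD !derN !(secDE, secNE).
  have [phi [phiI phiD phiN phiZ]] := fiber_coord x; apply: phiI.
  by rewrite !(phiD, phiN, phiZ); ring.
rewrite J lf_derD lf_derN.
rewrite !opprD !opprK; apply: sec_eq => x; rewrite !(secDE, secNE) [RHS]/=.
have [phi [phiI phiD phiN phiZ]] := fiber_coord x; apply: phiI.
rewrite -[in RHS](scale0r 0) !(phiD, phiN, phiZ). ring.
Qed.

Lemma dlf1E th E x : dlf th (der_one L) E x = th x (symbol E x).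
Proof.
rewrite dlfE; have -> : der_bracket (der_one L) E = 0.
  by apply: der_eq => s; rewrite bracketE subrr.
rewrite !(secDE, secNE) lf_derE symbol0 lf0 subr0.
rewrite (_ : lf_der th (der_one L) = 0) ?der0 ?subr0//.
by apply: sec_eq => y; rewrite lf_derE symbol1 lf0.
Qed.

(** For fields tangent to ker th the differential of th is, up to sign, the
    curvature of ker th. *)
Lemma dlf_kernel th D E X Y (x : M) :
  (\forall y \near x, symbol D y = X y) -> (\forall y \near x, symbol E y = Y y) ->
  (forall y, th y (X y) = 0) -> (forall y, th y (Y y) = 0) ->
  dlf th D E x = - th x (vf_bracket X Y x).
Proof.
move=> DX EY thX thY; rewrite dlfE !(secDE, secNE).
have -> : D (lf_der th E) x = 0.
  transitivity (D 0 x); last by rewrite der0.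
  apply: der_local.
  by apply: filterS EY => y Ey; rewrite lf_derE Ey thY.
have -> : E (lf_der th D) x = 0.
  transitivity (E 0 x); last by rewrite der0.
  apply: der_local.
  by apply: filterS DX => y Dy; rewrite lf_derE Dy thX.
rewrite subr0 sub0r lf_derE symbol_bracket; congr (- th x _).
apply: tangent_eq => f /=; rewrite (nbhs_singleton DX) (nbhs_singleton EY).
congr (_ - _); apply: tangent_local.
  by apply: filterS EY => y Ey; rewrite /= Ey.
by apply: filterS DX => y Dy; rewrite /= Dy.
Qed.

Definition lf_ker th (x : M) : set (tangent M x) := [set v | th x v = 0].
Arguments lf_ker : clear implicits.
Definition nowhere_zero th := forall x, exists v, th x v != 0.

(** Extend v to any field X0 and correct it along a field transverse to ker th;
    the corrected field is tangent to ker th near x, and a bump function makes it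
    so everywhere. *)
Lemma ker_extend th x (v : tangent M x) : nowhere_zero th -> th x v = 0 ->
  exists2 X : vfield M, X x = v & forall y, th y (X y) = 0.
Proof.
move=> nz thv; have [X0 X0x] := vfield_extend v; have [z thz] := nz x.
have [Z Zx] := vfield_extend z; have [e [rho [k gP]]] := gauge_exists L x.
have ke := gauge_e gP.
have kZ : k (lf_app th Z) x != 0.
  apply: contra thz => /eqP kZ; rewrite -Zx -[th x _]/(lf_app th Z x).
  by rewrite -(nbhs_singleton ke) kZ scale0r.
have [h hP] := near_inverse kZ.
pose a := - (h * k (lf_app th X0)).
have X1 : \forall y \near x, th y (X0 y + a y *: Z y) = 0.
  apply: filterS2 ke hP => y key hy.
  rewrite lfD lfZ -[th y (X0 y)]/(lf_app th X0 y) -[th y (Z y)]/(lf_app th Z y).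
  rewrite -(key (lf_app th X0)) -(key (lf_app th Z)) scalerA -scalerDl.
  rewrite /a cinfNE cinfME mulNr mulrAC hy mul1r subrr.
  by rewrite scale0r.
have ax : a x = 0.
  rewrite /a cinfNE cinfME.
  have -> : k (lf_app th X0) x = 0.
    have [_ _ gx] := gP; have [_ ex] := nbhs_singleton gx.
    have := nbhs_singleton ke (lf_app th X0); rewrite [RHS]/= X0x thv => /eqP.
    by rewrite scaler_eq0 (negbTE ex) orbF => /eqP.
  by rewrite mulr0 oppr0.
have [c cx cP] := near_bump X1.
exists (vf_scale c (vf_add X0 (vf_scale a Z))) => [|y].
  by rewrite -[LHS]/(c x *: (X0 x + a x *: Z x)) cx scale1r X0x ax scale0r addr0.
rewrite lfZ; have [->|/cP ->] := eqVneq (c y) 0; first by rewrite scale0r.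
by rewrite scaler0.
Qed.

Lemma ker_subspace th x : is_subspace (lf_ker th x).
Proof.
split; first exact: lf0.
by move=> a u v thu thv; rewrite /lf_ker /= lf_linear thu thv scaler0 addr0.
Qed.

Lemma ker_complement th x (z v : tangent M x) : th x z != 0 ->
  exists a, th x (v - a *: z) = 0.
Proof.
move=> thz; have [a av] := fiber_dim1 (th x v) thz.
by exists a; rewrite lfB lfZ av subrr.
Qed.

Lemma ker_corank1 th x : nowhere_zero th -> corank1 (lf_ker th x).
Proof.
move=> nz; have [z thz] := nz x; exists z; first exact/eqP.
by move=> v; exact: ker_complement.
Qed.

(** If th (E_i0) does not vanish at x, the fields E_j - (th E_j / th E_i0) E_i0
    for j <> i0 form a frame of ker th; [lift i0] enumerates these j. *)
Lemma ker_frames th : nowhere_zero th -> has_local_frames (mdim M).-1 (lf_ker th).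
Proof.
move=> nz x; have [xi [E fP]] := coordinate_frame_exists x.
have [e [rho [k gP]]] := gauge_exists L x; have ke := gauge_e gP.
have [i0 thi0] : exists i0, th x (E i0 x) != 0.
  apply: contrapT => /forallNP E0; have [z /negP[]] := nz x.
  have [_ fx] := nbhs_singleton fP; rewrite (fx z) lf_sum big1// => j _.
  by rewrite lfZ; have /negP := E0 j; rewrite negbK => /eqP ->; rewrite scaler0.
pose b j := k (lf_app th (E j)).
have b0 : b i0 x != 0.
  apply: contra thi0 => /eqP bx; rewrite -[th x _]/(lf_app th (E i0) x).
  by rewrite -(nbhs_singleton ke) -/(b i0) bx scale0r.
have [h hP] := near_inverse b0.
pose F (i : 'I_(mdim M).-1) :=
  vf_add (E (lift i0 i)) (vf_scale (- (h * b (lift i0 i))) (E i0)).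
have FE i y : F i y = E (lift i0 i) y - (h y * b (lift i0 i) y) *: E i0 y.
  by rewrite -scaleNr.
have [_ _ gx] := gP.
have H : \forall y \near x, [/\ forall s, k s y *: e y = s y, h y * b i0 y = 1,
    e y != 0 & ((forall i j, E j y (xi i) = (i == j)%:R) /\
    forall v : tangent M y, v = \sum_j v (xi j) *: E j y)].
  near=> y; split; [by near: y|by near: y| |by near: y].
  by have [] : rho y = 1 /\ e y != 0 by near: y.
move: H; rewrite /prop_near1 nbhsE => -[U [oU Ux] UP].
exists U; split=> //; exists (fun i => F i); split=> [i f|y Uy].
  by apply: msmooth_sub (vf_smooth (F i) f).
have [key hy ey [Exi fy]] := UP y Uy.
have thE j : th y (E j y) = b j y *: e y by rewrite key.
have bi0 : b i0 y != 0.
  by apply/eqP => by0; move/eqP: hy; rewrite by0 mulr0 eq_sym oner_eq0.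
have thF i : th y (F i y) = 0.
  by rewrite FE lfB lfZ !thE scalerA -scalerBl mulrAC hy mul1r subrr scale0r.
split=> // w thw.
have Fxi i l : F i y (xi (lift i0 l)) = (l == i)%:R.
  rewrite FE taddE toppE tscaleE !Exi (inj_eq (@lift_inj _ i0)).
  by rewrite (eq_sym (lift i0 l) i0) (negbTE (neq_lift _ _)) mulr0 subr0.
exists (\row_i w (xi (lift i0 i))); split.
  under eq_bigr do rewrite mxE.
  set w' := \sum_i _.
  have [c wE] : exists c, w - w' = c *: E i0 y.
    rewrite {1}(fy w) (bigD1_ord i0)//=.
    exists (w (xi i0) + \sum_i w (xi (lift i0 i)) * (h y * b (lift i0 i) y)).
    rewrite /w' scalerDl -addrA; congr (_ + _).
    rewrite -sumrB scaler_suml; apply: eq_bigr => i _.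
    by rewrite FE scalerBr opprB addrC subrK scalerA.
  apply/eqP; rewrite -subr_eq0 wE; apply/eqP.
  have : th y (w - w') = 0.
    by rewrite lfB thw /w' lf_sum big1 ?subr0// => i _; rewrite lfZ thF scaler0.
  rewrite wE lfZ thE scalerA => /eqP; rewrite scaler_eq0 (negbTE ey) orbF mulf_eq0.
  by rewrite (negbTE bi0) orbF => /eqP ->; rewrite scale0r.
move=> a wa; apply/rowP => l; rewrite mxE wa tsumE (bigD1 l)// big1 => [|i].
  by rewrite [LHS]addr0 tscaleE Fxi eqxx mulr1.
by rewrite andTb => il; rewrite tscaleE Fxi eq_sym (negbTE il) mulr0.
Unshelve. all: by end_near. Qed.

Lemma ker_hyperplane th : nowhere_zero th -> hyperplane_distribution (lf_ker th).
Proof.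
move=> nz; split; first exact: ker_subspace.
  by move=> x; exact: ker_corank1.
exact: ker_frames.
Qed.

Lemma der_scalarE D D' a x : (forall s, (D - D') s x = a *: s x) ->
  forall s, D s x = (D' + cinf_cst a *: der_one L) s x.
Proof.
move=> H s; have := H s; rewrite !derDE derNE derZE cinfZE cinf1E mulr1.
by move=> <-; rewrite addrC subrK.
Qed.

Lemma symbol_eq_scalar D D' x : symbol D x = symbol D' x ->
  exists a, forall s, D s x = (D' + cinf_cst a *: der_one L) s x.
Proof.
move=> DD'; have [|a aP] := @symbol0_scalar _ _ _ (D - D') x.
  by rewrite symbolD -scaleN1r symbolZ [(-1 : cinf M) x]/= scaleN1r DD' subrr.
by exists a; exact: der_scalarE.
Qed.

Lemma cinf_cstE a (x : M) : cinf_cst a x = a.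
Proof. by rewrite cinfZE cinf1E mulr1. Qed.

Lemma aform_combination w D E (E' : derivation L) a b x :
  w D (E + cinf_cst b *: E' + cinf_cst a *: der_one L) x =
  w D E x + b *: w D E' x + a *: w D (der_one L) x.
Proof. by rewrite !aformDr !aformZr !secDE !secZE !cinf_cstE. Qed.

Lemma dlf_addl1 th D E a x :
  dlf th (D + cinf_cst a *: der_one L) E x = dlf th D E x + a *: th x (symbol E x).
Proof.
rewrite aformDl secDE (aform_antisym _ (_ *: _)) aformZr secNE secZE cinf_cstE.
by rewrite -scalerN -secNE -aform_antisym dlf1E.
Qed.

Lemma dlf1r th D x : dlf th D (der_one L) x = - th x (symbol D x).
Proof. by rewrite aform_antisym secNE dlf1E. Qed.

(** Let w = d(th o symbol) and let D be in its kernel at x.  Pairing with 1 shows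
    that the symbol v of D is in ker th; pairing with lifts of fields tangent to
    ker th shows that v is in the kernel of the curvature, so v = 0 and D is a
    multiple of 1 at x.  Pairing with a transverse field kills the multiple. *)
Lemma contact_pointwise_nondegenerate th : nowhere_zero th ->
  curvature_nondegenerate (lf_ker th) -> pointwise_nondegenerate (dlf th).
Proof.
move=> nz cn x D Dx; set v := symbol D x.
have thv : th x v = 0 by apply/eqP; rewrite -oppr_eq0 -dlf1r Dx.
have br X Y : (forall y, th y (X y) = 0) -> (forall y, th y (Y y) = 0) -> X x = v ->
    th x (vf_bracket X Y x) = 0.
  move=> thX thY Xx; have [D' D'P] := symbol_lift_near L x X.
  have [E EP] := symbol_lift_near L x Y.
  have [a aP] := @symbol_eq_scalar D D' x
    (etrans (esym Xx) (esym (nbhs_singleton D'P))).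
  have := Dx E; rewrite (aform_tensoriall _ _ aP) dlf_addl1.
  rewrite (nbhs_singleton EP) thY scaler0 addr0 (dlf_kernel D'P EP thX thY).
  by move=> /eqP; rewrite oppr_eq0 => /eqP.
have v0 : v = 0.
  apply: cn => // w thw; apply/seteqP; split=> [u [X [Y [tX tY Xx Yx]]]|u thu].
    rewrite /lf_ker /= lfB => /eqP; rewrite subr_eq0 => /eqP ->.
    exact: br.
  have [X Xx tX] := ker_extend nz thv; have [Y Yx tY] := ker_extend nz thw.
  by exists X, Y; split=> //; rewrite /lf_ker /= lfB thu br// subr0.
have [a aP] := symbol0_scalar v0.
have [z thz] := nz x; have [E Ez] := symbol_lift L z.
have := Dx E; have DE s : D s x = (0 + cinf_cst a *: der_one L) s x.
  by rewrite derDE derZE cinf_cstE aP add0r.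
rewrite (aform_tensoriall _ _ DE) dlf_addl1 Ez.
rewrite aform_antisym -aform_linE linear0 secNE oppr0 add0r => /eqP.
rewrite scaler_eq0 (negbTE thz) orbF => /eqP a0 s.
by rewrite aP a0 scale0r.
Qed.

(** Conversely let v be in the kernel of the curvature and D a lift of a field
    through v.  Then D pairs to 0 with 1 and with lifts of fields tangent to
    ker th, and D1 = D - c 1 with a suitable c also with a transverse Z.  These
    span the fibre, so D1 vanishes at x and so does its symbol v. *)
Lemma pointwise_nondegenerate_contact th : nowhere_zero th ->
  pointwise_nondegenerate (dlf th) -> curvature_nondegenerate (lf_ker th).
Proof.
move=> nz nw x v thv curv; have [X Xx tX] := ker_extend nz thv.
have [D DP] := symbol_lift_near L x X.
have [z thz] := nz x; have [Z Zz] := symbol_lift L z.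
have [c cP] := fiber_dim1 (dlf th D Z x) thz.
pose D1 := D + cinf_cst (- c) *: der_one L.
have sD1 : symbol D1 x = v.
  by rewrite symbolD symbolZ symbol1 scaler0 addr0 (nbhs_singleton DP).
have D1x E : dlf th D1 E x = 0.
  have [b bP] := ker_complement (symbol E x) thz.
  have [Y Yx tY] := ker_extend nz bP.
  have [E' E'P] := symbol_lift_near L x Y.
  have [a aP] : exists a, forall s,
      E s x = (E' + cinf_cst b *: Z + cinf_cst a *: der_one L) s x.
    apply: symbol_eq_scalar; rewrite symbolD symbolZ cinf_cstE Zz (nbhs_singleton E'P).
    by rewrite Yx subrK.
  rewrite (aform_tensorialr _ _ aP) aform_combination.
  rewrite dlf1r sD1 thv oppr0 scaler0 addr0 !dlf_addl1 Zz cP.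
  rewrite -scalerDl subrr scale0r.
  rewrite scaler0 addr0 (nbhs_singleton E'P) tY scaler0 addr0.
  rewrite (dlf_kernel DP E'P tX tY).
  suff : lf_ker th x (vf_bracket X Y x) by rewrite /lf_ker /= => ->; rewrite oppr0.
  have thY : lf_ker th x (Y x) by exact: tY.
  rewrite -(curv _ thY); exists X, Y; split=> //.
  by rewrite subrr; exact: lf0.
rewrite -sD1 -(symbol0 L x); apply: symbol_det => s.
exact: nw.
Qed.

Lemma contact_symplecticP th : nowhere_zero th ->
  contact_structure (lf_ker th) <-> symplectic_atiyah (dlf th).
Proof.
move=> nz; split=> [[_ cn]|[_ nd]]; split.
- exact: dlf_closed.
- exact/pointwise_nondegenerateP/contact_pointwise_nondegenerate.
- exact: ker_hyperplane.
- exact/pointwise_nondegenerate_contact/nondegenerate_pointwise.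
Qed.

Section Contraction.
Variable w : atiyah2 L.

(** w (1, -) as a form on M: the value does not depend on the lift of v, since two
    lifts differ by a multiple of 1 at x and w (1, 1) = 0. *)
Definition contr_fun (x : M) (v : tangent M x) : L x :=
  w (der_one L) (projT1 (cid (symbol_lift L v))) x.

Lemma contr_funE D x : contr_fun (symbol D x) = w (der_one L) D x.
Proof.
rewrite /contr_fun; case: cid => E /= EP.
have [a aP] := symbol_eq_scalar EP.
rewrite (aform_tensorialr _ _ aP) aformDr aformZr aform_alt scaler0.
by rewrite addr0.
Qed.

Lemma contr_linear x : linear (@contr_fun x).
Proof.
move=> a u v; have [D <-] := symbol_lift L u; have [E <-] := symbol_lift L v.
have -> : a *: symbol D x + symbol E x = symbol (cinf_cst a *: D + E) x.
  by rewrite symbolD symbolZ cinf_cstE.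
by rewrite !contr_funE aformDr aformZr secDE secZE cinf_cstE.
Qed.

Lemma contr_smooth X : smooth_section (fun x => contr_fun (X x)).
Proof.
apply: smooth_section_near => x; have [D DP] := symbol_lift_near L x X.
by exists (w (der_one L) D); apply: filterS DP => y <-; rewrite contr_funE.
Qed.

Definition contr : lform := LForm contr_linear contr_smooth.

Lemma contrE D x : contr x (symbol D x) = w (der_one L) D x.
Proof. exact: contr_funE. Qed.

Lemma lf_der_contr D : lf_der contr D = w (der_one L) D.
Proof. by apply: sec_eq => x; rewrite lf_derE contrE. Qed.

(** Cartan's formula for the contraction with 1, whose Lie derivative is the
    identity of L-valued forms. *)
Lemma closed_dcontr : atiyah_closed w -> forall D E, w D E = dlf contr D E.
Proof.
move=> cw D E; have := cw (der_one L) D E; rewrite /d_atiyah2 dlfE !lf_der_contr.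
have b1 D' : der_bracket (der_one L) D' = 0.
  by apply: der_eq => s; rewrite bracketE subrr.
have w0 D' : w 0 D' = 0 by rewrite aform_antisym -aform_linE linear0 oppr0.
rewrite !b1 !w0 subr0 addr0 (aform_antisym _ (der_bracket D E)) opprK.
rewrite -[der_one L (w D E)]/(w D E) => /eqP; rewrite -addrA -addrA addr_eq0 => /eqP ->.
by rewrite !opprD !opprK addrA.
Qed.

Lemma contr_nowhere_zero : pointwise_nondegenerate w -> nowhere_zero contr.
Proof.
move=> nw x; apply: contrapT => /forallNP H.
have [e /negP[]] := nonzero_section L x; apply/eqP.
apply: (nw x (der_one L)) => E; rewrite -contrE.
by have /negP := H (symbol E x); rewrite negbK => /eqP.
Qed.

End Contraction.

Lemma contr_dlf th x v : contr (dlf th) x v = th x v.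
Proof. by have [D <-] := symbol_lift L v; rewrite contrE dlf1E. Qed.

End LForms.
Arguments lf_ker {R M L} th x _.

(** * Hyperplane distributions are kernels of 1-forms *)

Lemma hyperplane_functional (R : realType) (V : lmodType R) (S : set V) :
  is_subspace S -> corank1 S ->
  exists2 l : V -> R, (forall a u v, l (a *: u + v) = a * l u + l v) &
    forall v, l v = 0 <-> S v.
Proof.
move=> [S0 Sl] [u nSu /choice[l lP]].
have uniq v a : S (v - a *: u) -> l v = a.
  move=> Sva; apply: contrapT => /eqP; rewrite -subr_eq0 => la; apply: nSu.
  have E : (l v - a)^-1 *: ((-1) *: (v - l v *: u) + (v - a *: u)) + 0 = u.
    by rewrite addr0 scaleN1r opprB addrA subrK -scalerBl scalerA mulVf ?scale1r.
  by rewrite -E; apply: (Sl) => //; apply: (Sl).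
exists l => [a v w|v].
  apply: uniq; rewrite scalerDl -scalerA opprD addrACA -scalerBr.
  by apply: Sl; exact: lP.
split=> [lv|Sv]; first by have := lP v; rewrite lv scale0r subr0.
by apply: uniq; rewrite scale0r subr0.
Qed.

Section NormalBundle.
Context {R : realType} {M : manifold R}.
Variable H : forall x : M, set (tangent M x).

Lemma subspace_sum (V : lmodType R) (S : set V) (I : finType) (a : I -> R)
    (u : I -> V) :
  is_subspace S -> (forall i, S (u i)) -> S (\sum_i a i *: u i).
Proof.
move=> [S0 Sl] Su; elim/big_rec : _ => // i v _ Sv.
exact: Sl.
Qed.

(** G is a frame of H and Z extends a vector transverse to H at x.  The matrix A of
    the coordinates of Z and G is invertible at x, hence near x, and the
    components of a field X with respect to Z and G are smooth: a is the
    component along Z.  The dimension is a variable n = k + 1 here, since the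
    number of fields in a frame of H is stated as the predecessor of dim M. *)
Lemma transversal_field_frame n k (x : M)
    (xi : 'I_n -> cinf M) (E : 'I_n -> vfield M)
    (G : 'I_k -> vfield M) :
  (forall y, is_subspace (@H y)) -> (forall y, corank1 (@H y)) -> n = k.+1 ->
  coordinate_frame x xi E ->
  (\forall y \near x, forall i, H (G i y)) ->
  (forall a : 'I_k -> R, \sum_i a i *: G i x = 0 -> forall i, a i = 0) ->
  exists Z : vfield M, \forall y \near x, ~ H (Z y) /\
    forall X : vfield M, exists a : cinf M, \forall z \near y, H (X z - a z *: Z z).
Proof.
move=> subH corH nk; subst n => fP GH Gfree.
have [u nHu _] := corH x; have [Z Zx] := vfield_extend u.
pose G' (i : 'I_k.+1) := if unlift ord0 i is Some j then G j else Z.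
have G'0 : G' ord0 = Z by rewrite /G' unlift_none.
have G'S j : G' (lift ord0 j) = G j by rewrite /G' liftK.
pose A := \matrix_(i, j) vf_app (G' i) (xi j).
have AE (c : 'I_k.+1 -> R) (y : M) j :
    \sum_i c i * cinf_ev y (A i j) = (\sum_i c i *: G' i y) (xi j).
  by rewrite tsumE; apply: eq_bigr => i _; rewrite mxE.
have coords (y : M) (v w : tangent M y) :
    (forall v : tangent M y, v = \sum_j v (xi j) *: E j y) ->
    (forall j, v (xi j) = w (xi j)) -> v = w.
  by move=> fy vw; rewrite (fy v) (fy w); apply: eq_bigr => j _; rewrite vw.
have dA : \det (map_mx (cinf_ev x) A) != 0.
  apply/negP => /det0P[a a0 aA].
  have S0 : \sum_i a ord0 i *: G' i x = 0.
    have [_ fx] := nbhs_singleton fP; apply: (coords _ _ _ fx) => j.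
    have : (a *m map_mx (cinf_ev x) A) ord0 j = 0 by rewrite aA mxE.
    rewrite mxE -AE => aAj; apply: (etrans _ aAj).
    by apply: eq_bigr => i _; rewrite [map_mx _ _ _ _]mxE.
  move: S0; rewrite big_ord_recl G'0 Zx; set S := \sum_(i < k) _ => aS0.
  have HS : H S.
    by apply: subspace_sum => // i; rewrite G'S; exact: (nbhs_singleton GH).
  have a00 : a ord0 ord0 = 0.
    apply: contrapT => /eqP a00; apply: nHu.
    have [H0 Hl] := subH x.
    have <- : - (a ord0 ord0)^-1 *: S + 0 = u.
      have -> : S = - (a ord0 ord0 *: u) by apply/eqP; rewrite -addr_eq0 addrC aS0.
      by rewrite addr0 scalerN scaleNr opprK scalerA mulVf ?scale1r.
    exact: Hl.
  move: aS0; rewrite /S.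
  rewrite a00 scale0r add0r; under eq_bigr do rewrite G'S.
  move=> /Gfree aS; case/negP: a0; apply/eqP/rowP => i; rewrite mxE.
  by have [j ->|->] := unliftP ord0 i.
have [B BP] := near_invertible dA.
pose c X := \row_j vf_app X (xi j) *m B.
exists Z.
have span : \forall y \near x, forall X : vfield M,
    X y = \sum_i c X ord0 i y *: G' i y.
  apply: filterS2 fP BP => y [_ fy] BA X; apply: coords => // j.
  rewrite -AE; apply/esym; transitivity (map_mx (cinf_ev y) (c X *m A) ord0 j).
    rewrite [RHS]mxE [(c X *m A) _ _]mxE rmorph_sum; apply: eq_bigr => i _.
    by rewrite rmorphM.
  by rewrite /c -mulmxA map_mxM BA mulmx1 mxE mxE.
have /near_join span' := span; have /near_join GH' := GH.
apply: filterS2 span' GH' => y sy Gy; split=> [HZ|X]; last first.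
  exists (c X ord0 ord0); apply: filterS2 sy Gy => z sz Gz.
  rewrite (sz X) big_ord_recl G'0 addrC addKr.
  by apply: subspace_sum => // i; rewrite G'S.
have [v nHv _] := corH y; apply: nHv; have [X <-] := vfield_extend v.
rewrite (nbhs_singleton sy); apply: subspace_sum => // i.
have [j ->|->] := unliftP ord0 i; first by rewrite G'S; exact: (nbhs_singleton Gy).
by rewrite G'0.
Qed.

Lemma transversal_field (x : M) : hyperplane_distribution H ->
  exists Z : vfield M, \forall y \near x, ~ H (Z y) /\
    forall X : vfield M, exists a : cinf M, \forall z \near y, H (X z - a z *: Z z).
Proof.
move=> [subH corH frH]; have [xi [E fP]] := coordinate_frame_exists x.
have [u nHu _] := corH x.
have dimM : mdim M = (mdim M).-1.+1.
  rewrite prednK// lt0n; apply/eqP => d0; apply: nHu.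
  have [_ fx] := nbhs_singleton fP; rewrite (fx u) big1; first by have [] := subH x.
  by move=> i; have := ltn_ord i; rewrite {2}d0.
have [U [oU Ux [F [sF FP]]]] := frH x.
have [rho srho r1] := bump_function oU Ux.
pose G i : vfield M := VField (fun f => supported_msmooth oU srho (sF i f) :
  msmooth setT (fun y => (rho y *: F i y) f)).
apply: (transversal_field_frame (G := G) subH corH dimM fP).
  have Un : \forall y \near x, U y by exact: open_nbhs_nbhs.
  apply: filterS2 Un r1 => y Uy ry i.
  by rewrite -[G i y]/(rho y *: F i y) ry scale1r; exact: (FP y Uy).1.
move=> a; under eq_bigr => i _ do
  rewrite -[G i x]/(rho x *: F i x) (nbhs_singleton r1) scale1r.
move=> aF i; have [_ /(_ 0)] := FP x Ux.
have [H0 _] := subH x => /(_ H0)[b [_ ub]].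
have /(congr1 (fun v : 'rV_ _ => v ord0 i)) : \row_i a i = 0.
  rewrite -(ub (\row_i a i)); last by under eq_bigr do rewrite mxE.
  apply: ub; rewrite big1// => j _.
  by rewrite mxE scale0r.
by rewrite !mxE.
Qed.

Hypothesis hypH : hyperplane_distribution H.

Let lam_exists x := cid2 (hyperplane_functional
  (let: And3 subH _ _ := hypH in subH x) (let: And3 _ corH _ := hypH in corH x)).

(** The normal line T_x M / H_x is identified with R by a functional with kernel
    H_x, chosen independently for each x; smoothness lies in the
    trivializations, whose generators are the classes of transverse fields. *)
Definition conormal (x : M) : tangent M x -> R := s2val (lam_exists x).
Lemma conormal_linear x a u v :
  @conormal x (a *: u + v) = a * conormal u + conormal v.
Proof. exact: (s2valP (lam_exists x)). Qed.
Lemma conormalP x v : @conormal x v = 0 <-> H v.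
Proof. exact: (s2valP' (lam_exists x)). Qed.

Definition normal_triv : set (set M * (M -> R^o)) :=
  [set t | [/\ open t.1, forall y, t.1 y -> t.2 y != 0 &
    forall X : vfield M, msmooth t.1 (fun y => conormal (X y) / t.2 y)]].

Lemma normal_triv_open t : normal_triv t -> open t.1.
Proof. by case. Qed.

Lemma normal_triv_basis t : normal_triv t -> forall x, t.1 x ->
  forall v : R^o, exists! a : R, v = a *: t.2 x.
Proof.
move=> [_ t0 _] x tx v; exists (v / t.2 x); split=> [|a ->].
  by rewrite /GRing.scale /= divfK// t0.
by rewrite /GRing.scale /= mulfK// t0.
Qed.

Lemma normal_triv_field (x : M) : exists U Z, [/\ U x,
  normal_triv (U, fun y => conormal (vf Z y)) & forall y, U y -> conormal (Z y) != 0].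
Proof.
have [Z ZP] := transversal_field x hypH.
move: ZP; rewrite /prop_near1 nbhsE => -[U [oU Ux] UP].
have Z0 y : U y -> conormal (Z y) != 0.
  by move=> Uy; apply/eqP => /conormalP; exact: (UP y Uy).1.
exists U, Z; split=> //; split=> // X; apply: msmooth_local => y Uy /=.
(* X - a Z is tangent to H near y, so a is the coordinate of X there. *)
have [a] := (UP y Uy).2 X; rewrite /prop_near1 nbhsE => -[V [oV Vy] VP].
exists (U `&` V) => //; apply: (msmooth_ext (f := a)); first exact: openI.
  move=> z [Uz Vz]; have /conormalP := VP z Vz.
  rewrite addrC -scaleNr conormal_linear mulNr => /eqP.
  by rewrite addrC subr_eq0 => /eqP ->; rewrite mulfK// Z0.
exact: msmooth_sub (cinf_smooth a).
Qed.

Lemma normal_triv_cover x : exists2 t, normal_triv t & t.1 x.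
Proof.
have [U [Z [Ux UZ _]]] := normal_triv_field x.
by exists (U, fun y => conormal (vf Z y)).
Qed.

Lemma normal_triv_compat s t : normal_triv s -> normal_triv t ->
  exists2 g : M -> R, msmooth (s.1 `&` t.1) g &
    forall x, s.1 x -> t.1 x -> t.2 x = g x *: s.2 x.
Proof.
move=> [os s0 ss] [ot t0 st]; exists (fun y => t.2 y / s.2 y); last first.
  by move=> x sx tx; rewrite /GRing.scale /= divfK// s0.
apply: msmooth_local => x [sx tx].
have [U [Z [Ux [oU _ _] Z0]]] := normal_triv_field x.
have oW : open (U `&` (s.1 `&` t.1)) by do 2 apply: openI => //.
exists (U `&` (s.1 `&` t.1)) => //.
apply: (msmooth_ext (f := fun y =>
  (conormal (Z y) / s.2 y) * (conormal (Z y) / t.2 y)^-1)) => //.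
  move=> y [Uy [sy ty]]; rewrite invf_div mulrC mulrA divfK//.
  exact: Z0.
apply: msmoothM => //; first by apply: msmooth_sub (ss Z) => y [_ []].
apply: msmoothV => //; last by apply: msmooth_sub (st Z) => y [_ []].
by move=> y [Uy [sy ty]]; rewrite mulf_neq0 ?invr_eq0 ?Z0 ?t0.
Qed.

Definition normal_bundle : line_bundle M :=
  @LineBundle R M (fun=> R^o) normal_triv normal_triv_open normal_triv_basis
    normal_triv_cover normal_triv_compat.

Definition normal_form : lform (L := normal_bundle).
Proof.
apply: (@LForm R M normal_bundle conormal) => [x a u v|X t [_ t0 st]].
  exact: conormal_linear.
exists (fun y => conormal (X y) / t.2 y) => // y ty.
by rewrite /GRing.scale /= divfK// t0.
Defined.

Lemma normal_form_ker x : lf_ker normal_form x = @H x.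
Proof. by apply/seteqP; split=> v /conormalP. Qed.

Lemma normal_form_nowhere_zero : nowhere_zero normal_form.
Proof.
have [_ corH _] := hypH.
by move=> x; have [u nHu _] := corH x; exists u; apply/eqP => /conormalP.
Qed.

End NormalBundle.

(** * Line bundle isomorphisms intertwining 1-forms *)

Section PushForward.
Context {R : realType} {M N : manifold R} (phi : diffeo M N).

Lemma dphi_linear x a (u v : tangent M x) :
  dphi phi (a *: u + v) = a *: dphi phi u + dphi phi v.
Proof. exact: tangent_eq. Qed.

Lemma is_diffeo_inv : is_diffeo (dinv phi) phi.
Proof. by case: phi => f g [fK gK sf sg]; split. Qed.

Lemma dphi_surj x (w : tangent N (phi x)) : exists v : tangent M x, dphi phi v = w.
Proof.
pose inv := Diffeo is_diffeo_inv.
have vP : (forall (a : R) (f g : cinf M), w (cinf_pull inv (a *: f + g)) =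
       a * w (cinf_pull inv f) + w (cinf_pull inv g)) /\
    (forall f g : cinf M, w (cinf_pull inv (f * g)) =
       f x * w (cinf_pull inv g) + g x * w (cinf_pull inv f)).
  by split=> *; rewrite ?cinf_pull_linear ?cinf_pullM ?tlinear ?tleibniz//= dmapK.
exists (Tangent vP); apply: tangent_eq => f /=; congr (w _).
by apply: cinf_eq => y /=; rewrite dinvK.
Qed.

Lemma dphi_inj x : injective (@dphi _ _ _ phi x).
Proof.
move=> u v uv; apply: tangent_eq => f.
have -> : f = cinf_pull phi (cinf_pull (Diffeo is_diffeo_inv) f).
  by apply: cinf_eq => y /=; rewrite dmapK.
exact: (congr1 (fun w : tangent N _ => w (cinf_pull (Diffeo is_diffeo_inv) f)) uv).
Qed.

End PushForward.

Section LineBundlePush.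
Context {R : realType} {M N : manifold R} {L1 : line_bundle M} {L2 : line_bundle N}.
Variable F : lb_iso L1 L2.
Implicit Types (D E : derivation L1).

Lemma der_pushE D (s : Gamma L2) : der_push F D s = sec_push F (D (sec_pull F s)).
Proof. by []. Qed.

Lemma der_push_sec D (s : Gamma L1) :
  der_push F D (sec_push F s) = sec_push F (D s).
Proof. by rewrite der_pushE sec_pushK. Qed.

Lemma symbol_push D : symbol (der_push F D) = vf_push F (symbol D).
Proof.
apply: symbol_eq => f s; rewrite der_pushE sec_pullZ symbolP sec_pushD sec_pushZ.
congr (_ + _).
have -> : vf_app (symbol D) (cinf_pull F f) =
    cinf_pull F (vf_app (vf_push F (symbol D)) f).
  by apply: cinf_eq => x /=; rewrite dmapK.
by rewrite sec_pushZ sec_pullK.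
Qed.

Lemma sec_pushN s : sec_push F (- s) = - sec_push F s.
Proof.
apply: sec_pushP => x; rewrite !secNE sec_pushE.
by rewrite -(scaleN1r (s x)) lb_scale scaleN1r.
Qed.

Lemma der_push_bracket D E :
  der_push F (der_bracket D E) = der_bracket (der_push F D) (der_push F E).
Proof.
apply: der_eq => s; rewrite bracketE !der_pushE bracketE !sec_pushK.
by rewrite sec_pushD sec_pushN.
Qed.

Lemma der_push_one : der_push F (der_one L1) = der_one L2.
Proof. by apply: der_eq => s; rewrite der_pushE sec_pullK. Qed.

(** The relation by which a morphism of symplectic Atiyah bundles is recognized on
    the contracted forms, see [preserves_intertwines] and [intertwines_dlf]. *)
Definition intertwines (th1 : lform (L := L1)) (th2 : lform (L := L2)) : Prop :=
  forall x (v : tangent M x), lb_fun F x (th1 x v) = th2 (F x) (dphi F v).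

Lemma intertwines_app (th1 : lform (L := L1)) (th2 : lform (L := L2)) X :
  intertwines th1 th2 ->
  sec_push F (lf_app th1 X) = lf_app th2 (vf_push F X).
Proof.
move=> Fth; apply: sec_pushP => x.
by rewrite -[LHS]/(th2 (F x) (vf_push F X (F x))) vf_push_dphi -Fth.
Qed.

Lemma intertwines_dlf (th1 : lform (L := L1)) (th2 : lform (L := L2)) D E :
  intertwines th1 th2 ->
  dlf th2 (der_push F D) (der_push F E) = sec_push F (dlf th1 D E).
Proof.
move=> Fth; rewrite !dlfE -der_push_bracket.
have lE D' : lf_der th2 (der_push F D') = sec_push F (lf_der th1 D').
  by rewrite /lf_der symbol_push (intertwines_app _ Fth).
by rewrite !lE !der_push_sec !sec_pushD !sec_pushN.
Qed.

(** The push-forward of derivations fixes the identity derivation. *)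
Lemma preserves_intertwines (w1 : atiyah2 L1) (w2 : atiyah2 L2) :
  (forall D E, w2 (der_push F D) (der_push F E) = sec_push F (w1 D E)) ->
  intertwines (contr w1) (contr w2).
Proof.
move=> Fw x v; have [D <-] := symbol_lift L1 v.
by rewrite contrE -vf_push_dphi -symbol_push contrE -der_push_one Fw sec_pushE.
Qed.

End LineBundlePush.

Lemma lf_surj (R : realType) (M : manifold R) (L : line_bundle M)
    (th : lform (L := L)) x (u : L x) : nowhere_zero th -> exists v, th x v = u.
Proof.
move=> nz; have [z thz] := nz x; have [a ->] := fiber_dim1 u thz.
by exists (a *: z); rewrite lfZ.
Qed.

Lemma intertwines_unique (R : realType) (M N : manifold R) (L1 : line_bundle M)
    (L2 : line_bundle N) (F G : lb_iso L1 L2) (th1 : lform (L := L1))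
    (th2 : lform (L := L2)) :
  nowhere_zero th1 -> intertwines F th1 th2 -> intertwines G th1 th2 ->
  lb_base F = lb_base G -> F = G.
Proof.
move=> nz; case: F => [phi F F' FP]; case: G => [psi G G' GP] + + /= e.
subst psi; rewrite /intertwines /= => Fth Gth.
have FG : F = G.
  apply/functional_extensionality_dep => x; apply/funext => u.
  by have [v <-] := lf_surj u nz; rewrite Fth Gth.
subst G; have FG' : F' = G'.
  apply/functional_extensionality_dep => x; apply/funext => u.
  have [_ FK _ _] := FP; have [_ _ GK _] := GP.
  by rewrite -{1}(GK x u) FK.
by subst G'; congr LbIso; exact: Prop_irrelevance.
Qed.

Section InducedIso.
Context {R : realType} {M N : manifold R} (phi : diffeo M N).
Context {L1 : line_bundle M} {L2 : line_bundle N}.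
Context {th1 : lform (L := L1)} {th2 : lform (L := L2)}.
Hypothesis nz1 : nowhere_zero th1.
Hypothesis nz2 : nowhere_zero th2.
Hypothesis kerP : forall x (v : tangent M x),
  th1 x v = 0 <-> th2 (phi x) (dphi phi v) = 0.

Lemma pushed_formB x (u v : tangent M x) :
  th2 (phi x) (dphi phi (u - v)) =
  th2 (phi x) (dphi phi u) - th2 (phi x) (dphi phi v).
Proof. by rewrite -lfB; congr (th2 _ _); exact: tangent_eq. Qed.

Lemma kernel_fibers x (u v : tangent M x) :
  th1 x u = th1 x v <-> th2 (phi x) (dphi phi u) = th2 (phi x) (dphi phi v).
Proof.
split=> /eqP; rewrite -subr_eq0 => /eqP uv; apply/eqP; rewrite -subr_eq0.
  by rewrite -pushed_formB; apply/eqP/kerP; rewrite lfB.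
by rewrite -lfB; apply/eqP/kerP; rewrite pushed_formB.
Qed.

(** The only map with F (th1 v) = th2 (dphi v): it is well defined because the two
    sides vanish for the same v. *)
Definition induced_fun x (u : L1 x) : L2 (phi x) :=
  th2 (phi x) (dphi phi (projT1 (cid (lf_surj u nz1)))).

Lemma induced_funE x (v : tangent M x) :
  induced_fun (th1 x v) = th2 (phi x) (dphi phi v).
Proof. by rewrite /induced_fun; case: cid => w /= /kernel_fibers. Qed.

Lemma pushed_form_surj x (w : L2 (phi x)) :
  exists v : tangent M x, th2 (phi x) (dphi phi v) = w.
Proof.
have [v <-] := lf_surj w nz2; have [u <-] := dphi_surj v.
by exists u.
Qed.

Definition induced_inv x (w : L2 (phi x)) : L1 x :=
  th1 x (projT1 (cid (pushed_form_surj w))).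

Lemma induced_invE x (v : tangent M x) :
  induced_inv (th2 (phi x) (dphi phi v)) = th1 x v.
Proof. by rewrite /induced_inv; case: cid => w /= /kernel_fibers. Qed.

Lemma induced_fun_linear x : linear (@induced_fun x).
Proof.
move=> a u v; have [u' <-] := lf_surj u nz1; have [v' <-] := lf_surj v nz1.
by rewrite -lf_linear !induced_funE dphi_linear lf_linear.
Qed.

(** Near x a trivialization s of L1 is a smooth multiple of th1 Z, for a field Z
    with th1 (Z x) <> 0, and th1 Z is mapped to th2 (phi_* Z). *)
Lemma induced_smooth s t : trivs s -> trivs t ->
  exists2 g : M -> R, msmooth (s.1 `&` phi @^-1` t.1) g &
    forall x, s.1 x -> t.1 (phi x) ->
      induced_fun (s.2 x : L1 x) = g x *: (t.2 (phi x) : L2 (phi x)).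
Proof.
move=> Ts Tt.
have oP (U : set N) : open U -> open (phi @^-1` U).
  by move=> oU; apply: open_comp => // x _; have [+ _] := dmap_smooth phi; exact.
have oU : open (s.1 `&` phi @^-1` t.1).
  by apply: openI; [exact: triv_open|exact/oP/triv_open].
have Fscale x a u : induced_fun (a *: u) = a *: induced_fun u :> L2 (phi x).
  have [v <-] := lf_surj u nz1; rewrite -lfZ !induced_funE -lfZ; congr (th2 _ _).
  exact: tangent_eq.
have [g sg gP] : exists2 g, msmooth (s.1 `&` phi @^-1` t.1) g &
    forall x, (s.1 `&` phi @^-1` t.1) x ->
      induced_fun (s.2 x : L1 x) = g x *: (t.2 (phi x) : L2 (phi x)).
  apply: (msmooth_glue (P := fun x a =>
    induced_fun (s.2 x : L1 x) = a *: t.2 (phi x))) => //.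
    by move=> x a b [_ tx] -> /(triv_inj Tt tx).
  move=> x [sx tx]; have [v thv] := nz1 x; have [Z Zx] := vfield_extend v.
  have [h sh hP] := sec_smooth (lf_app th1 Z) Ts.
  have [g sg gP] := sec_smooth (lf_app th2 (vf_push phi Z)) Tt.
  have [h' h'P] := cinf_extend (triv_open Ts) sx sh.
  have h'x : h' x != 0.
    rewrite (nbhs_singleton h'P); apply: contra thv => /eqP hx.
    by have := hP x sx; rewrite hx scale0r /= Zx => ->.
  have [k kP] := near_inverse h'x.
  have : nbhs x [set y | k y * h y = 1] by apply: filterS2 h'P kP => y /= ->.
  rewrite nbhsE => -[V [oV Vx] VP].
  exists (V `&` (s.1 `&` phi @^-1` t.1)); split=> //; first exact: openI.
  exists (fun y => k y * g (phi y)).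
    apply: msmoothM; first exact: openI.
      by apply: msmooth_sub (cinf_smooth k).
    apply: msmooth_sub (msmooth_comp (dmap_smooth phi) (triv_open Tt) sg).
    by move=> y [_ []].
  move=> y [Vy [sy ty]].
  have -> : s.2 y = k y *: th1 y (Z y).
    by have := hP y sy => /= ->; rewrite scalerA (VP y Vy) scale1r.
  rewrite Fscale induced_funE -vf_push_dphi -scalerA; congr (_ *: _).
  exact: (gP (phi y) ty).
by exists g => // x sx tx; exact: gP.
Qed.

Lemma induced_isoP :
  is_lb_iso (L1 := L1) (L2 := L2) (phi := phi) induced_fun induced_inv.
Proof.
split; [exact: induced_fun_linear| | |exact: induced_smooth] => x u.
  by have [v <-] := lf_surj u nz1; rewrite induced_funE induced_invE.
by have [v <-] := pushed_form_surj u; rewrite induced_invE induced_funE.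
Qed.

Definition induced_iso : lb_iso L1 L2 := LbIso induced_isoP.

Lemma induced_iso_intertwines : intertwines induced_iso th1 th2.
Proof. by move=> x v; exact: induced_funE. Qed.

End InducedIso.

(** * The equivalence of categories *)

Section CategoryTheory.
Variables (C D : category) (G : functor D C).

(** The inverse functor chooses for each c an object with an isomorphism i c from
    its image to c, and lifts the conjugate of f by these isomorphisms; i is the
    first natural isomorphism, and its lift the second. *)
Lemma fully_faithful_equivalence :
  (forall A B (h : hom (G A) (G B)), exists f : hom A B, fmap G f = h) ->
  (forall A B (f g : hom A B), fmap G f = fmap G g -> f = g) ->
  (forall c : C, exists (A : D) (i : hom (G A) c), is_iso i) ->
  equivalent_categories C D.
Proof.
move=> full faith ess.
have pre A B (h : hom (G A) (G B)) : {f : hom A B | fmap G f = h} by exact/cid/full.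
have essT c : {A : D & {i : hom (G A) c & {j : hom c (G A) |
    compm j i = idm _ /\ compm i j = idm _}}}.
  by have [A /cid[i /cid[j ij]]] := cid (ess c); exists A, i, j.
pose F0 c := projT1 (essT c).
pose i c : hom (G (F0 c)) c := projT1 (projT2 (essT c)).
pose j c : hom c (G (F0 c)) := proj1_sig (projT2 (projT2 (essT c))).
have ji c : compm (j c) (i c) = idm _ := (proj2_sig (projT2 (projT2 (essT c)))).1.
have ij c : compm (i c) (j c) = idm _ := (proj2_sig (projT2 (projT2 (essT c)))).2.
pose F1 c d (f : hom c d) : hom (F0 c) (F0 d) :=
  proj1_sig (pre _ _ (compm (j d) (compm f (i c)))).
have F1E c d f : fmap G (F1 c d f) = compm (j d) (compm f (i c)).
  by rewrite /F1; case: (pre _ _ _).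
have F1id c : F1 c c (idm c) = idm (F0 c).
  by apply: faith; rewrite F1E fmap_id comp1m ji.
have F1comp c d e (g : hom d e) (f : hom c d) :
    F1 c e (compm g f) = compm (F1 d e g) (F1 c d f).
  apply: faith; rewrite fmap_comp !F1E !compmA; congr (compm (compm _ f) _).
  by rewrite -!compmA ij compm1.
pose F : functor C D := @Functor C D F0 F1 F1id F1comp.
exists F, G; split.
  exists i; split=> [c|c d f]; first by exists (j c); rewrite ji ij.
  by rewrite /= F1E compmA ij comp1m.
pose eta A : hom (F0 (G A)) A := proj1_sig (pre _ _ (i (G A))).
have etaE A : fmap G (eta A) = i (G A) by rewrite /eta; case: (pre _ _ _).
exists eta; split=> [A|A B f].
  exists (proj1_sig (pre _ _ (j (G A)))); case: (pre _ _ _) => jA /= jE.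
  by split; apply: faith; rewrite fmap_comp fmap_id etaE jE.
by apply: faith; rewrite /= !fmap_comp !etaE F1E compmA ij comp1m.
Qed.

End CategoryTheory.

Lemma atiyah2_eq (R : realType) (M : manifold R) (L : line_bundle M)
    (w w' : atiyah2 L) :
  (forall D E, w D E = w' D E) -> w = w'.
Proof.
case: w w' => [w wl wr wa] [w' wl' wr' wa'] /= ww'.
have E : w = w' by apply/funext => D; apply/funext => E; exact: ww'.
subst w'; congr Atiyah2; exact: Prop_irrelevance.
Qed.

Section Kernel.
Variable R : realType.
Implicit Types A B : symplectic_atiyah_bundle R.

Definition sab_one_form A := contr (sab_form A).

Lemma sab_one_form_nowhere_zero A : nowhere_zero (sab_one_form A).
Proof.
by case: (sab_symplectic A) => _ /nondegenerate_pointwise/contr_nowhere_zero.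
Qed.

Lemma sab_formE A D E : sab_form A D E = dlf (sab_one_form A) D E.
Proof. by apply: closed_dcontr; case: (sab_symplectic A). Qed.

Lemma sab_form_dlf A : sab_form A = dlf (sab_one_form A).
Proof. by apply: atiyah2_eq => D E; exact: sab_formE. Qed.

Lemma sab_kernel_contact A : contact_structure (lf_ker (sab_one_form A)).
Proof.
apply/contact_symplecticP; first exact: sab_one_form_nowhere_zero.
by rewrite -sab_form_dlf; exact: sab_symplectic.
Qed.

Definition kernel_obj A : contact_manifold R :=
  ContactManifold (@sab_kernel_contact A).

Lemma sam_intertwines A B (f : symplectic_atiyah_morphism A B) :
  intertwines f (sab_one_form A) (sab_one_form B).
Proof. exact: preserves_intertwines (samP f). Qed.

Lemma kernel_mapP A B (f : symplectic_atiyah_morphism A B) :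
  @maps_dist R (kernel_obj A) (kernel_obj B) (lb_base f).
Proof.
move=> x; have fth := @sam_intertwines A B f x.
have f0 : lb_fun f x 0 = 0 by rewrite -(scale0r 0) lb_scale scale0r.
apply/seteqP; split=> [_ [v thv <-]|w thw].
  by have := fth v; rewrite (thv : sab_one_form A x v = 0) f0 => /esym.
have [v vw] := dphi_surj w; exists v => //.
apply: (can_inj (lb_funK f (x := x))); rewrite f0.
by have := fth v; rewrite vw (thw : sab_one_form B _ w = 0).
Qed.

Definition kernel_mor A B (f : symplectic_atiyah_morphism A B) :
    contactomorphism (kernel_obj A) (kernel_obj B) :=
  @Contactomorphism R (kernel_obj A) (kernel_obj B) (lb_base f) (kernel_mapP f).

Program Definition kernel_functor :
    functor (symplectic_atiyah_category R) (contact_category R) :=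
  @Functor (symplectic_atiyah_category R) (contact_category R)
    kernel_obj kernel_mor _ _.
Next Obligation. by move=> A; apply: cto_eq. Qed.
Next Obligation. by move=> A B C g f; apply: cto_eq. Qed.

(** Both isomorphisms intertwine the same forms, and th is onto. *)
Lemma kernel_faithful A B (f g : symplectic_atiyah_morphism A B) :
  kernel_mor f = kernel_mor g -> f = g.
Proof.
move=> /(congr1 (fun h : contactomorphism _ _ => cto_diffeo h)) /= fg.
apply: sam_eq; apply: intertwines_unique fg.
- exact: sab_one_form_nowhere_zero.
- exact: sam_intertwines.
- exact: sam_intertwines.
Qed.

Lemma kernel_full A B (h : contactomorphism (kernel_obj A) (kernel_obj B)) :
  exists f : symplectic_atiyah_morphism A B, kernel_mor f = h.
Proof.
have kerP x (v : tangent (sab_base A) x) :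
    sab_one_form A x v = 0 <-> sab_one_form B (h x) (dphi h v) = 0.
  have /seteqP[h1 h2] := ctoP h x; split=> [thv|thv]; first by apply: h1; exists v.
  have [u thu uv] := h2 _ thv.
  by rewrite -(dphi_inj uv).
pose F := induced_iso (@sab_one_form_nowhere_zero A)
  (@sab_one_form_nowhere_zero B) kerP.
have FP : preserves_form (A := A) (B := B) F.
  move=> D E; rewrite !sab_formE; apply: intertwines_dlf.
  exact: induced_iso_intertwines.
exists (SymplecticAtiyahMorphism FP); exact: cto_eq.
Qed.

(** Take the normal line bundle of the contact distribution, with the differential
    of the projection; its contraction with 1 is the projection again. *)
Lemma kernel_surjective (c : contact_category R) :
  exists (A : symplectic_atiyah_category R) (i : hom (kernel_functor A) c), is_iso i.
Proof.
have [hyp cn] := cm_contact c.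
pose th := normal_form hyp.
have nz : nowhere_zero th by exact: normal_form_nowhere_zero.
have kerE x : lf_ker th x = @cm_dist R c x by exact: normal_form_ker.
have sym : symplectic_atiyah (dlf th).
  apply/contact_symplecticP => //.
  have -> : lf_ker th = @cm_dist R c.
    by apply/functional_extensionality_dep => x.
  exact: cm_contact.
pose A : symplectic_atiyah_category R := SymplecticAtiyahBundle sym.
have kerA x : @cm_dist R (kernel_obj A) x = @cm_dist R c x.
  rewrite -kerE; apply/seteqP; split=> v thv.
    by apply: etrans thv; apply/esym; exact: contr_dlf.
  by apply: etrans thv; exact: contr_dlf.
exists A.
have did x (v : tangent (sab_base A) x) : dphi (diffeo_id _) v = v.
  by apply: tangent_eq => f; congr (v _); exact: cinf_eq.
pose c' : contact_category R := kernel_obj A.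
have toP : @maps_dist R c' c (diffeo_id _).
  move=> x; rewrite -kerA; apply/seteqP; split=> [_ [v vH <-]|v vH].
    by rewrite did.
  by exists v.
have fromP : @maps_dist R c c' (diffeo_id _).
  move=> x; rewrite kerA; apply/seteqP; split=> [_ [v vH <-]|v vH].
    by rewrite did.
  by exists v.
exists (Contactomorphism toP), (Contactomorphism fromP).
by split; apply: cto_eq; exact: diffeo_proof_irrelevance.
Qed.

End Kernel.

Theorem theorem4p2 (R : realType) :
  equivalent_categories (contact_category R) (symplectic_atiyah_category R).
Proof.
apply: (fully_faithful_equivalence (G := kernel_functor R)).
- exact: kernel_full.
- exact: kernel_faithful.
- exact: kernel_surjective.
Qed.
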